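(* Let $N\ge2$, $1<p<\infty$, let $\Omega\subsetneq\mathbb{R}^N$ be any domain, and let $(V,W)$ be a positive pair of $C^1$ functions. If $(V,W)$ is a $p$-Bessel pair on $(0,R)$ with positive solution $\varphi$, for some $R>\frac12D_\infty(\Omega)$, or $R=\infty$ if $D_\infty(\Omega)=\infty$, then for all $u\in C_0^\infty(\Omega)$ $$\int_\Omega\tilde V_{M,p}|\nabla u|^pdx=\int_\Omega W_{M,p}|u|^pdx+2\,\mathcal S_\Omega\!\left[V(\rho_\nu)\left|\frac{\varphi'(\rho_\nu)}{\varphi(\rho_\nu)}\right|^{p-2}\frac{\varphi'(\rho_\nu)}{\varphi(\rho_\nu)}|u|^p\right]+\int_{S^{N-1}}\int_\Omega V(\rho_\nu)\,C_p\!\left(\partial_\nu u,\ \varphi(\rho_\nu)\partial_\nu\!\left(\frac{u}{\varphi(\rho_\nu)}\right)\right)dx\,d\sigma(\nu)$$ and $$\int_\Omega V_{M,p}|\nabla u|^pdx\ge\int_\Omega W_{M,p}|u|^pdx+2\,\mathcal S_\Omega\!\left[V(\rho_\nu)\left|\frac{\varphi'(\rho_\nu)}{\varphi(\rho_\nu)}\right|^{p-2}\frac{\varphi'(\rho_\nu)}{\varphi(\rho_\nu)}|u|^p\right]+\int_{S^{N-1}}\int_\Omega V(\rho_\nu)\,C_p\!\left(\partial_\nu u,\ \varphi(\rho_\nu)\partial_\nu\!\left(\frac{u}{\varphi(\rho_\nu)}\right)\right)dx\,d\sigma(\nu).$$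
   Context: For $0<R\le\infty$ and $1<p<\infty$, a pair $(V,W)$ of positive $C^1$ functions on $(0,R)$ is a $p$-Bessel pair on $(0,R)$ if the ODE $(V|y'|^{p-2}y')'+W|y|^{p-2}y=0$ has a positive $C^1$ solution $\varphi$ on $(0,R)$; such a $\varphi$ is called a positive solution of the pair. Convention: if $1<p<2$, $\varphi'$ is assumed to have constant sign on $(0,R)$. For $x,y\in\mathbb{R}^k$, $C_p(x,y)=|x|^p-|x-y|^p-p|x-y|^{p-2}(x-y)\cdot y$. For $\nu\in S^{N-1}$ and $x\in\Omega$, $\rho_\nu(x)=\inf\{|s|: s\in\mathbb{R},\ x+s\nu\notin\Omega\}$ is the distance from $x$ to $\partial\Omega$ along the line through $x$ in the direction $\nu$; $\partial_\nu$ is the directional derivative; $d\sigma$ is the normalized round measure on $S^{N-1}$. The spherical means are $$\tilde V_{M,p}(x)=\int_{S^{N-1}}V(\rho_\nu(x))|\cos(\nu,\vec e)|^p\,d\sigma(\nu),\quad V_{M,p}(x)=\int_{S^{N-1}}V(\rho_\nu(x))\,d\sigma(\nu),\quad W_{M,p}(x)=\int_{S^{N-1}}W(\rho_\nu(x))\,d\sigma(\nu),$$ where $\vec e$ is any fixed unit vector in $\mathbb{R}^N$ and $(a,b)$ denotes the angle between $a$ and $b$. For $\nu\in S^{N-1}$ and $x'\in\nu^\perp\cong\mathbb{R}^{N-1}$, $[x',\nu]$ is the family of connected components (open segments, possibly infinite) of the intersection of $\Omega$ with the line $\{x'+s\nu:s\in\mathbb{R}\}$; $D_{x',\nu}\in[0,\infty]$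 is the supremum of the lengths of the elements of $[x',\nu]$, and the essential diameter of $\Omega$ is $D_\infty(\Omega)=\operatorname{ess\,sup}_{\nu\in S^{N-1}}\operatorname{ess\,sup}_{x'\in\nu^\perp}D_{x',\nu}$. For $\ell\in[x',\nu]$ let $m_\ell$ be the midpoint of $\ell$ if $\ell$ is bounded, and $m_\ell=\infty$ otherwise, with the convention $f(\infty)=0$ for compactly supported $f$. The $\nu$-skeleton is $\Sigma_\nu=\overline{\{m_\ell:\ell\in[x',\nu],x'\in\nu^\perp\}}\cap\Omega$, and $\mu_\nu$ is the Radon measure on $\Sigma_\nu$ with $\int_{\Sigma_\nu}f\,d\mu_\nu=\int_{\nu^\perp}\sum_{\ell\in[x',\nu]}f(m_\ell)\,dx'$ for $f\in C_0(\Omega)$ (continuous with compact support). The spherical skeletal mean is $\mathcal S_\Omega[f]=\int_{S^{N-1}}\int_{\Sigma_\nu}f(m)\,d\mu_\nu(m)\,d\sigma(\nu)$, where the integrand may depend on $\nu$.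
   Formalization: First identity is false for fixed e when Ṽ depends on e: proved for fixed e if Ṽ is independent of e, else with e the direction of ∇u(x). Identities exclude right sides ∞−∞ (possible only if D_∞=∞). At ρ=∞: W=0, φ=1, V any constant ≥0. *)

(* Defs.v *)
From HB Require Import structures.
From mathcomp Require Import all_boot all_order all_algebra.
From mathcomp Require Import all_classical all_reals all_analysis.
From mathcomp Require Import measurable_realfun ess_sup_inf.

Set Implicit Arguments.
Unset Strict Implicit.
Unset Printing Implicit Defensive.

Import Order.TTheory GRing.Theory Num.Theory.
Import numFieldNormedType.Exports.

Local Open Scope classical_set_scope.
Local Open Scope ring_scope.
Local Open Scope ereal_scope.

(* The sigma-algebra of 'rV[R]_n is generated by the coordinate functions; it
   is the Borel sigma-algebra of R^n. *)
Definition rV_display : measure_display -> measure_display.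
Proof. exact. Qed.

Section measurable_rV.
Context {R : realType} (n : nat).

Definition coord_rV (i : 'I_n) (x : 'rV[R]_n) : measurableTypeR R := x ord0 i.

Let rV_set0 : g_sigma_preimage coord_rV set0.
Proof. exact: sigma_algebra0. Qed.

Let rV_setC A : g_sigma_preimage coord_rV A -> g_sigma_preimage coord_rV (~` A).
Proof. exact: sigma_algebraC. Qed.

Let rV_bigcup (F : _^nat) : (forall i, g_sigma_preimage coord_rV (F i)) ->
  g_sigma_preimage coord_rV (\bigcup_i (F i)).
Proof. exact: sigma_algebra_bigcup. Qed.

HB.instance Definition _ := @isMeasurable.Build (rV_display default_measure_display)
  'rV[R]_n (g_sigma_preimage coord_rV) rV_set0 rV_setC rV_bigcup.

Lemma measurable_coord_rV (i : 'I_n) : measurable_fun [set: 'rV[R]_n] (coord_rV i).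
Proof.
move=> _ Y mY; rewrite setTI; apply: sub_sigma_algebra => /=.
rewrite -bigcup_seq/=; exists i => /=; first by rewrite mem_index_enum.
by exists Y => //; rewrite setTI.
Qed.

Lemma measurable_fun_rV d (T : measurableType d) (f : T -> 'rV[R]_n) :
  (forall i, measurable_fun [set: T] (coord_rV i \o f)) ->
  measurable_fun [set: T] f.
Proof.
move=> mf _ A mA.
suff : g_sigma_preimage (fun i => coord_rV i \o f) `<=` measurable.
  by rewrite g_sigma_preimage_comp; apply; exists A.
apply: smallest_sub; first exact: sigma_algebra_measurable.
rewrite -bigcup_seq; apply: bigcup_sub => i _ B [C mC <-]; exact: mf.
Qed.

End measurable_rV.

Section lebesgue_measure_rV.
Context {R : realType}.

Section step.
Variable n : nat.

Definition cons_rV (z : measurableTypeR R * 'rV[R]_n) : 'rV[R]_n.+1 :=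
  row_mx (const_mx z.1 : 'rV_1) z.2.

Lemma measurable_cons_rV : measurable_fun [set: _] cons_rV.
Proof.
apply: measurable_fun_rV => i; rewrite -(@splitK 1 n i).
case: (fintype.split _) => j /=.
  rewrite (_ : _ \o _ = fst)//.
  by apply/funext => z; rewrite /= /coord_rV [LHS](@row_mxEl _ 1 1 n) mxE.
rewrite (_ : _ \o _ = coord_rV j \o snd); last first.
  by apply/funext => z; rewrite /= /coord_rV [LHS](@row_mxEr _ 1 1 n).
by apply: measurableT_comp => //; exact: measurable_coord_rV.
Qed.

Variable m : {sigma_finite_measure set 'rV[R]_n -> \bar R}.

Definition lebesgueS : set 'rV[R]_n.+1 -> \bar R :=
  pushforward (@lebesgue_measure R \x m) cons_rV.

Let lebesgueS0 : lebesgueS set0 = 0.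
Proof. by rewrite /lebesgueS /pushforward preimage_set0 measure0. Qed.

Let lebesgueS_ge0 A : 0 <= lebesgueS A.
Proof. by rewrite /lebesgueS /pushforward measure_ge0. Qed.

Let lebesgueS_sigma_additive : semi_sigma_additive lebesgueS.
Proof.
move=> F mF tF mUF; rewrite /lebesgueS /pushforward preimage_bigcup.
apply: measure_semi_sigma_additive.
- by move=> k; rewrite -[X in measurable X]setTI; exact: measurable_cons_rV.
- apply/trivIsetP => /= i j _ _ ij; rewrite -preimage_setI.
  by move/trivIsetP : tF => /(_ _ _ _ _ ij) ->//; rewrite preimage_set0.
- rewrite -preimage_bigcup -[X in measurable X]setTI.
  exact: measurable_cons_rV.
Qed.

HB.instance Definition _ := isMeasure.Build _ _ _ lebesgueS
  lebesgueS0 lebesgueS_ge0 lebesgueS_sigma_additive.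

Let uncons_rV (x : 'rV[R]_n.+1) : measurableTypeR R * 'rV[R]_n :=
  (lsubmx (x : 'rV_(1 + n)) ord0 ord0, rsubmx (x : 'rV_(1 + n))).

Let cons_rVK : cancel cons_rV uncons_rV.
Proof.
by move=> [t v]; rewrite /uncons_rV /cons_rV row_mxKl row_mxKr mxE.
Qed.

Let measurable_uncons_rV : measurable_fun [set: _] uncons_rV.
Proof.
apply/measurable_fun_pair.
  apply: (eq_measurable_fun (coord_rV (@lshift 1 n ord0))) => [x _|].
    by rewrite /coord_rV mxE.
  exact: measurable_coord_rV.
apply: measurable_fun_rV => i.
apply: (eq_measurable_fun (coord_rV (@rshift 1 n i))) => [x _|].
  by rewrite /= /coord_rV mxE.
exact: measurable_coord_rV.
Qed.

Let lebesgueS_sigma_finite : sigma_finite [set: 'rV[R]_n.+1] lebesgueS.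
Proof.
have /sigma_finiteP[F [TF ndF Foo]] := sigma_finiteT (@lebesgue_measure R).
have /sigma_finiteP[G [TG ndG Goo]] := sigma_finiteT m.
exists (fun k => uncons_rV @^-1` (F k `*` G k)).
  rewrite -preimage_bigcup (_ : \bigcup_k _ = setT) ?preimage_setT//.
  rewrite -subTset => -[x y] _.
  have [i _ Fx] : (\bigcup_k F k) x by rewrite -TF.
  have [j _ Gy] : (\bigcup_k G k) y by rewrite -TG.
  exists (maxn i j) => //; split.
    by move: x Fx; exact/subsetPset/ndF/leq_maxl.
  by move: y Gy; exact/subsetPset/ndG/leq_maxr.
move=> k; have [mF Fk] := Foo k; have [mG Gk] := Goo k; split.
  rewrite -[X in measurable X]setTI; apply: measurable_uncons_rV => //.
  exact: measurableX.
rewrite /lebesgueS /pushforward -comp_preimage (_ : _ \o _ = id); last first.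
  exact/funext.
by rewrite preimage_id product_measure1E// lte_mul_pinfty// ge0_fin_numE.
Qed.

HB.instance Definition _ := Measure_isSigmaFinite.Build _ _ _ lebesgueS
  lebesgueS_sigma_finite.

End step.

Fixpoint lebesgue_rV n : {sigma_finite_measure set 'rV[R]_n -> \bar R} :=
  match n with
  | 0 => \d_(0%R : 'rV[R]_0)
  | n'.+1 => lebesgueS (lebesgue_rV n')
  end.

End lebesgue_measure_rV.

Section euclidean.
Context {R : realType} {N : nat}.
Implicit Types x y : 'rV[R]_N.

(* The norm `|x| of 'rV[R]_N in the library is the sup norm. *)
Definition dotp x y : R := (\sum_i x ord0 i * y ord0 i)%R.
Definition enorm x : R := Num.sqrt (dotp x x).
Definition cosang x y : R := (dotp x y / (enorm x * enorm y))%R.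

Definition usphere : set 'rV[R]_N := [set x | enorm x = 1%R].
Definition punctured_ball : set 'rV[R]_N := [set x | (0 < enorm x <= 1)%R].
Definition to_sphere x : 'rV[R]_N := ((enorm x)^-1 *: x)%R.

Lemma measurable_enorm :
  measurable_fun [set: 'rV[R]_N] enorm.
Proof.
apply: measurableT_comp.
  by apply: continuous_measurable_fun; exact: sqrt_continuous.
apply: measurable_sum => i.
by apply: measurable_funM; exact: measurable_coord_rV.
Qed.

Lemma measurable_to_sphere : measurable_fun [set: 'rV[R]_N] to_sphere.
Proof.
apply: measurable_fun_rV => i.
apply: (eq_measurable_fun (fun x => enorm x `^ (-1) * coord_rV i x)%R) => [x _|].
  by rewrite /= /coord_rV mxE powR_inv1// sqrtr_ge0.
apply: measurable_funM; last exact: measurable_coord_rV.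
exact: (measurableT_comp (measurable_powR (R := R) (-1)) measurable_enorm).
Qed.

Lemma measurable_punctured_ball : measurable punctured_ball.
Proof.
rewrite (_ : punctured_ball = enorm @^-1` `]0%R, 1%R]); last first.
  by apply/seteqP; split => x /=; rewrite in_itv.
by rewrite -[X in measurable X]setTI; apply: measurable_enorm => //.
Qed.

Definition cone_measure (A : set 'rV[R]_N) : \bar R :=
  lebesgue_rV N (punctured_ball `&` to_sphere @^-1` A).

Let measurable_cone A : measurable A ->
  measurable (punctured_ball `&` to_sphere @^-1` A).
Proof.
move=> mA; apply: measurableI; first exact: measurable_punctured_ball.
by rewrite -[X in measurable X]setTI; exact: measurable_to_sphere.
Qed.

Let cone_measure0 : cone_measure set0 = 0.
Proof. by rewrite /cone_measure preimage_set0 setI0 measure0. Qed.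

Let cone_measure_ge0 A : 0 <= cone_measure A.
Proof. exact: measure_ge0. Qed.

Let cone_measure_sigma_additive : semi_sigma_additive cone_measure.
Proof.
move=> F mF tF mUF; rewrite /cone_measure preimage_bigcup setI_bigcupr.
apply: measure_semi_sigma_additive.
- by move=> k; exact: measurable_cone.
- apply: trivIset_setIl; apply/trivIsetP => /= i j _ _ ij.
  rewrite -preimage_setI.
  by move/trivIsetP : tF => /(_ _ _ _ _ ij) ->//; rewrite preimage_set0.
- by rewrite -setI_bigcupr -preimage_bigcup; exact: measurable_cone.
Qed.

HB.instance Definition _ := isMeasure.Build _ _ _ cone_measure
  cone_measure0 cone_measure_ge0 cone_measure_sigma_additive.

Lemma inv_ball_ge0 : (0 <= (fine (lebesgue_rV N punctured_ball))^-1)%R.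
Proof. by rewrite invr_ge0 fine_ge0. Qed.

(* The normalized round measure on the unit sphere is the cone measure
     A |-> |{x in B : x / |x| \in A}| / |B|,  B the punctured unit ball,
   seen as a measure on R^N concentrated on the sphere. *)
Definition sphere_measure : set 'rV[R]_N -> \bar R :=
  mscale (NngNum inv_ball_ge0) cone_measure.

HB.instance Definition _ := Measure.on sphere_measure.

End euclidean.

Section domain.
Context {R : realType} {N : nat}.
Implicit Types (Omega : set 'rV[R]_N) (x nu m : 'rV[R]_N).

Definition domain Omega : Prop := [/\ open Omega, connected Omega & Omega !=set0].

(* +oo when the whole line x + R nu is contained in Omega *)
Definition rho Omega nu x : \bar R :=
  ereal_inf [set `|s|%:E | s in [set s : R | ~ Omega (x + s *: nu)%R]].

(* An orthonormal frame of the hyperplane orthogonal to the unit vector nu: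
   y |-> y *m frame nu is a linear isometry from R^(N-1) onto it, through which
   the hyperplane carries the (N-1)-dimensional Lebesgue measure. *)
Definition frame nu : 'M[R]_(N.-1, N) :=
  xget 0%R [set J : 'M[R]_(N.-1, N) | J *m J^T = 1%:M /\ J *m nu^T = 0%R].

(* The line x' + R nu is identified with R by s |-> x' + s nu, so that the
   elements of [x', nu] are subsets of R. *)
Definition segments Omega x' nu : set (set R) :=
  let chord := [set s : R | Omega (x' + s *: nu)%R] in
  [set connected_component chord s | s in chord].

Definition seg_length (l : set R) : \bar R :=
  ereal_sup [set (t - s)%:E | s in l & t in l].

(* D_(x', nu), a supremum in [0, +oo] *)
Definition chord_diam Omega x' nu : \bar R :=
  ereal_sup (0 |` [set seg_length l | l in segments Omega x' nu]).

Definition ess_diam Omega : \bar R :=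
  ess_sup sphere_measure (fun nu : 'rV[R]_N =>
    ess_sup (lebesgue_rV N.-1) (fun y : 'rV[R]_N.-1 =>
      chord_diam Omega (y *m frame nu)%R nu)).

(* None stands for the point at infinity *)
Definition midpoint x' nu (l : set R) : option 'rV[R]_N :=
  if `[< has_ubound l /\ has_lbound l >]
  then Some (x' + ((inf l + sup l) / 2) *: nu)%R else None.

Definition skeleton Omega nu : set 'rV[R]_N :=
  closure [set m | exists x' l, [/\ dotp x' nu = 0%R,
    segments Omega x' nu l & midpoint x' nu l = Some m]] `&` Omega.

Definition compactly_supported Omega (f : 'rV[R]_N -> R) : Prop :=
  compact (closure [set x | f x != 0%R]) /\
  closure [set x | f x != 0%R] `<=` Omega.

(* mu is the Radon measure mu_nu on the nu-skeleton (on a relatively closed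
   subset of Omega, a Borel measure is Radon iff it is finite on compact sets).
   Only finitely many terms of the sum are nonzero. *)
Definition skeletal_measure Omega nu (mu : {measure set 'rV[R]_N -> \bar R}) :=
  (forall K, compact K -> K `<=` Omega -> mu (K `&` skeleton Omega nu) < +oo) /\
  (forall f : 'rV[R]_N -> R, continuous f -> compactly_supported Omega f ->
    \int[mu]_(m in skeleton Omega nu) (f m)%:E =
    \int[lebesgue_rV N.-1]_y
      (\sum_(l \in segments Omega (y *m frame nu)%R nu)
         oapp f 0%R (midpoint (y *m frame nu)%R nu l))%R%:E).

Definition skeletal_mean Omega (mu : 'rV[R]_N -> {measure set 'rV[R]_N -> \bar R})
    (f : 'rV[R]_N -> 'rV[R]_N -> R) : \bar R :=
  \int[sphere_measure]_(nu in usphere)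
    \int[mu nu]_(m in skeleton Omega nu) (f nu m)%:E.

Definition partial (i : 'I_N) (f : 'rV[R]_N -> R) : 'rV[R]_N -> R :=
  'D_(delta_mx ord0 i) f.

Definition smooth (f : 'rV[R]_N -> R) : Prop :=
  forall (s : seq 'I_N) x, differentiable (foldr partial f s) x.

Definition test_function Omega (u : 'rV[R]_N -> R) : Prop :=
  smooth u /\ compactly_supported Omega u.

Definition grad (f : 'rV[R]_N -> R) x : 'rV[R]_N := (\row_i partial i f x)%R.

End domain.

Section bessel.
Context {R : realType}.
Implicit Types (p : R) (V W phi : R -> R) (Rad : \bar R).
Local Open Scope ring_scope.

(* |y|^(p-2) y, equal to 0 at y = 0 for every p > 1 since 0 `^ a is 0 or 1 *)
Definition signed_pow p (y : R) : R := `|y| `^ (p - 2) * y.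

Definition interval0 Rad : set R := [set r | 0 < r /\ (r%:E < Rad)%E].

Definition C1_on Rad (f : R -> R) : Prop :=
  forall r, interval0 Rad r -> derivable f r 1 /\ {for r, continuous (derive1 f)}.

Definition positive_solution p Rad V W phi : Prop :=
  [/\ forall r, interval0 Rad r -> 0 < phi r,
      C1_on Rad phi,
      forall r, interval0 Rad r ->
        let F := fun s => V s * signed_pow p (derive1 phi s) in
        derivable F r 1 /\ derive1 F r + W r * signed_pow p (phi r) = 0 &
      p < 2 -> forall r s, interval0 Rad r -> interval0 Rad s ->
        Num.sg (derive1 phi r) = Num.sg (derive1 phi s)].

Definition bessel_pair p Rad V W : Prop :=
  [/\ forall r, interval0 Rad r -> 0 < V r /\ 0 < W r,
      C1_on Rad V, C1_on Rad W &
      exists phi, positive_solution p Rad V W phi].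

Definition Cp p (x y : R) : R :=
  `|x| `^ p - `|x - y| `^ p - p * (signed_pow p (x - y) * y).

(* f(rho), with the value finf when rho = +oo *)
Definition at_rho (finf : R) (f : R -> R) (r : \bar R) : R :=
  if r is s%:E then f s else finf.

End bessel.

Section means.
Context {R : realType} {N : nat}.
Implicit Types (Omega : set 'rV[R]_N) (x e nu : 'rV[R]_N) (p : R).

(* The value Vinf of V on lines that stay inside Omega is a parameter.
   mean_cos depends on the direction e in general, since rho depends on nu. *)
Definition mean_cos p Vinf (V : R -> R) Omega e x : \bar R :=
  \int[sphere_measure]_(nu in usphere)
    (at_rho Vinf V (rho Omega nu x) * `|cosang nu e| `^ p)%R%:E.

Definition mean finf (f : R -> R) Omega x : \bar R :=
  \int[sphere_measure]_(nu in usphere) (at_rho finf f (rho Omega nu x))%:E.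

End means.

(* Main.v *)
Require Import Defs.
From HB Require Import structures.
From mathcomp Require Import all_boot all_order all_algebra.
From mathcomp Require Import finmap.
From mathcomp Require Import all_classical all_reals all_analysis.
From mathcomp Require Import measurable_realfun ess_sup_inf.
From mathcomp Require Import lra ring.

Set Implicit Arguments.
Unset Strict Implicit.
Unset Printing Implicit Defensive.

Import Order.TTheory GRing.Theory Num.Theory.
Import numFieldNormedType.Exports.
Import HBNNSimple.

Local Open Scope classical_set_scope.
Local Open Scope ring_scope.
Local Open Scope ereal_scope.

(** Everything happens on one line at a time. Fix a unit vector [nu]. On a bounded segment ]a, b[ of
    a line of direction [nu] inside [Omega], [rho] is the distance to the nearer end, so on each
    half it is an affine function r of slope sg = 1 or -1. Put h = phi'/phi and q = V |h|^(p-2) h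
    ([logder] and [flux]). The equation of the Bessel pair becomes the Riccati equation q' = - W -
    (p-1) V |h|^p ([is_derive_flux]). For w the restriction of [u] to the line this gives the exact
    formula (sg q(r) |w|^p)' = V |w'|^p - W |w|^p - V Cp(w', w' - sg h w) ([is_derive_dG]), and w' -
    sg h w is phi(rho) times the derivative of u / phi(rho) along the line ([derive_quotient]). When
    the formula is integrated over the two halves, the boundary terms near a and b vanish because
    [u] has compact support in [Omega], and each half leaves q((b-a)/2) |w(m)|^p at the midpoint m:
    this is the skeletal term with its factor 2 ([component_identity]). An unbounded segment has no
    midpoint and leaves no such term.

    The countably many segments of a line are summed ([eq_integral_comp], [le_integral_comp]), and
    the lines of direction [nu] are put together by rotation invariance and Tonelli
    ([ge0_integral_line]), which gives [domain_identity]. There the skeletal term appears as an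
    integral over [Omega], each value at a midpoint being spread uniformly over its segment;
    [skeletal_integral] identifies it with an integral against the measure on the [nu]-skeleton, for
    continuous functions by the definition of that measure and then for Borel functions by
    uniqueness of finite measures. Integration over the sphere and Tonelli produce the spherical
    means: |cos(nu, grad u)| |grad u| = |d_nu u| turns the first term into the mean with the cosine,
    and |d_nu u| <= |grad u| gives the inequality.

    Two technical matters remain. The functions [V], [W], [phi] are controlled only on the interval
    of the pair, so all integrands are replaced by cut-off ones; the points where this matters lie
    on segments longer than the essential diameter and form a null set ([ae_null_bad]). Moreover the
    integrals may be infinite. The positive and negative parts of the skeletal term are therefore
    carried separately, with inequalities bounding each by the other terms, and [balance] recombines
    them; when the essential diameter is finite the negative part is integrable
    ([integral_FM_finite]). *)

(** * Integrals of arbitrary functions modulo null sets, and image measures *)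

Section integral_ae.
Context d (T : measurableType d) (R : realType).
Variable mu : {measure set T -> \bar R}.
Implicit Types (D N : set T) (f g : T -> \bar R).

(** The integral of a nonnegative function is a supremum over the simple functions below it, whether
    or not the function is measurable. A simple function below [f] keeps its integral when it is
    made 0 on the null set [N], and then it lies below [g]. Measurability must be avoided because
    [V], [W] and [phi] are arbitrary outside the interval of the pair. *)
Lemma le_integral_off_null D N f g : measurable D -> measurable N -> mu N = 0 ->
  (forall x, D x -> 0 <= f x) -> (forall x, D x -> 0 <= g x) ->
  (forall x, D x -> ~ N x -> f x = g x) ->
  \int[mu]_(x in D) f x <= \int[mu]_(x in D) g x.
Proof.
move=> mD mN N0 f0 g0 fg.
rewrite integral_mkcond [leRHS]integral_mkcond.
have pos (h : T -> \bar R) : (forall x, D x -> 0 <= h x) ->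
    forall x, 0 <= (h \_ D) x.
  by move=> h0 x; rewrite patchE; case: ifPn => // /set_mem /h0.
rewrite !ge0_integralTE; [|exact: pos..].
apply: ge_ereal_sup => _ [h hf <-].
rewrite (_ : sintegral mu h = sintegral mu (proj_nnsfun h (measurableC mN))).
  apply: ereal_sup_ubound => /=; exists (proj_nnsfun h (measurableC mN)) => //.
  move=> x; rewrite [X in X%:E](_ : _ = (h \_ (~` N)) x)%R; last by rewrite (mrestrict h (measurableC mN)).
  rewrite patchE; case: ifPn => [/set_mem Nx|_]; last exact: pos.
  apply: (le_trans (hf x)); rewrite !patchE; case: ifPn => // /set_mem Dx.
  by rewrite fg.
rewrite -!integralT_nnsfun; apply: ge0_ae_eq_integral => //.
- by apply/measurable_EFinP.
- by apply/measurable_EFinP.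
- by move=> x _; rewrite lee_fin.
- by move=> x _; rewrite lee_fin.
exists N; split => // x /= /not_implyP [_ hN]; apply: contrapT => Nx; apply: hN.
rewrite -[RHS](_ : ((h \_ (~` N)) x)%:E = _).
  by rewrite patchE mem_set.
by rewrite (mrestrict h (measurableC mN)).
Qed.

Lemma integral_off_null D N f g : measurable D -> measurable N -> mu N = 0 ->
  (forall x, D x -> ~ N x -> f x = g x) ->
  \int[mu]_(x in D) f x = \int[mu]_(x in D) g x.
Proof.
move=> mD mN N0 fg; rewrite integralE [RHS]integralE.
by congr (_ - _); apply/eqP; rewrite eq_le; apply/andP; split;
  apply: (le_integral_off_null mD mN N0) => // x Dx Nx;
  rewrite ?funeposE ?funenegE fg.
Qed.

(* No measurability of [f] or [g] is required. *)
Lemma eq_integral_ae D f g : measurable D ->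
  {ae mu, forall x, D x -> f x = g x} ->
  \int[mu]_(x in D) f x = \int[mu]_(x in D) g x.
Proof.
move=> mD [N [mN N0 subN]]; apply: (integral_off_null mD mN N0) => x Dx Nx.
by apply: contrapT => fg; apply: Nx; apply: subN => /= /(_ Dx).
Qed.

End integral_ae.

Lemma preimage_measurable d1 d2 (T1 : measurableType d1) (T2 : measurableType d2)
  (f : T1 -> T2) (A : set T2) : measurable_fun setT f -> measurable A ->
  measurable (f @^-1` A).
Proof. by move=> mf mA; rewrite -[_ @^-1` _]setTI; exact: mf. Qed.

Lemma ge0_integral_image d1 d2 (T1 : measurableType d1) (T2 : measurableType d2)
    (R : realType) (m1 : {measure set T1 -> \bar R}) (m2 : {measure set T2 -> \bar R})
    (phi : T1 -> T2) (f : T2 -> \bar R) :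
  measurable_fun setT phi ->
  (forall A, measurable A -> m2 A = m1 (phi @^-1` A)) ->
  measurable_fun setT f -> (forall x, 0 <= f x) ->
  \int[m2]_x f x = \int[m1]_x f (phi x).
Proof.
move=> mphi m12 mf f0.
pose F : {mfun _ >-> _} := HB.pack_for {mfun T1 >-> T2}
  phi (isMeasurableFun.Build _ _ _ _ _ mphi).
transitivity (\int[pushforward m1 F]_x f x).
  by apply: eq_measure_integral => A mA _; exact: m12.
by rewrite ge0_integral_pushforward// preimage_setT.
Qed.

(** * Borel sets and measurable maps of R^n *)

Section borel_rV.
Context {R : realType}.

(** These boxes form a countable base of the topology. This places the open sets in the
    sigma-algebra generated by the coordinates, and the open sets of a product in the product
    sigma-algebra. *)
Definition rat_box n (c : 'rV[rat]_n * nat) : set 'rV[R]_n :=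
  [set y | forall i, (`|ratr (c.1 ord0 i) - y ord0 i| < c.2.+1%:R^-1)%R].

Lemma measurable_rat_box n (c : 'rV[rat]_n * nat) : measurable (rat_box c).
Proof.
rewrite (_ : rat_box c = \bigcap_i [set y | (`|ratr (c.1 ord0 i) - y ord0 i| < c.2.+1%:R^-1)%R]); last first.
  by apply/seteqP; split => [y cy i _|y cy i]; [exact: cy|exact: cy].
apply: fin_bigcap_measurable => [|i _]; first exact: finite_finset.
pose f (y : 'rV[R]_n) : R := `|ratr (c.1 ord0 i) - y ord0 i|%R.
have mf : measurable_fun setT f.
  apply: measurableT_comp => //; apply: measurable_funB => //.
  exact: measurable_coord_rV.
rewrite [X in measurable X](_ : _ = setT `&` f @^-1` `]-oo, (c.2.+1%:R^-1)%R[); last first.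
  by rewrite setTI; apply/seteqP; split => y /=; rewrite in_itv.
exact: mf.
Qed.

Lemma rat_box_nbhs n (x : 'rV[R]_n) (e : R) : (0 < e)%R ->
  exists c, rat_box c x /\ rat_box c `<=` ball x e.
Proof.
move=> e0; have e20 : (0 < e / 2)%R by rewrite divr_gt0.
have [k ke] : exists k, (k.+1%:R^-1 < e / 2)%R by have [k _ /(_ k (leqnn k))] := near_infty_natSinv_lt (PosNum e20); exists k.
have k0 : (0 < k.+1%:R^-1 :> R)%R by rewrite invr_gt0.
have H i : exists q : rat, (`|ratr q - x ord0 i| < k.+1%:R^-1)%R.
  have /rat_in_itvoo[q /itvP qx] : (x ord0 i < x ord0 i + k.+1%:R^-1)%R by rewrite ltrDl.
  by exists q; rewrite ltr_distl ?qx andbT ltrBlDr ltr_wpDr ?qx// ltW.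
have /choice[q qx] := H.
exists ((\row_i q i)%R, k); split => [i|y yq]; first by rewrite /= mxE.
split => // i j; rewrite ord1 /ball /=.
have := yq j; rewrite /= mxE; have := qx j => h1 h2.
rewrite (splitr e) -(subrKA (ratr (q j))) (le_lt_trans (ler_normD _ _))//.
by rewrite ltrD// ?(lt_trans h2)// distrC (lt_trans h1).
Qed.

Lemma measurable_openrV n (U : set 'rV[R]_n) : open U -> measurable U.
Proof.
move=> oU; rewrite (_ : U = \bigcup_c (if `[< rat_box c `<=` U >] then rat_box c else set0)).
  apply: countable_bigcupT_measurable => // c; case: ifP => // _.
  exact: measurable_rat_box.
apply/seteqP; split => [x Ux|x [c _]]; last by case: asboolP => // cU /cU.
have /nbhs_ballP[e e0 eU] := open_nbhs_nbhs (conj oU Ux).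
have [c [cx ce]] := rat_box_nbhs x e0.
by exists c => //; rewrite asboolT//; exact: subset_trans eU.
Qed.

Lemma measurable_openrV2 n m (U : set ('rV[R]_n * 'rV[R]_m)) : open U -> measurable U.
Proof.
move=> oU; rewrite (_ : U = \bigcup_c (if `[< rat_box c.1 `*` rat_box c.2 `<=` U >]
    then rat_box c.1 `*` rat_box c.2 else set0)).
  apply: countable_bigcupT_measurable => // c; case: ifP => // _.
  by apply: measurableX; exact: measurable_rat_box.
apply/seteqP; split => [x Ux|x [c _]]; last by case: asboolP => // cU /cU.
have /nbhs_ballP[e e0 eU] := open_nbhs_nbhs (conj oU Ux).
have [c [cx ce]] := rat_box_nbhs x.1 e0.
have [d [dx de]] := rat_box_nbhs x.2 e0.
exists (c, d) => //=; rewrite asboolT//.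
by move=> y [/= yc yd]; apply: eU; split => /=; [apply: ce|apply: de].
Qed.

Lemma measurable_closedrV n (U : set 'rV[R]_n) : closed U -> measurable U.
Proof.
move=> cU; rewrite -[U]setCK; apply: measurableC; apply: measurable_openrV.
exact: closed_openC.
Qed.

Lemma continuous_measurable_rV n (f : 'rV[R]_n -> R) :
  continuous f -> measurable_fun [set: 'rV[R]_n] f.
Proof.
move=> /continuousP cf; apply: (measurability _ (RGenOpens.measurableE R)).
move=> _ [_ [a [b ->] <-]]; rewrite setTI; apply: measurable_openrV.
exact/cf/interval_open.
Qed.

Lemma measurable_funD_rV d (T : measurableType d) n (f g : T -> 'rV[R]_n) :
  measurable_fun setT f -> measurable_fun setT g ->
  measurable_fun setT (fun x => f x + g x)%R.
Proof.
move=> mf mg; apply: measurable_fun_rV => i.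
apply: (eq_measurable_fun (fun z => coord_rV i (f z) + coord_rV i (g z))%R) => [x _|].
  by rewrite /= /coord_rV mxE.
by apply: measurable_funD; apply: measurableT_comp => //; exact: measurable_coord_rV.
Qed.

Lemma measurable_funZ_rV d (T : measurableType d) n (a : T -> R) (f : T -> 'rV[R]_n) :
  measurable_fun setT a -> measurable_fun setT f ->
  measurable_fun setT (fun x => a x *: f x)%R.
Proof.
move=> ma mf; apply: measurable_fun_rV => i.
apply: (eq_measurable_fun (fun z => a z * coord_rV i (f z))%R) => [x _|].
  by rewrite /= /coord_rV mxE.
by apply: measurable_funM => //; apply: measurableT_comp => //; exact: measurable_coord_rV.
Qed.

Lemma measurable_mulmx_rV n m (Q : 'M[R]_(n, m)) :
  measurable_fun [set: 'rV[R]_n] (fun x => x *m Q : 'rV[R]_m)%R.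
Proof.
apply: measurable_fun_rV => i.
apply: (eq_measurable_fun (fun z : 'rV[R]_n => \sum_j coord_rV j z * Q j i)%R) => [x _|].
  by rewrite /= /coord_rV mxE.
apply: measurable_sum => j; apply: measurable_funM => //; exact: measurable_coord_rV.
Qed.

End borel_rV.

(** * Translation invariance of Lebesgue measure on R^n *)

Section translation.
Context {R : realType}.
Local Notation leb := (@lebesgue_measure R).

(** By uniqueness of Lebesgue measure: its image by a translation gives every half-open interval its
    length. *)
Lemma lebesgue_measure_shift (c : R) (A : set (measurableTypeR R)) : measurable A ->
  leb ((fun x => x + c)%R @^-1` A) = leb A.
Proof.
move=> mA; have mf : measurable_fun [set: measurableTypeR R] (fun x : measurableTypeR R => x + c : measurableTypeR R)%R by exact: measurable_funD.
rewrite -[LHS]/(pushforward leb (fun x : measurableTypeR R => x + c : measurableTypeR R)%R A).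
pose F : {mfun _ >-> _} := HB.pack_for {mfun measurableTypeR R >-> measurableTypeR R}
  (fun x : measurableTypeR R => x + c : measurableTypeR R)%R (isMeasurableFun.Build _ _ _ _ _ mf).
apply/esym; apply: (@lebesgue_measure_unique R (pushforward leb F)) => // _ [[a b] _ <-].
rewrite /= /pushforward [X in _ = leb X](_ : _ = `](a - c)%R, (b - c)%R]%classic); last first.
  by apply/seteqP; split => x /=; rewrite !in_itv /= ltrBlDr lerBrDr.
rewrite !lebesgue_measure_itv /= !lte_fin ltrBlDr subrK -!EFinB (_ : b - c - (a - c) = b - a)%R//; ring.
Qed.

Lemma ge0_integral_shift (c : R) (g : R -> \bar R) : measurable_fun setT g ->
  (forall x, 0 <= g x) -> \int[leb]_x g (x + c)%R = \int[leb]_x g x.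
Proof.
move=> mg g0; apply/esym.
apply: (ge0_integral_image (phi := fun x : measurableTypeR R => x + c : measurableTypeR R)%R) => //.
  exact: measurable_funD.
by move=> A mA; apply/esym; exact: lebesgue_measure_shift.
Qed.

Lemma lebesgue_rVS n (A : set 'rV[R]_n.+1) :
  lebesgue_rV n.+1 A = \int[leb]_t lebesgue_rV n [set y | A (cons_rV (t, y))].
Proof.
rewrite -[LHS]/((leb \x lebesgue_rV n) (@cons_rV R n @^-1` A)) /product_measure1 /=.
apply: eq_integral => t _; congr (lebesgue_rV n _).
by apply/seteqP; split => y /=; rewrite /xsection /= inE.
Qed.

Lemma measurable_cons_section n (A : set 'rV[R]_n.+1) t : measurable A ->
  measurable [set y | A (cons_rV (t, y))].
Proof.
move=> mA; rewrite (_ : [set _ | _] = setT `&` (@cons_rV R n \o pair t) @^-1` A); last by rewrite setTI.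
by apply: measurableT_comp => //; exact: measurable_cons_rV.
Qed.

Lemma cons_rV0 n t (y : 'rV[R]_n) : cons_rV (t, y) ord0 ord0 = t.
Proof.
by rewrite /cons_rV (_ : ord0 = @lshift 1 n ord0) ?[LHS](@row_mxEl _ 1 1 n) ?mxE//; exact/val_inj.
Qed.

Lemma cons_rVD n (z1 z2 : measurableTypeR R * 'rV[R]_n) :
  (cons_rV z1 + cons_rV z2 = cons_rV ((z1.1 + z2.1)%R, z1.2 + z2.2))%R.
Proof.
rewrite /cons_rV; apply/rowP => i; rewrite mxE -(@splitK 1 n i).
case: (fintype.split _) => j /=.
  by rewrite [X in (X + _)%R](@row_mxEl _ 1 1 n) [X in (_ + X)%R](@row_mxEl _ 1 1 n) [RHS](@row_mxEl _ 1 1 n) !mxE.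
by rewrite [X in (X + _)%R](@row_mxEr _ 1 1 n) [X in (_ + X)%R](@row_mxEr _ 1 1 n) [RHS](@row_mxEr _ 1 1 n) !mxE.
Qed.

Lemma cons_rV_surj n (x : 'rV[R]_n.+1) : exists t y, x = cons_rV (t, y).
Proof.
exists (lsubmx (x : 'rV_(1 + n)) ord0 ord0), (rsubmx (x : 'rV_(1 + n))).
apply/rowP => i; rewrite /cons_rV -(@splitK 1 n i).
case: (fintype.split _) => j /=.
  by rewrite [RHS](@row_mxEl _ 1 1 n) (ord1 j) !mxE.
by rewrite [RHS](@row_mxEr _ 1 1 n) !mxE.
Qed.

(** By induction on the dimension: the first coordinate is shifted in the outer integral, the
    remaining ones inside each section. *)
Lemma lebesgue_rV_shift n (v : 'rV[R]_n) (A : set 'rV[R]_n) : measurable A ->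
  lebesgue_rV n ((fun x => x + v)%R @^-1` A) = lebesgue_rV n A.
Proof.
elim: n => [|n IH] in v A *.
  move=> _; congr (lebesgue_rV 0 _); apply/seteqP.
  by split => x /=; rewrite (thinmx0 v) addr0.
have [c [w ->]] := cons_rV_surj v => mA; rewrite !lebesgue_rVS.
pose g t := lebesgue_rV n [set y | A (cons_rV (t, y))].
rewrite -(@ge0_integral_shift c g).
- apply: eq_integral => t _; rewrite /g -[RHS](IH w); last exact: measurable_cons_section.
  by congr (lebesgue_rV n _); apply/seteqP; split => y /=; rewrite cons_rVD.
- pose B := @cons_rV R n @^-1` A.
  have mB : measurable B.
    by rewrite -[B]setTI; apply: measurable_cons_rV.
  apply: (eq_measurable_fun (lebesgue_rV n \o xsection B)) => [t _|].
    by congr (lebesgue_rV n _); apply/seteqP; split => y /=; rewrite /xsection /= inE.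
  exact: measurable_fun_xsection.
- by move=> t; exact: measure_ge0.
Qed.

Lemma lebesgue_rV_box n (a b : R) : (a <= b)%R ->
  lebesgue_rV n [set x : 'rV[R]_n | forall i, (a <= x ord0 i <= b)%R] = ((b - a) ^+ n)%:E.
Proof.
move=> ab; elim: n => [|n IH].
  rewrite expr0 /= diracE mem_set//= => -[]//.
rewrite lebesgue_rVS (eq_integral (fun t : measurableTypeR R => ((b - a) ^+ n)%:E * (\1_`[a, b] t)%:E)).
  rewrite ge0_integralZl//; last 2 first.
  - by apply/measurable_EFinP; exact: measurable_indic.
  - by rewrite lee_fin exprn_ge0// subr_ge0.
  rewrite exprSr EFinM; congr (_ * _); rewrite integral_indic// setIT.
  apply: etrans (lebesgue_measure_itv `[a, b]) _; rewrite /= lte_fin.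
  by case: ltgtP ab => // -> _; rewrite subrr.
move=> t _; rewrite indicE.
case: (boolP (t \in `[a, b]%classic)) => tab /=.
  rewrite mule1 -IH; congr (lebesgue_rV n _); apply/seteqP; split => y /= H i.
    by have := H (@rshift 1 n i); rewrite /cons_rV [X in (_ <= X <= _)%R](@row_mxEr _ 1 1 n).
  rewrite -(@splitK 1 n i); case: (fintype.split _) => j /=.
    rewrite /cons_rV [X in (_ <= X <= _)%R](@row_mxEl _ 1 1 n) mxE /=.
    by move: tab; rewrite inE /= in_itv.
  by rewrite /cons_rV [X in (_ <= X <= _)%R](@row_mxEr _ 1 1 n).
rewrite mule0 [X in lebesgue_rV n X](_ : _ = set0) ?measure0//.
apply/seteqP; split => y //= /(_ ord0); rewrite cons_rV0.
by move: tab; rewrite notin_setE /= in_itv /= => H /H.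
Qed.

End translation.

(** * Rotation invariance, and integration along the lines of a given direction *)

Lemma coord_le_enorm (R : realType) n (x : 'rV[R]_n) i : (`|x ord0 i| <= enorm x)%R.
Proof.
rewrite -sqrtr_sqr ler_wsqrtr// /dotp (bigD1 i)//= -expr2 lerDl.
by apply: sumr_ge0 => j _; rewrite -expr2 sqr_ge0.
Qed.

Section rotation.
Context {R : realType}.
Local Notation leb := (@lebesgue_measure R).

Lemma section_fubini d1 d2 (T1 : measurableType d1) (T2 : measurableType d2)
    (m1 : {sigma_finite_measure set T1 -> \bar R})
    (m2 : {sigma_finite_measure set T2 -> \bar R}) (E : set (T1 * T2)) :
  measurable E ->
  \int[m1]_x m2 [set y | E (x, y)] = \int[m2]_y m1 [set x | E (x, y)].
Proof.
move=> mE; have := indic_fubini_tonelli m1 m2 mE.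
rewrite indic_fubini_tonelli_FE// indic_fubini_tonelli_GE// => H.
transitivity (\int[m1]_x (m2 \o xsection E) x).
  apply: eq_integral => x _; congr (m2 _).
  by apply/seteqP; split => y; rewrite /xsection /= inE.
rewrite H; apply: eq_integral => x _; congr (m1 _).
by apply/seteqP; split => y; rewrite /ysection /= inE.
Qed.

Lemma measurable_cube n (a b : R) :
  measurable [set x : 'rV[R]_n | forall i, (a <= x ord0 i <= b)%R].
Proof.
rewrite (_ : mkset _ = \bigcap_i (coord_rV i @^-1` `[a, b]%classic)).
  apply: fin_bigcap_measurable => [|i _]; first exact: finite_finset.
  by apply: preimage_measurable => //; exact: measurable_coord_rV.
apply/seteqP; split => [x H i _|x H i] /=; first by rewrite in_itv /=; exact: H.
by have := H i I; rewrite /= in_itv.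
Qed.

Section linear.
Variables (n : nat) (Q : 'M[R]_n).
Local Notation lam := (lebesgue_rV n).
Local Notation rot := (fun x : 'rV[R]_n => x *m Q)%R.

(* The uniqueness argument for Haar measure, applied to the image of the
   Lebesgue measure by [Q]. *)
Lemma lebesgue_rV_mulmx (A B : set 'rV[R]_n) : Q \in unitmx ->
  measurable A -> measurable B ->
  lam A * lam (rot @^-1` B) = lam [set x | B (- x)%R] * lam (rot @^-1` A).
Proof.
move=> uQ mA mB.
have mQ := measurable_mulmx_rV Q.
have mN : measurable_fun [set: 'rV[R]_n] (fun x => - x)%R.
  have := measurable_mulmx_rV (R := R) (n := n) (- 1%:M)%R.
  by apply: eq_measurable_fun => x _; rewrite mulmxN mulmx1.
have msnd : measurable_fun [set: 'rV[R]_n * 'rV[R]_n] (fun z => z.2 *m Q)%R.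
  exact: measurableT_comp mQ measurable_snd.
have msum : measurable_fun [set: 'rV[R]_n * 'rV[R]_n] (fun z => z.1 + z.2 *m Q)%R.
  by apply: measurable_funD_rV.
have mdif : measurable_fun [set: 'rV[R]_n * 'rV[R]_n] (fun z => z.2 *m Q - z.1)%R.
  apply: measurable_funD_rV => //; exact: measurableT_comp mN measurable_fst.
have mrB : measurable (rot @^-1` B) by exact: preimage_measurable.
have mrA : measurable (rot @^-1` A) by exact: preimage_measurable.
(* Both products are measures of subsets of the product space. For fixed [y] the section of [E1] is
   a translate of [A] or empty, according to whether [y *m Q] is in [B]; likewise for [E2], with a
   translate of the opposite of [B], and [A] as the condition. For fixed [x] the sections of [E1]
   and [E2] are translates of each other by [x *m invmx Q]. *)
pose E1 := [set z : 'rV[R]_n * 'rV[R]_n | A (z.1 + z.2 *m Q)%R /\ B (z.2 *m Q)%R].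
have mE1 : measurable E1.
  apply: (measurableI (_ @^-1` A) (_ @^-1` B)); exact: preimage_measurable.
pose E2 := [set z : 'rV[R]_n * 'rV[R]_n | A (z.2 *m Q)%R /\ B (z.2 *m Q - z.1)%R].
have mE2 : measurable E2.
  apply: (measurableI (_ @^-1` A) (_ @^-1` B)); exact: preimage_measurable.
have intind (S : set 'rV[R]_n) c : 0 <= c -> measurable S ->
    \int[lam]_y (c * (\1_S y)%:E) = c * lam S.
  move=> c0 mS; rewrite ge0_integralZl//; last 1 first.
    by apply/measurable_EFinP; exact: measurable_indic.
  by rewrite integral_indic// setIT.
have half1 : lam A * lam (rot @^-1` B) = \int[lam]_y lam [set x | E1 (x, y)].
  rewrite -intind//; apply: eq_integral => y _; rewrite indicE /E1.
  case: (boolP (y \in _)) => [/set_mem|/negP] By.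
    rewrite mule1 -(lebesgue_rV_shift (y *m Q)%R mA); congr (lam _).
    by apply/seteqP; split => x //= [].
  rewrite mule0 [X in lam X](_ : _ = set0) ?measure0//.
  by apply/seteqP; split => x //= [_ By']; apply: By; rewrite inE.
have half2 : lam [set x | B (- x)%R] * lam (rot @^-1` A) = \int[lam]_y lam [set x | E2 (x, y)].
  have mNB : measurable [set x | B (- x)%R].
    exact: (preimage_measurable mN).
  rewrite -intind//; apply: eq_integral => y _; rewrite indicE /E2.
  case: (boolP (y \in _)) => [/set_mem|/negP] By.
    rewrite mule1 -(lebesgue_rV_shift (- (y *m Q))%R mNB); congr (lam _).
    by apply/seteqP; split => x /=; rewrite opprD opprK addrC => // -[].
  rewrite mule0 [X in lam X](_ : _ = set0) ?measure0//.
  by apply/seteqP; split => x //= [By' _]; apply: By; rewrite inE.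
rewrite half1 half2 -section_fubini// -section_fubini//; apply: eq_integral => x _.
have mS : measurable [set y | E2 (x, y)].
  apply: (preimage_measurable (f := pair x)) => //.
rewrite -(lebesgue_rV_shift (x *m invmx Q)%R mS); congr (lam _).
by apply/seteqP; split => y /=; rewrite /E1 /E2 /= mulmxDl mulmxKV// addrK addrC.
Qed.

Lemma dotp_mulmx (x y : 'rV[R]_n) : (Q *m Q^T = 1%:M)%R ->
  dotp (x *m Q)%R (y *m Q)%R = dotp x y.
Proof.
have dE (a b : 'rV[R]_n) : dotp a b = (a *m b^T)%R ord0 ord0.
  by rewrite /dotp mxE; apply: eq_bigr => i _; rewrite mxE.
by move=> QQ; rewrite !dE trmx_mul mulmxA -(mulmxA x) QQ mulmx1.
Qed.

(** In [lebesgue_rV_mulmx] take for [B] the unit ball, which is invariant under [Q] and under x |->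
    - x. Its measure lies between those of two cubes, so it is finite and positive and can be
    cancelled. *)
Lemma lebesgue_rV_rotation (A : set 'rV[R]_n) : (Q *m Q^T = 1%:M)%R ->
  measurable A -> lam (rot @^-1` A) = lam A.
Proof.
move=> QQ mA; pose B := [set x : 'rV[R]_n | (enorm x <= 1)%R].
have mB : measurable B.
  rewrite (_ : B = enorm @^-1` `]-oo, 1%R]).
    apply: preimage_measurable => //; exact: measurable_enorm.
  by apply/seteqP; split => x /=; rewrite in_itv.
have uQ : Q \in unitmx by have [] := mulmx1_unit QQ.
have := lebesgue_rV_mulmx uQ mA mB.
rewrite (_ : rot @^-1` B = B); last first.
  by apply/seteqP; split => x; rewrite /B /= /enorm dotp_mulmx.
rewrite (_ : [set x | B (- x)%R] = B); last first.
  have NN (x : 'rV[R]_n) : enorm (- x)%R = enorm x.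
    by congr Num.sqrt; apply: eq_bigr => i _; rewrite !mxE mulrNN.
  by apply/seteqP; split => x; rewrite /B /= NN.
have Bfin : lam B < +oo.
  apply: (@le_lt_trans _ _ (lam [set x | forall i, (-1 <= x ord0 i <= 1)%R])).
    apply: le_measure; rewrite ?inE //.
      exact: measurable_cube.
    move=> x xB i; rewrite -ler_norml; exact: le_trans (coord_le_enorm x i) xB.
  by rewrite lebesgue_rV_box ?ltry// lerNl opprK (@le_trans _ _ 0%R) ?lerN10.
have B0 : 0 < lam B.
  (* The cube of half-side 1/(n+1) lies in the unit ball, since n / (n+1)^2 <= 1. *)
  set e := (n.+1%:R^-1 : R)%R; have e0 : (0 < e)%R by rewrite invr_gt0.
  apply: (@lt_le_trans _ _ (lam [set x | forall i, (- e <= x ord0 i <= e)%R])).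
    rewrite lebesgue_rV_box ?lte_fin ?exprn_gt0 ?opprK ?addr_gt0//.
    by rewrite (@le_trans _ _ 0%R)// ?oppr_le0 ltW.
  apply: le_measure; rewrite ?inE //.
    exact: measurable_cube.
  move=> x xe; rewrite /B /= /enorm -(sqrtr1 R) ler_wsqrtr//.
  apply: (@le_trans _ _ (\sum_(i < n) e ^+ 2)%R).
    apply: ler_sum => i _; rewrite -expr2 -real_normK ?num_real// ler_sqr ?nnegrE//; last exact: ltW.
    by rewrite ler_norml; exact: xe.
  rewrite sumr_const card_ord -mulr_natr expr2 -mulrA.
  apply: mulr_ile1; [exact: ltW|by rewrite mulr_ge0// ltW| |].
    by rewrite /e invf_le1 ?ler1n.
  by rewrite mulrC ler_pdivrMr ?mul1r ?ler_nat.
have Bf : lam B \is a fin_num by rewrite ge0_fin_numE.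
rewrite muleC => H; apply/eqP; rewrite eq_le.
by rewrite -(lee_pmul2l Bf B0) -[X in _ && X](lee_pmul2l Bf B0) H lexx.
Qed.

Lemma ge0_integral_rotation (f : 'rV[R]_n -> \bar R) : (Q *m Q^T = 1%:M)%R ->
  measurable_fun setT f -> (forall x, 0 <= f x) ->
  \int[lam]_x f (x *m Q)%R = \int[lam]_x f x.
Proof.
move=> QQ mf f0; apply/esym.
apply: (ge0_integral_image (phi := rot)) => //; first exact: measurable_mulmx_rV.
by move=> A mA; apply/esym; exact: lebesgue_rV_rotation.
Qed.

End linear.

(** Here [S] stands for v^T v and 2 b for the squared norm of v. The hypothesis on [c * b] replaces
    c b = 1 so that v = 0 is also covered. *)
Lemma reflectionK n (S : 'M[R]_n) (b c : R) :
  (S *m S = (2 * b) *: S -> (c * b) *: S = S ->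
  (1%:M - c *: S) *m (1%:M - c *: S) = 1%:M)%R.
Proof.
move=> SS cbS; rewrite mulmxBl mul1mx mulmxBr mulmx1 -scalemxAl -scalemxAr SS !scalerA.
rewrite (_ : c * c * (2 * b) = (2 * c) * (c * b))%R; last by ring.
rewrite -scalerA cbS -scalerBl -addrA -opprD -scalerDl.
by rewrite (_ : c + (c - 2 * c) = 0)%R ?scale0r ?subr0//; ring.
Qed.

Lemma usphere_dotp n (nu : 'rV[R]_n) : usphere nu -> dotp nu nu = 1%R.
Proof.
rewrite /usphere /= /enorm => /(congr1 (fun z => z ^+ 2)%R).
rewrite sqr_sqrtr ?expr1n//; apply: sumr_ge0 => i _.
by rewrite -expr2 sqr_ge0.
Qed.

(* The Householder reflection exchanging the first basis vector and [nu]; if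
   [nu] is the first basis vector, division by zero makes it the identity. *)
Lemma ex_frame n (nu : 'rV[R]_n.+1) : usphere nu ->
  exists J : 'M[R]_(n, n.+1), (J *m J^T = 1%:M /\ J *m nu^T = 0)%R.
Proof.
move=> /usphere_dotp nu1.
pose e := delta_mx ord0 ord0 : 'rV[R]_n.+1.
pose v := (nu - e)%R; pose c := ((1 - nu ord0 ord0)^-1)%R.
pose H : 'M[R]_(1 + n) := (1%:M - c *: (v^T *m v))%R.
have nuT : (nu *m nu^T = 1%:M)%R.
  apply/matrixP => i j; rewrite !ord1 !mxE /= mulr1n -[RHS]nu1.
  by apply: eq_bigr => k _; rewrite mxE.
have enu : (e *m nu^T = (nu ord0 ord0)%:M)%R.
  apply/matrixP => i j; rewrite !ord1 -rowE !mxE /= mulr1n//.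
have ee : (e *m e^T = 1%:M)%R.
  by apply/matrixP => i j; rewrite !ord1 -rowE !mxE !eqxx.
have nue : (nu *m e^T = (nu ord0 ord0)%:M)%R.
  by rewrite -[LHS]trmxK trmx_mul trmxK enu tr_scalar_mx.
have vv : (v *m v^T = (2 * (1 - nu ord0 ord0))%:M)%R.
  rewrite /v linearB /= mulmxBl !mulmxBr nuT nue enu ee.
  rewrite -!raddfB /=; congr (_%:M)%R; ring.
have ev : (e *m v^T = (nu ord0 ord0 - 1)%:M)%R.
  by rewrite /v linearB /= mulmxBr enu ee -raddfB.
have HT : (H^T = H)%R.
  by rewrite /H linearB /= trmx1 linearZ /= trmx_mul trmxK.
have key : ((c * (1 - nu ord0 ord0)) *: v = v)%R.
  have [nu0|nu0] := eqVneq (nu ord0 ord0) 1%R; last first.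
    by rewrite /c mulVf ?scale1r// subr_eq0 eq_sym.
  suff -> : v = 0%R by rewrite scaler0.
  have /matrixP/(_ ord0 ord0) := vv; rewrite nu0 subrr mulr0 !mxE mulr1n.
  move/eqP; rewrite psumr_eq0 => [/allP H0|k _]; last by rewrite !mxE -expr2 sqr_ge0.
  apply/rowP => k; have := H0 k (mem_index_enum _).
  by rewrite /= [X in (v _ _ * X)%R]mxE -expr2 sqrf_eq0 => /eqP ->; rewrite mxE.
have eH : (e *m H = nu)%R.
  rewrite /H mulmxBr mulmx1 -scalemxAr mulmxA ev mul_scalar_mx scalerA.
  by rewrite -(opprB 1%R) mulrN scaleNr key opprK addrC subrK.
have HH : (H *m H^T = 1%:M)%R.
  rewrite HT; apply: (@reflectionK _ _ (1 - nu ord0 ord0)%R _).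
    by rewrite mulmxA -(mulmxA v^T) vv mul_mx_scalar -scalemxAl.
  by rewrite scalemxAr key.
have usub : usubmx H = nu.
  rewrite -[RHS]eH /e -rowE; apply/rowP => k; rewrite [LHS]mxE [RHS]mxE.
  by congr (H _ _); exact/val_inj.
exists (dsubmx H); move: HH; rewrite -{1 2}(vsubmxK H) tr_col_mx mul_col_row usub.
rewrite (@scalar_mx_block _ 1 n) => /eq_block_mx[_ _ HJ0 HJ1].
by split.
Qed.

Lemma frameP n (nu : 'rV[R]_n.+1) : usphere nu ->
  (frame nu *m (frame nu)^T = 1%:M /\ frame nu *m nu^T = 0)%R.
Proof.
move=> /ex_frame[J HJ]; rewrite /frame; case: xgetP => [K _ //|/(_ J)].
by move=> /(_ HJ).
Qed.

Lemma measurable_cons_mulmx n (Q : 'M[R]_n.+1) :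
  measurable_fun [set: measurableTypeR R * 'rV[R]_n] (fun z => cons_rV z *m Q)%R.
Proof.
exact: measurableT_comp (measurable_mulmx_rV Q) (@measurable_cons_rV R n).
Qed.

Definition line_frame n (nu : 'rV[R]_n.+1) : 'M[R]_n.+1 := col_mx nu (frame nu).

Lemma line_frameE n (nu : 'rV[R]_n.+1) (z : measurableTypeR R * 'rV[R]_n) :
  (cons_rV z *m line_frame nu = z.2 *m frame nu + z.1 *: nu)%R.
Proof.
rewrite /cons_rV /line_frame (@mul_row_col _ 1 1 n) addrC; congr (_ + _)%R.
by apply/rowP => j; rewrite !mxE big_ord1 !mxE.
Qed.

Lemma line_frameK n (nu : 'rV[R]_n.+1) : usphere nu ->
  (line_frame nu *m (line_frame nu)^T = 1%:M)%R.
Proof.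
move=> nu1; have [J1 J0] := frameP nu1.
rewrite /line_frame (@tr_col_mx _ 1 n) (@mul_col_row _ 1 n _ 1 n) J1 J0.
rewrite -[X in block_mx _ X]trmxK trmx_mul trmxK J0 trmx0.
rewrite (_ : nu *m nu^T = 1%:M)%R; first by rewrite -(@scalar_mx_block _ 1 n).
apply/matrixP => i j; rewrite !ord1 !mxE mulr1n -(usphere_dotp nu1).
by apply: eq_bigr => k _; rewrite mxE.
Qed.

(** Rotation invariance for the orthogonal matrix [line_frame nu], followed by Tonelli with the
    first coordinate, the one along [nu], split off. *)
Lemma ge0_integral_line n (nu : 'rV[R]_n.+1) (f : 'rV[R]_n.+1 -> \bar R) :
  usphere nu -> measurable_fun setT f -> (forall x, 0 <= f x) ->
  \int[lebesgue_rV n.+1]_x f x =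
  \int[lebesgue_rV n]_y \int[leb]_s f (y *m frame nu + s *: nu)%R.
Proof.
move=> nu1 mf f0; rewrite -(ge0_integral_rotation (line_frameK nu1))//.
pose Q := line_frame nu.
have mC := @measurable_cons_rV R n.
have mfQ : measurable_fun setT (fun x : 'rV[R]_n.+1 => f (x *m Q)%R).
  exact: measurableT_comp mf (measurable_mulmx_rV Q).
rewrite (ge0_integral_image (m1 := leb \x lebesgue_rV n) (phi := @cons_rV R n))//.
have mg := measurableT_comp mfQ mC.
rewrite (@fubini_tonelli2 _ _ _ _ _ leb (lebesgue_rV n) _ mg (fun=> f0 _)).
apply: eq_integral => y _; apply: eq_integral => s _ /=.
by rewrite line_frameE.
Qed.

Lemma measurable_line_integral n (nu : 'rV[R]_n.+1) (f : 'rV[R]_n.+1 -> \bar R) :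
  measurable_fun setT f -> (forall x, 0 <= f x) ->
  measurable_fun setT (fun y : 'rV[R]_n => \int[leb]_s f (y *m frame nu + s *: nu)%R).
Proof.
move=> mf f0.
have mg : measurable_fun setT (f \o (fun z : measurableTypeR R * 'rV[R]_n => cons_rV z *m line_frame nu)%R).
  exact: measurableT_comp mf (@measurable_cons_mulmx _ _).
have := @measurable_fun_fubini_tonelli_G _ _ _ _ _ leb _ mg (fun z => f0 _).
apply: eq_measurable_fun => y _.
by apply: eq_integral => s _ /=; rewrite line_frameE.
Qed.

End rotation.

(** * Components of an open subset of the real line *)

Section rend.
Context {R : realType}.
Implicit Types (C : set R) (s t : R).

(** The first point from [s] onwards that is outside [C]: the right end of the component of [s], +oo
    if there is none, and [s] itself when [s] is not in [C]. Left ends are defined below by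
    reflection, so that their properties follow from those of right ends. *)
Definition rend C s : \bar R := ereal_inf [set t%:E | t in [set t | (s <= t)%R /\ ~ C t]].

Lemma rend_le C s t : (s <= t)%R -> ~ C t -> rend C s <= t%:E.
Proof. by move=> st Ct; apply: ereal_inf_lbound; exists t. Qed.

Lemma rend_ge C s : s%:E <= rend C s.
Proof. by apply: le_ereal_inf_tmp => _ [t [st _] <-]; rewrite lee_fin. Qed.

Lemma rend_in C s t : (s <= t)%R -> t%:E < rend C s -> C t.
Proof. by move=> st; apply: contraPP => Ct; apply/negP; rewrite -leNgt rend_le. Qed.

Lemma rend_notin C s b : open C -> rend C s = b%:E -> ~ C b.
Proof.
move=> oC sb Cb; have /nbhs_ballP[e /= e0 be] := open_nbhs_nbhs (conj oC Cb).
have : rend C s < (b + e)%:E by rewrite sb lte_fin ltrDl.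
move=> /ereal_inf_lt[_ [t [st Ct] <-]]; rewrite lte_fin => tbe.
have := rend_le st Ct; rewrite sb lee_fin => bt.
apply: Ct; apply: be; rewrite /ball /= distrC ltr_distl tbe andbT.
by rewrite (@lt_le_trans _ _ b)// ltrBlDr ltrDl.
Qed.

Lemma rend_gt C s : open C -> C s -> s%:E < rend C s.
Proof.
by move=> oC Cs; rewrite lt_neqAle rend_ge andbT; apply/eqP => /esym/(rend_notin oC).
Qed.

Lemma rend_eq C s t : (s <= t)%R -> t%:E < rend C s -> rend C t = rend C s.
Proof.
move=> st ts; apply/eqP; rewrite eq_le; apply/andP; split.
  apply: le_ereal_inf_tmp => _ [r [sr Cr] <-]; apply: rend_le => //.
  by rewrite leNgt; apply/negP => rt; apply: Cr; apply: (rend_in sr); rewrite (lt_trans _ ts)// lte_fin.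
apply: le_ereal_inf_tmp => _ [r [sr Cr] <-]; apply: rend_le => //.
exact: le_trans sr.
Qed.

Lemma rend_ltP C s t : open C -> (forall r, (s <= r <= t)%R -> C r) -> (s <= t)%R ->
  t%:E < rend C s.
Proof.
move=> oC sC st; rewrite ltNge; apply/negP => ts.
have [b sb] : exists b, rend C s = b%:E.
  move: ts; case: (rend C s) (rend_ge C s) => [b _ _||]//; first by exists b.
apply: (rend_notin oC sb); apply: sC.
by have := rend_ge C s; move: ts; rewrite sb !lee_fin => -> ->.
Qed.

Definition lend C s : \bar R := - rend (-%R @^-1` C) (- s)%R.

Lemma open_opp C : open C -> open (-%R @^-1` C).
Proof.
by move=> oC; apply: open_comp => // x _; exact: opp_continuous.
Qed.

Lemma lend_lt C s : open C -> C s -> lend C s < s%:E.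
Proof.
move=> oC Cs; rewrite /lend lteNl -EFinN; apply: rend_gt; first exact: open_opp.
by rewrite /= opprK.
Qed.

Lemma lend_in C s t : (t <= s)%R -> lend C s < t%:E -> C t.
Proof.
move=> ts; rewrite /lend lteNl -EFinN => /rend_in /=; rewrite opprK; apply.
by rewrite lerN2.
Qed.

Lemma lend_eq C s t : (t <= s)%R -> lend C s < t%:E -> lend C t = lend C s.
Proof.
move=> ts; rewrite /lend lteNl -EFinN => st.
by congr (- _); apply: rend_eq; rewrite ?lerN2.
Qed.

Lemma lend_ltP C s t : open C -> (forall r, (t <= r <= s)%R -> C r) -> (t <= s)%R ->
  lend C s < t%:E.
Proof.
move=> oC sC ts; rewrite /lend lteNl -EFinN; apply: rend_ltP; first exact: open_opp.
- by move=> r /andP[h1 h2]; apply: sC; rewrite lerNr h2 lerNl h1.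
- by rewrite lerN2.
Qed.

(** For open [C] and [s] in [C] this is the connected component of [s] ([connected_componentE]), in
    a form that displays its two ends. It is empty when [s] is not in [C]. *)
Definition component C s : set R := [set t | lend C s < t%:E < rend C s].

Lemma component_refl C s : open C -> C s -> component C s s.
Proof. by move=> oC Cs; rewrite /component /= lend_lt// rend_gt. Qed.

Lemma component_sub C s : component C s `<=` C.
Proof.
move=> t /andP[lt rt]; have [st|/ltW ts] := leP s t; first exact: rend_in rt.
exact: lend_in lt.
Qed.

Lemma component_ends C s t : open C -> C s -> component C s t ->
  lend C t = lend C s /\ rend C t = rend C s.
Proof.
move=> oC Cs /andP[lt rt]; have [st|/ltW ts] := leP s t.
  split; last exact: rend_eq.
  apply/esym; apply: lend_eq => //; apply: lend_ltP => // r /andP[sr rt'].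
  by apply: (rend_in sr); rewrite (le_lt_trans _ rt)// lee_fin.
split; first exact: lend_eq.
apply/esym; apply: rend_eq => //; apply: rend_ltP => // r /andP[sr rt'].
by apply: (lend_in rt'); rewrite (lt_le_trans lt)// lee_fin.
Qed.

Lemma component_eq C s t : open C -> C s -> component C s t -> component C t = component C s.
Proof. by move=> oC Cs st; rewrite /component; have [-> ->] := component_ends oC Cs st. Qed.

Lemma component_is_interval C s : is_interval (component C s).
Proof.
move=> a b /andP[la ra] /andP[lb rb] t /andP[at_ tb]; rewrite /component /=.
by rewrite (lt_le_trans la) ?lee_fin//= (le_lt_trans _ rb)// lee_fin.
Qed.

Lemma connected_componentE C s : open C -> C s -> connected_component C s = component C s.
Proof.
move=> oC Cs; apply/seteqP; split; last first.
  apply: connected_component_max; [exact: component_refl|exact: component_sub|].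
  by apply/connected_intervalP; exact: component_is_interval.
move=> t [B [Bs BC /connected_intervalP Bi] Bt]; rewrite /component /=; apply/andP.
have [st|/ltW ts] := leP s t; split.
- by rewrite (lt_le_trans (lend_lt oC Cs))// lee_fin.
- by apply: rend_ltP => // r /(Bi _ _ Bs Bt)/BC.
- by apply: lend_ltP => // r /(Bi _ _ Bt Bs)/BC.
- by rewrite (le_lt_trans _ (rend_gt oC Cs))// lee_fin.
Qed.

Lemma measurable_component C s : measurable (component C s).
Proof. exact: is_interval_measurable (@component_is_interval C s). Qed.

Lemma component_itv C s : component C s = match lend C s, rend C s with
  | a%:E, b%:E => `]a, b[%classic | a%:E, +oo => `]a, +oo[%classic
  | -oo, b%:E => `]-oo, b[%classic | -oo, +oo => setT
  | _, _ => set0 end.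
Proof.
rewrite /component; case: (lend C s) => [a||]; case: (rend C s) => [b||];
  apply/seteqP; split => t //=; rewrite ?in_itv /= ?lte_fin ?ltry ?ltNyr ?andbT//=.
by rewrite [_ < -oo]ltNge leNye andbF.
Qed.

End rend.

(** * One-sided distances to the boundary along a line *)

Section reach.
Context {R : realType} {N : nat}.
Implicit Types (Omega : set 'rV[R]_N) (x nu : 'rV[R]_N).

Definition chord Omega nu x : set R := [set s | Omega (x + s *: nu)%R].

Definition reach Omega nu x : \bar R := rend (chord Omega nu x) 0.

Lemma open_chord Omega nu x : open Omega -> open (chord Omega nu x).
Proof.
move=> oO; apply: open_comp => // s _.
by apply: cvgD; [exact: cvg_cst|apply: cvgZr_tmp; exact: cvg_id].
Qed.

Lemma chordN Omega nu x : chord Omega (- nu)%R x = -%R @^-1` chord Omega nu x.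
Proof. by apply/seteqP; split => s; rewrite /chord /= scalerN scaleNr. Qed.

Lemma chord_shift Omega nu x s t :
  chord Omega nu (x + s *: nu)%R t = chord Omega nu x (s + t)%R.
Proof. by rewrite /chord /= scalerDl addrA. Qed.

Lemma reach_line Omega nu x s :
  reach Omega nu (x + s *: nu)%R = rend (chord Omega nu x) s - s%:E.
Proof.
apply/eqP; rewrite eq_le leeBrDr// leeBlDr//; apply/andP; split.
  apply: le_ereal_inf_tmp => _ [t [st Ct] <-].
  rewrite -leeBrDr// -EFinB; apply: rend_le; first by rewrite subr_ge0.
  by rewrite chord_shift addrC subrK.
rewrite -leeBlDr//; apply: le_ereal_inf_tmp => _ [t [t0 Ct] <-].
rewrite leeBlDr// -EFinD; apply: rend_le; first by rewrite lerDr.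
by move: Ct; rewrite chord_shift addrC.
Qed.

Lemma reachN_line Omega nu x s :
  reach Omega (- nu)%R (x + s *: nu)%R = s%:E - lend (chord Omega nu x) s.
Proof.
have -> : (x + s *: nu = x + (- s) *: (- nu))%R by rewrite scalerN scaleNr opprK.
by rewrite reach_line chordN /lend oppeK EFinN oppeK addeC.
Qed.

Lemma reach_ge0 Omega nu x : 0 <= reach Omega nu x.
Proof. exact: rend_ge. Qed.

Lemma reach_gt0 Omega nu x : open Omega -> Omega x -> 0 < reach Omega nu x.
Proof.
move=> oO Ox; apply: rend_gt; first exact: open_chord.
by rewrite /chord /= scale0r addr0.
Qed.

Lemma rho_reach Omega nu x :
  rho Omega nu x = mine (reach Omega nu x) (reach Omega (- nu)%R x).
Proof.
apply/eqP; rewrite eq_le; apply/andP; split.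
  rewrite le_min; apply/andP; split.
    apply: le_ereal_inf_tmp => _ [t [t0 Ct] <-]; apply: ereal_inf_lbound.
    by exists t => //; rewrite ger0_norm.
  apply: le_ereal_inf_tmp => _ [t [t0 Ct] <-]; apply: ereal_inf_lbound.
  exists (- t)%R; last by rewrite normrN ger0_norm.
  by move: Ct; rewrite chordN.
apply: le_ereal_inf_tmp => _ [t Ct <-]; rewrite ge_min.
have [t0|/ltW t0] := leP 0%R t.
  by rewrite ger0_norm// [X in X || _]rend_le.
rewrite ler0_norm// [X in _ || X]rend_le ?orbT// ?oppr_ge0//.
by rewrite chordN /= opprK.
Qed.

Lemma reach_gtP Omega nu x (c : R) : open Omega -> (0 <= c)%R ->
  c%:E < reach Omega nu x <-> `[0%R, c] `<=` chord Omega nu x.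
Proof.
move=> oO c0; split => [cr s /=|H].
  by rewrite in_itv /= => /andP[s0 sc]; apply: (rend_in s0); rewrite (le_lt_trans _ cr).
by apply: rend_ltP => //; exact: open_chord.
Qed.

(** Lower semicontinuity, jointly in direction and point: the reach exceeds [c] exactly when the
    compact segment of parameters [0, c] stays in [Omega], and by compactness the nearby segments
    then stay in [Omega] too. *)
Lemma open_reach_gt Omega (c : R) : open Omega ->
  open [set z : 'rV[R]_N * 'rV[R]_N | c%:E < reach Omega z.1 z.2].
Proof.
move=> oO; have [c0|c0] := leP 0%R c; last first.
  rewrite (_ : mkset _ = setT); first exact: openT.
  by apply/seteqP; split => z //= _; rewrite (lt_le_trans _ (reach_ge0 _ _ _))// lte_fin.
rewrite openE => -[nu x] /(reach_gtP _ _ oO c0) /= H.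
rewrite /interior.
have /compact_near_coveringP := @segment_compact R 0%R c.
move=> /(_ _ (nbhs (nu, x)) (fun z s => chord Omega z.1 z.2 s)).
move=> /(_ _) /= cov.
near=> z; apply/(reach_gtP _ _ oO c0).
near: z; apply: cov => s s0c.
have Cs := H s s0c.
pose f (y : R * ('rV[R]_N * 'rV[R]_N)) : 'rV[R]_N := (y.2.2 + y.1 *: y.2.1)%R.
have cf : {for (s, (nu, x)), continuous f}.
  apply: cvgD.
    exact: (cvg_comp _ _ cvg_snd cvg_snd).
  apply: cvgZ; first exact: cvg_fst.
  exact: (cvg_comp _ _ cvg_snd cvg_fst).
have : nbhs (s, (nu, x)) (f @^-1` Omega).
  by apply: cf; apply: open_nbhs_nbhs; split.
by apply: filterS => -[r [mu y]].
Unshelve. all: by end_near. Qed.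

Lemma measurable_reach Omega : open Omega ->
  measurable_fun setT (fun z : 'rV[R]_N * 'rV[R]_N => reach Omega z.1 z.2).
Proof.
move=> oO; apply: (measurability _ (ErealGenOInfty.measurableE R)).
move=> /= _ [_ [a ->]] <-; apply: measurableI => //.
rewrite preimage_itvoy; apply: measurable_openrV2.
exact: open_reach_gt.
Qed.

End reach.

(** * The function |y|^(p-2) y and the functional Cp *)

Section signed_pow.
Context {R : realType}.
Variable p : R.
Hypothesis p1 : (1 < p)%R.
Local Open Scope ring_scope.

Let p0 : 0 < p. Proof. exact: lt_trans p1. Qed.
Let p10 : 0 < p - 1. Proof. by rewrite subr_gt0. Qed.

Lemma signed_powM (x y : R) : signed_pow p (x * y) = signed_pow p x * signed_pow p y.
Proof. by rewrite /signed_pow normrM powRM// mulrACA. Qed.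

Lemma signed_powN (y : R) : signed_pow p (- y) = - signed_pow p y.
Proof. by rewrite /signed_pow normrN mulrN. Qed.

Lemma signed_pow0 : signed_pow p 0 = 0.
Proof. by rewrite /signed_pow mulr0. Qed.

Lemma signed_pow_gt0 (y : R) : 0 < y -> signed_pow p y = y `^ (p - 1).
Proof.
move=> y0; rewrite /signed_pow gtr0_norm// -{2}(powRr1 (ltW y0)) -powRD ?(gt_eqF y0) ?implybT//.
by congr (_ `^ _); lra.
Qed.

Lemma signed_pow_lt0 (y : R) : y < 0 -> signed_pow p y = - (- y) `^ (p - 1).
Proof. by move=> y0; rewrite -signed_pow_gt0 ?oppr_gt0// signed_powN opprK. Qed.

Lemma norm_signed_pow (y : R) : `|signed_pow p y| = `|y| `^ (p - 1).
Proof.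
have [y0|y0|->] := ltgtP y 0.
- by rewrite signed_pow_lt0// normrN (ltr0_norm y0) ger0_norm// powR_ge0.
- by rewrite signed_pow_gt0// (gtr0_norm y0) ger0_norm// powR_ge0.
- by rewrite signed_pow0 normr0 powR0// gt_eqF.
Qed.

Lemma signed_pow_mulr (y : R) : signed_pow p y * y = `|y| `^ p.
Proof.
have [y0|y0|->] := ltgtP y 0.
- by rewrite signed_pow_lt0// mulNr -mulrN mulrC mulr_powRB1 ?oppr_ge0 ?ltW// ltr0_norm.
- by rewrite signed_pow_gt0// mulrC mulr_powRB1 ?ltW// gtr0_norm.
- by rewrite signed_pow0 mulr0 normr0 powR0// gt_eqF.
Qed.

Lemma cvg_norm_powR0 (a : R) : 0 < a -> (`|h| `^ a @[h --> (0 : R)]) --> (0 : R).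
Proof.
move=> a0; apply/cvgrPdist_lt => e e0.
have d0 : 0 < e `^ a^-1 by rewrite powR_gt0.
have : nbhs (0 : R) (ball 0 (e `^ a^-1)) by exact: nbhsx_ballx.
apply: filterS => h; rewrite /ball /= sub0r normrN => he.
rewrite sub0r normrN ger0_norm ?powR_ge0//.
rewrite [ltRHS](_ : e = (e `^ a^-1) `^ a); last first.
  by rewrite -powRrM mulVf ?gt_eqF// powRr1// ltW.
by apply: gt0_ltr_powR => //; rewrite nnegrE// ltW.
Qed.

(** Away from 0 this is the derivative of a power. At 0 the difference quotient has absolute value
    |h|^(p-1), which tends to 0 because p > 1. *)
Lemma is_derive_norm_powR (y : R) :
  is_derive y 1 (fun z => `|z| `^ p) (p * signed_pow p y).
Proof.
have [y0|y0|->] := ltgtP y 0.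
- have Ny0 : 0 < - y by rewrite oppr_gt0.
  have := is_derive1_comp (is_derive1_powR p Ny0) (is_deriveN (is_derive_id y 1)).
  move/is_derive_eq => /(_ (p * signed_pow p y)) D.
  apply: near_eq_is_derive (D _).
    by near=> z; rewrite /= ltr0_norm//; near: z; exact: lt_nbhsl.
  by rewrite signed_pow_lt0// mulrN1 mulrN.
- rewrite signed_pow_gt0//; apply: near_eq_is_derive (is_derive1_powR p y0).
  by near=> z; rewrite /= gtr0_norm//; near: z; exact: lt_nbhsr.
rewrite signed_pow0 mulr0.
pose f (z : R) : R := `|z| `^ p.
have H : (fun h : R => h^-1 *: ((f \o shift (0:R)) (h *: 1) - f 0) : R) @ 0^' --> (0 : R).
  apply/cvgr0Pnorm_lt => e e0.
  have /cvgrPdist_lt/(_ e e0) H := cvg_norm_powR0 p10.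
  near=> h; have h0 : h != 0 by near: h; exact: nbhs_dnbhs_neq.
  rewrite /f /= normr0 powR0 ?gt_eqF// subr0 addr0 /GRing.scale /= mulr1 normrM normfV.
  rewrite (ger0_norm (powR_ge0 _ _)) -mulr_powRB1// mulKf ?normr_eq0//.
  near: h; rewrite /dnbhs; apply: filterS H => h + _.
  by rewrite sub0r normrN ger0_norm ?powR_ge0.
split; first by apply/cvg_ex; exists 0.
exact: cvg_lim H.
Unshelve. all: by end_near. Qed.

Lemma continuous_norm_powR : continuous (fun z : R => `|z| `^ p).
Proof.
move=> y; apply: differentiable_continuous; apply/derivable1_diffP.
by have [] := is_derive_norm_powR y.
Qed.

Lemma continuous_signed_pow : continuous (signed_pow p).
Proof.
move=> y; have [->|y0] := eqVneq y 0.
  rewrite /continuous_at signed_pow0; apply/cvgr0Pnorm_lt => e e0.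
  have /cvgrPdist_lt/(_ e e0) := cvg_norm_powR0 p10.
  by apply: filterS => h; rewrite sub0r normrN norm_signed_pow ger0_norm ?powR_ge0.
have {y0} ny0 : 0 < `|y| by rewrite normr_gt0.
apply: cvgM; last exact: cvg_id.
have cp : {for `|y|, continuous (fun z : R => z `^ (p - 2))}.
  apply: differentiable_continuous; apply/derivable1_diffP.
  by have [] := is_derive1_powR (p - 2) ny0.
exact: cvg_comp (@norm_continuous _ _ y) cp.
Qed.

(** With z = x - y the claim reads p |z|^(p-2) z x <= |x|^p + (p-1) |z|^p, which is Young's
    inequality with the exponents p and p/(p-1). *)
Lemma Cp_ge0 (x y : R) : 0 <= Cp p x y.
Proof.
rewrite /Cp; set z := x - y.
have -> : y = x - z by rewrite /z opprB addrC subrK.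
rewrite mulrBr signed_pow_mulr.
have q0 : 0 < p / (p - 1) by rewrite divr_gt0.
have pq : p^-1 + (p / (p - 1))^-1 = 1.
  by rewrite invf_div; field; rewrite gt_eqF.
have := conjugate_powR (normr_ge0 x) (normr_ge0 (signed_pow p z)) p0 q0 pq.
rewrite norm_signed_pow -powRrM (_ : (p - 1) * _ = p); last by field; rewrite gt_eqF.
move=> Y; have H : signed_pow p z * x <= `|x| * `|z| `^ (p - 1).
  by rewrite mulrC -norm_signed_pow -normrM ler_norm.
have {H Y} := le_trans H Y.
rewrite -(ler_pM2l p0) mulrDr !(mulrCA p) divff ?gt_eqF// mulr1.
rewrite (_ : p * (p / (p - 1))^-1 = p - 1); last by field; rewrite !gt_eqF.
lra.
Qed.

Lemma Cp_self (x : R) : Cp p x x = `|x| `^ p.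
Proof. by rewrite /Cp subrr signed_pow0 normr0 powR0 ?gt_eqF// mul0r mulr0 !subr0. Qed.

Lemma Cp_cancel (x z : R) : Cp p x (x - z) = `|x| `^ p - `|z| `^ p - p * (signed_pow p z * (x - z)).
Proof. by rewrite /Cp (_ : x - (x - z) = z)//; ring. Qed.

End signed_pow.

(** * The Riccati equation and the exact derivative on a half segment *)

Section continuousR.
Context {R : realType}.
Implicit Types f g : R -> R.

Lemma continuous_compR f g (s : R) : {for s, continuous f} ->
  {for f s, continuous g} -> {for s, continuous (fun x => g (f x))}.
Proof. by move=> cf cg; exact: continuous_comp cf cg. Qed.

Lemma continuous_mulR f g (s : R) : {for s, continuous f} ->
  {for s, continuous g} -> {for s, continuous (fun x => f x * g x)%R}.
Proof. by move=> cf cg; exact: cvgM cf cg. Qed.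

Lemma continuous_subR f g (s : R) : {for s, continuous f} ->
  {for s, continuous g} -> {for s, continuous (fun x => f x - g x)%R}.
Proof. by move=> cf cg; exact: cvgB cf cg. Qed.

End continuousR.

Section bessel_calculus.
Context {R : realType}.
Variables (p : R) (Rad : \bar R) (V W phi : R -> R).
Hypothesis p1 : (1 < p)%R.
Hypothesis VW0 : forall r, interval0 Rad r -> (0 < V r)%R /\ (0 < W r)%R.
Hypothesis V1 : C1_on Rad V.
Hypothesis W1 : C1_on Rad W.
Hypothesis sol : positive_solution p Rad V W phi.
Local Open Scope ring_scope.
Local Notation leb := (@lebesgue_measure R).

Definition logder (r : R) : R := derive1 phi r / phi r.
Definition flux (r : R) : R := V r * signed_pow p (logder r).

Let phi0 r : interval0 Rad r -> 0 < phi r. Proof. by case: sol => + _ _ _; apply. Qed.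

Lemma open_interval0 : open (interval0 Rad).
Proof.
case: Rad => [a||].
- rewrite (_ : interval0 _ = `]0, a[%classic); first exact: interval_open.
  by apply/seteqP; split => r /=; rewrite in_itv /interval0 /= lte_fin => /andP.
- rewrite (_ : interval0 _ = `]0, +oo[%classic); first exact: interval_open.
  by apply/seteqP; split => r /=; rewrite in_itv /interval0 /= ltry andbT // => -[].
- rewrite (_ : interval0 _ = set0); first exact: open0.
  by apply/seteqP; split => r //= [_]; rewrite ltNge leNye.
Qed.

Lemma C1_on_continuous (f : R -> R) r : C1_on Rad f -> interval0 Rad r ->
  {for r, continuous f}.
Proof.
move=> cf /cf[df _]; apply: differentiable_continuous; exact/derivable1_diffP.
Qed.

Let phi1 : C1_on Rad phi. Proof. by case: sol. Qed.

Lemma continuous_logder r : interval0 Rad r -> {for r, continuous logder}.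
Proof.
move=> r0; apply: cvgM; first by have [] := phi1 r0.
apply: cvgV; first by rewrite gt_eqF// phi0.
exact: C1_on_continuous.
Qed.

(** The Riccati form of the equation. With F = V |phi'|^(p-2) phi', the flux is F phi^(1-p). The
    equation gives F' = - W phi^(p-1), whence the term - W, and differentiating phi^(1-p) gives the
    other term. *)
Lemma is_derive_flux r : interval0 Rad r ->
  is_derive r 1 flux (- W r - (p - 1) * (V r * `|logder r| `^ p)).
Proof.
move=> r0; have /= [dF eF] : let F := fun s => V s * signed_pow p (derive1 phi s) in
    derivable F r 1 /\ derive1 F r + W r * signed_pow p (phi r) = 0.
  by case: sol => _ _ + _; apply.
set F := fun s => _ in dF eF.
have isF : is_derive r 1 F (- (W r * signed_pow p (phi r))).
  by split => //; rewrite -derive1E; apply/eqP; rewrite -addr_eq0 eF.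
have isphi : is_derive r 1 phi (derive1 phi r).
  by have [d _] := phi1 r0; split => //; rewrite -derive1E.
have ispow := is_derive1_comp (is_derive1_powR (1 - p) (phi0 r0)) isphi.
apply: near_eq_is_derive (is_derive_eq (is_deriveM isF ispow) _).
  have : nbhs r (interval0 Rad) by apply: open_nbhs_nbhs; split => //; exact: open_interval0.
  apply: filterS => z z0 /=; have pz := phi0 z0.
  rewrite /F /flux /logder signed_powM -mulrA; congr (_ * (_ * _)) => /=.
  rewrite signed_pow_gt0 ?invr_gt0// -powR_inv1 ?ltW// -powRrM.
  by congr (_ `^ _); ring.
have pr := phi0 r0; rewrite /= /GRing.scale /= /F (signed_pow_gt0 p pr).
rewrite -signed_pow_mulr// /logder signed_powM.
have -> : signed_pow p (phi r)^-1 = phi r `^ (1 - p).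
  rewrite signed_pow_gt0 ?invr_gt0// -powR_inv1 ?ltW// -powRrM.
  by congr (_ `^ _); ring.
have e1 : phi r `^ (1 - p) * phi r `^ (p - 1) = 1.
  rewrite -powRD ?(gt_eqF pr) ?implybT// (_ : 1 - p + (p - 1) = 0) ?powRr0//; ring.
have e2 : phi r `^ (1 - p - 1) = phi r `^ (1 - p) / phi r.
  by rewrite powRB ?(gt_eqF pr) ?implybT// powRr1// ltW.
have -> : - W r = - (W r * (phi r `^ (1 - p) * phi r `^ (p - 1))) by rewrite e1 mulr1.
by rewrite e2; ring.
Qed.

Lemma continuous_flux r : interval0 Rad r -> {for r, continuous flux}.
Proof.
move=> /is_derive_flux[dq _]; apply: differentiable_continuous; exact/derivable1_diffP.
Qed.

Section half_line.
Variables (sg c : R) (w w' : R -> R).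
Hypothesis sg1 : sg = 1 \/ sg = -1.
Hypothesis dw : forall s : R, is_derive s (1 : R) w (w' s).
Hypothesis cw' : continuous w'.

(* [dist] is the distance to the end point [c] of a component of the chord, on
   the side [sg] of [c]. *)
Definition dist (s : R) : R := sg * (s - c).
Definition dA s := V (dist s) * `|w' s| `^ p.
Definition dB s := W (dist s) * `|w s| `^ p.
Definition dC s := V (dist s) * Cp p (w' s) (w' s - sg * logder (dist s) * w s).
Definition dG s := sg * flux (dist s) * `|w s| `^ p.

Lemma is_derive_dist s : is_derive s (1 : R) dist sg.
Proof.
rewrite /dist (_ : (fun s => _) = sg \*: (id - cst c)); last by apply/funext.
have := is_deriveZ sg (is_deriveB (is_derive_id s (1:R)) (is_derive_cst c s 1)).
by move/is_derive_eq; apply; rewrite subr0 /GRing.scale /= mulr1.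
Qed.

Lemma continuous_dist s : {for s, continuous dist}.
Proof.
have [d _] := is_derive_dist s.
by apply: differentiable_continuous; exact/derivable1_diffP.
Qed.

Let cw s : {for s, continuous w}.
Proof.
by have [d _] := dw s; apply: differentiable_continuous; exact/derivable1_diffP.
Qed.

(** The pointwise identity behind the theorem. Put z = sg h w with h the logarithmic derivative of
    [phi]. Expanding Cp(w', w' - z), the term V |w'|^p cancels, and p V |z|^(p-2) z w' is what the
    derivative of |w|^p contributes. What remains, - W |w|^p - (p-1) V |z|^p, is the Riccati
    equation multiplied by |w|^p. *)
Lemma is_derive_dG s : interval0 Rad (dist s) -> is_derive s (1 : R) dG (dA s - dB s - dC s).
Proof.
move=> r0.
have d1 := is_deriveZ sg (is_derive1_comp (is_derive_flux r0) (is_derive_dist s)).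
have d2 := is_derive1_comp (is_derive_norm_powR p1 (w s)) (dw s).
apply: near_eq_is_derive (is_derive_eq (is_deriveM d1 d2) _).
  by near=> z; rewrite /dG.
rewrite /= /GRing.scale /= /dA /dB /dC /flux; set r := dist s; set h := logder r; clearbody h.
rewrite Cp_cancel -signed_pow_mulr// -!(@signed_pow_mulr _ p)// !signed_powM.
have ss : signed_pow p sg * sg = 1 by rewrite signed_pow_mulr//; case: sg1 => ->; rewrite ?normrN normr1 powR1.
have -> : signed_pow p sg = sg.
  case: sg1 => -> ; rewrite ?signed_powN;
  by rewrite -[signed_pow p 1]mulr1 signed_pow_mulr// normr1 powR1.
have s2 : sg * sg = 1 by case: sg1 => ->; rewrite ?mulrNN mulr1.
set A := signed_pow p (w' s) * _; set hh := signed_pow p h; set ww := signed_pow p (w s).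
transitivity ((sg * sg) * (ww * w s * (- W r - (p - 1) * (V r * (hh * h)))) + sg * V r * hh * p * ww * w' s).
  ring.
rewrite s2.
transitivity (- (W r * (ww * w s)) + V r * ((sg * sg) * (hh * h) * (ww * w s)) * (1 - p) + V r * p * (sg * hh * ww * w' s)).
  by rewrite s2; ring.
ring.
Unshelve. all: by end_near. Qed.

Let cVd s : interval0 Rad (dist s) -> {for s, continuous (fun z => V (dist z))}.
Proof.
by move=> r0; apply: continuous_compR (@continuous_dist s) _; exact: C1_on_continuous.
Qed.

Lemma continuous_dA s : interval0 Rad (dist s) -> {for s, continuous dA}.
Proof.
move=> r0.
have h := continuous_compR (@cw' s) (@continuous_norm_powR _ _ p1 (w' s)).
exact: (continuous_mulR (cVd r0) h).
Qed.

Lemma continuous_dB s : interval0 Rad (dist s) -> {for s, continuous dB}.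
Proof.
move=> r0.
have h := continuous_compR (@cw s) (@continuous_norm_powR _ _ p1 (w s)).
have hW := continuous_compR (@continuous_dist s) (C1_on_continuous W1 r0).
exact: (continuous_mulR hW h).
Qed.

Lemma continuous_dC s : interval0 Rad (dist s) -> {for s, continuous dC}.
Proof.
move=> r0; apply: (continuous_mulR (cVd r0)).
have ch := continuous_compR (@continuous_dist s) (continuous_logder r0).
have cz := continuous_mulR (continuous_mulR (@cst_continuous _ _ sg s) ch) (@cw s).
rewrite (_ : (fun s => Cp p _ _) = fun s => `|w' s| `^ p - `|sg * logder (dist s) * w s| `^ p -
    p * (signed_pow p (sg * logder (dist s) * w s) * (w' s - sg * logder (dist s) * w s))); last first.
  by apply/funext => z; rewrite Cp_cancel.
have h1 := continuous_compR (@cw' s) (@continuous_norm_powR _ _ p1 (w' s)).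
have h2 := continuous_compR cz (@continuous_norm_powR _ _ p1 _).
have h3 := continuous_compR cz (@continuous_signed_pow _ _ p1 _).
have h4 := continuous_mulR (@cst_continuous _ _ p s) (continuous_mulR h3 (continuous_subR (@cw' s) cz)).
exact: (continuous_subR (continuous_subR h1 h2) h4).
Qed.

Lemma half_line_FTC (s1 s2 : R) : s1 < s2 ->
  (forall s, s1 <= s <= s2 -> interval0 Rad (dist s)) ->
  exists a b d : R, [/\ (\int[leb]_(s in `[s1, s2]) (dA s)%:E = a%:E)%E,
    (\int[leb]_(s in `[s1, s2]) (dB s)%:E = b%:E)%E,
    (\int[leb]_(s in `[s1, s2]) (dC s)%:E = d%:E)%E &
    a = b + d + (dG s2 - dG s1)].
Proof.
move=> s12 I0.
have wc (f : R -> R) : (forall s, interval0 Rad (dist s) -> {for s, continuous f}) ->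
    {within `[s1, s2], continuous f}.
  move=> cf; apply: continuous_in_subspaceT => s; rewrite inE /= in_itv /= => /I0.
  exact: cf.
have int (f : R -> R) : (forall s, interval0 Rad (dist s) -> {for s, continuous f}) ->
    leb.-integrable `[s1, s2] (EFin \o f).
  move=> cf; apply: continuous_compact_integrable; first exact: segment_compact.
  exact: wc.
have iA := int _ continuous_dA; have iB := int _ continuous_dB.
have iC := int _ continuous_dC.
have fin (f : R -> R) : leb.-integrable `[s1, s2] (EFin \o f) ->
    (\int[leb]_(s in `[s1, s2]) (f s)%:E)%E = (fine (\int[leb]_(s in `[s1, s2]) (f s)%:E)%E)%:E.
  by move=> i; rewrite fineK//; exact: integrable_fin_num.
have dGd s : interval0 Rad (dist s) -> derivable dG s 1.
  by move=> /is_derive_dG[].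
have cG s : interval0 Rad (dist s) -> {for s, continuous dG}.
  move=> /dGd d; apply: differentiable_continuous; exact/derivable1_diffP.
have := @continuous_FTC2 R (fun s => dA s - dB s - dC s) dG s1 s2 s12.
have -> : (\int[leb]_(s in `[s1, s2]) (dA s - dB s - dC s)%:E =
   \int[leb]_(s in `[s1, s2]) (dA s)%:E - \int[leb]_(s in `[s1, s2]) (dB s)%:E -
   \int[leb]_(s in `[s1, s2]) (dC s)%:E)%E.
  have mI : measurable (`[s1, s2]%classic : set (measurableTypeR R)) by exact: measurable_itv.
  have iAB := integrableB mI iA iB.
  by rewrite -(integralB mI iA iB) -(integralB mI iAB iC).
rewrite (fin _ iA) (fin _ iB) (fin _ iC) => H.
exists (fine (\int[leb]_(s in `[s1, s2]) (dA s)%:E)%E),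
 (fine (\int[leb]_(s in `[s1, s2]) (dB s)%:E)%E),
 (fine (\int[leb]_(s in `[s1, s2]) (dC s)%:E)%E); split => //.
suff : ((fine (\int[leb]_(s in `[s1, s2]) (dA s)%:E)%E)%:E -
  (fine (\int[leb]_(s in `[s1, s2]) (dB s)%:E)%E)%:E -
 (fine (\int[leb]_(s in `[s1, s2]) (dC s)%:E)%E)%:E = (dG s2)%:E - (dG s1)%:E)%E.
  by rewrite -!EFinB => -[]; lra.
apply: H.
- by apply: wc => s r0; apply: (continuous_subR (continuous_subR _ _)); [exact: continuous_dA|exact: continuous_dB|exact: continuous_dC].
- split.
  + by move=> s; rewrite in_itv /= => /andP[s1s ss2]; apply: dGd; apply: I0; rewrite !ltW.
  + by apply: cvg_at_right_filter; apply: cG; apply: I0; rewrite lexx ltW.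
  + by apply: cvg_at_left_filter; apply: cG; apply: I0; rewrite lexx ltW.
- move=> s; rewrite in_itv /= => /andP[s1s ss2]; rewrite derive1E.
  by have [] := @is_derive_dG s; last by []; apply: I0; rewrite !ltW.
Qed.

End half_line.
End bessel_calculus.

(** * The identity on one component of a chord *)

Section component.
Context {R : realType}.
Variables (p : R) (Rad : \bar R) (V W phi : R -> R) (Vinf : R).
Hypothesis p1 : (1 < p)%R.
Hypothesis VW0 : forall r, interval0 Rad r -> (0 < V r)%R /\ (0 < W r)%R.
Hypothesis V1 : C1_on Rad V.
Hypothesis W1 : C1_on Rad W.
Hypothesis sol : positive_solution p Rad V W phi.
Hypothesis Vinf0 : (0 <= Vinf)%R.
Local Notation leb := (@lebesgue_measure R).

(** Nothing is known of [V], [W], [phi] outside the interval of the pair. Setting the functions to 0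
    there makes the integrands measurable, and preserves the signs of [V] and [W]. *)
Definition cutoff (f : R -> R) (r : R) : R := if `[< interval0 Rad r >] then f r else 0%R.

Lemma cutoffE f r : interval0 Rad r -> cutoff f r = f r.
Proof. by rewrite /cutoff => /asboolT ->. Qed.

Lemma cutoff_ge0 f r : (forall s, interval0 Rad s -> (0 <= f s)%R) -> (0 <= cutoff f r)%R.
Proof. by rewrite /cutoff => f0; case: asboolP => // /f0. Qed.

(* At a point of a line, [ap] and [am] are the distances to the boundary in the
   positive and negative directions, [v] the value and [d] the derivative of u,
   and [vm] the value of u at the midpoint of the component. *)
Definition side (ap am : \bar R) : R := if am < ap then 1%R else (-1)%R.
Definition iA ap am (d : R) : R :=
  (at_rho Vinf (cutoff V) (mine ap am) * `|d| `^ p)%R.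
Definition iB ap am (v : R) : R :=
  (at_rho 0 (cutoff W) (mine ap am) * `|v| `^ p)%R.
Definition iC ap am (v d : R) : R :=
  (at_rho Vinf (cutoff V) (mine ap am) *
   Cp p d (d - side ap am * at_rho 0 (cutoff (logder phi)) (mine ap am) * v))%R.
(** Here l = ap + am is the length of the component and l/2 the distance of its midpoint from both
    ends. Dividing by l makes the integral over the component return the value at the midpoint. It
    is 0 on unbounded components. *)
Definition skel ap am (vm : R) : R :=
  (at_rho 0 (fun l => cutoff (flux p V phi) (l / 2) / l) (ap + am) * `|vm| `^ p)%R.
Definition mid_shift (ap am : \bar R) : R := ((fine ap - fine am) / 2)%R.

Lemma at_rhoV_ge0 r : (0 <= at_rho Vinf (cutoff V) r)%R.
Proof. by case: r => [r||] //=; apply: cutoff_ge0 => s /VW0[/ltW]. Qed.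

Lemma at_rhoW_ge0 r : (0 <= at_rho 0 (cutoff W) r)%R.
Proof. by case: r => [r||] //=; apply: cutoff_ge0 => s /VW0[_ /ltW]. Qed.

Lemma iA_ge0 ap am d : (0 <= iA ap am d)%R.
Proof. by rewrite mulr_ge0 ?at_rhoV_ge0// powR_ge0. Qed.

Lemma iB_ge0 ap am d : (0 <= iB ap am d)%R.
Proof. by rewrite mulr_ge0 ?at_rhoW_ge0// powR_ge0. Qed.

Lemma iC_ge0 ap am v d : (0 <= iC ap am v d)%R.
Proof. by rewrite mulr_ge0 ?at_rhoV_ge0// Cp_ge0. Qed.

Let p_neq0 : p != 0%R. Proof. by rewrite gt_eqF// (lt_trans _ p1). Qed.

Lemma iA0 ap am : iA ap am 0 = 0%R.
Proof. by rewrite /iA normr0 powR0// mulr0. Qed.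

Lemma iB0 ap am : iB ap am 0 = 0%R.
Proof. by rewrite /iB normr0 powR0// mulr0. Qed.

Lemma iC0 ap am : iC ap am 0 0 = 0%R.
Proof. by rewrite /iC mulr0 subr0 Cp_self// normr0 powR0// mulr0. Qed.

Lemma skel0 ap am : skel ap am 0 = 0%R.
Proof. by rewrite /skel normr0 powR0// mulr0. Qed.

Lemma integral_eq_off_point (I J : set (measurableTypeR R)) (e : R) (f g : R -> \bar R) :
  (forall s, s != e -> (f \_ I) s = (g \_ J) s) ->
  \int[leb]_(s in I) f s = \int[leb]_(s in J) g s.
Proof.
move=> fg; rewrite integral_mkcond [RHS]integral_mkcond.
apply: (integral_off_null (N := [set e] : set (measurableTypeR R))) => //.
  exact: lebesgue_measure_set1.
by move=> s _ /= /eqP se; rewrite fg.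
Qed.

Section half_piece.
Variables (sg c : R) (w w' : R -> R) (ap am : R -> \bar R).
Hypothesis sg1 : (sg = 1 \/ sg = -1)%R.
Hypothesis dw : forall s : R, is_derive s (1 : R)%R w (w' s).
Hypothesis cw' : continuous w'.

(** Transfers the formula of a half line to the integrands written with [ap] and [am]. The point
    [e], in practice the midpoint or an end, is negligible, and outside [s1, s2] both [w] and [w']
    vanish, so that only the nearer end matters. *)
Lemma half_piece (I : set (measurableTypeR R)) (s1 s2 e : R) : (s1 < s2)%R ->
  (forall s, (s1 <= s <= s2)%R -> interval0 Rad (dist sg c s)) ->
  (forall s, s != e -> I s -> (s1 <= s <= s2)%R ->
     mine (ap s) (am s) = (dist sg c s)%:E /\ side (ap s) (am s) = sg) ->
  (forall s, s != e -> I s -> ~~ (s1 <= s <= s2)%R -> w s = 0%R /\ w' s = 0%R) ->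
  (forall s, s != e -> (s1 <= s <= s2)%R -> I s) ->
  exists a b d : R, [/\ \int[leb]_(s in I) (iA (ap s) (am s) (w' s))%:E = a%:E,
    \int[leb]_(s in I) (iB (ap s) (am s) (w s))%:E = b%:E,
    \int[leb]_(s in I) (iC (ap s) (am s) (w s) (w' s))%:E = d%:E &
    (a = b + d + (dG p V phi sg c w s2 - dG p V phi sg c w s1))%R].
Proof.
move=> s12 I0 Iin Iout IJ.
have [a [b [d [HA HB HC E]]]] := half_line_FTC p1 V1 W1 sol sg1 dw cw' s12 I0.
pose J : set (measurableTypeR R) := `[s1, s2]%classic.
have case_s (F : R -> \bar R) (G : R -> \bar R) s : s != e ->
    (forall (Is : I s) (Js : (s1 <= s <= s2)%R), F s = G s) ->
    (w s = 0%R -> w' s = 0%R -> F s = 0) -> (F \_ I) s = (G \_ J) s.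
  move=> se FG F0; rewrite !patchE.
  have [sJ|sJ] := boolP (s1 <= s <= s2)%R.
    have Is := IJ _ se sJ.
    by rewrite mem_set// mem_set ?FG// /J /= in_itv.
  rewrite [s \in J](_ : _ = false); last first.
    by apply/negbTE; rewrite notin_setE /J /= in_itv /=; exact/negP.
  by case: ifPn => // /set_mem Is; have [] := Iout s se Is sJ; exact: F0.
exists a, b, d; split => //; [rewrite -HA|rewrite -HB|rewrite -HC];
  apply: (@integral_eq_off_point _ _ e) => s se; apply: case_s => //.
- by move=> Is Js; have [mE _] := Iin s se Is Js; rewrite /iA mE /= cutoffE//; exact: I0.
- by move=> _ ->; rewrite iA0.
- by move=> Is Js; have [mE _] := Iin s se Is Js; rewrite /iB mE /= cutoffE//; exact: I0.
- by move=> -> _; rewrite iB0.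
- move=> Is Js; have [mE sE] := Iin s se Is Js.
  by rewrite /iC mE sE /= !cutoffE//; exact: I0.
- by move=> -> ->; rewrite iC0.
Qed.

End half_piece.

Section component_identity.
Variables (w w' : R -> R) (delta M : R).
Hypothesis dw : forall s : R, is_derive s (1 : R)%R w (w' s).
Hypothesis cw' : continuous w'.
Hypothesis delta0 : (0 < delta)%R.
Variables al be : \bar R.
Hypothesis Rad_gt : 2^-1%:E * (be - al) < Rad \/ Rad = +oo.

Let I : set (measurableTypeR R) := [set t | al < t%:E < be].
Let ap s := be - s%:E.
Let am s := s%:E - al.

Hypothesis w_end : forall s, I s -> am s <= delta%:E \/ ap s <= delta%:E ->
  w s = 0%R /\ w' s = 0%R.
Hypothesis w_far : forall s, I s -> (M <= `|s|)%R -> w s = 0%R /\ w' s = 0%R.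

Let IA := \int[leb]_(s in I) (iA (ap s) (am s) (w' s))%:E.
Let IB := \int[leb]_(s in I) (iB (ap s) (am s) (w s))%:E.
Let IC := \int[leb]_(s in I) (iC (ap s) (am s) (w s) (w' s))%:E.
Let sk s := skel (ap s) (am s) (w (s + mid_shift (ap s) (am s))%R).
Let SP := \int[leb]_(s in I) (Num.max (sk s) 0)%:E.
Let SM := \int[leb]_(s in I) (Num.max (- sk s) 0)%:E.

Hypothesis mA : measurable_fun I (fun s => (iA (ap s) (am s) (w' s))%:E).
Hypothesis mB : measurable_fun I (fun s => (iB (ap s) (am s) (w s))%:E).
Hypothesis mC : measurable_fun I (fun s => (iC (ap s) (am s) (w s) (w' s))%:E).

Let zero_skel : (forall s, I s -> sk s = 0%R) -> IA = IB + IC ->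
  [/\ IA + 2%:E * SM = IB + IC + 2%:E * SP, 2%:E * SP <= IA & 2%:E * SM <= IB + IC].
Proof.
move=> sk0 E.
have -> : SP = 0.
  by apply: integral0_eq => s Is; rewrite sk0// maxxx.
have -> : SM = 0.
  by apply: integral0_eq => s Is; rewrite sk0// oppr0 maxxx.
rewrite mule0 !adde0; split => //.
  by apply: integral_ge0 => s _; rewrite lee_fin iA_ge0.
by rewrite -E; apply: integral_ge0 => s _; rewrite lee_fin iA_ge0.
Qed.

(** On a complete line rho = +oo: by convention the [W] term is 0 and the logarithmic derivative is
    read as 0, and Cp(d, d) = |d|^p makes the other two terms equal. *)
Let line_case : al = -oo -> be = +oo -> IA = IB + IC.
Proof.
move=> al_ be_; rewrite /IA /IB /IC /ap /am al_ be_ [X in X + _]integral0_eq => [|s _].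
  rewrite add0e; apply: eq_integral => s _.
  by rewrite /iA /iC /= mulr0 mul0r subr0 Cp_self.
by rewrite /iB /= mul0r.
Qed.

(** With a single end the half-length is infinite, which forces Rad = +oo. The primitive vanishes
    both near the end and beyond the support of [w], so no boundary term survives. *)
Let rhalf_case (a : R) : al = a%:E -> be = +oo -> IA = IB + IC.
Proof.
move=> al_ be_.
have RadE : Rad = +oo.
  case: Rad_gt => //; rewrite al_ be_ /= mulry gtr0_sg ?invr_gt0// mul1e.
  by rewrite ltNge leey.
have IE s : I s = (a < s)%R by rewrite /I al_ be_ /= ltry andbT lte_fin.
pose s1 := (a + delta)%R; pose s2 := (Num.max s1 `|M| + 1)%R.
have s12 : (s1 < s2)%R by rewrite (@le_lt_trans _ _ (Num.max s1 `|M|)%R)// ?le_max ?lexx// ltrDl.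
have Ms2 : (`|M| < s2)%R by rewrite (@le_lt_trans _ _ (Num.max s1 `|M|)%R)// ?le_max ?lexx ?orbT// ltrDl.
have as1 : (a < s1)%R by rewrite ltrDl.
have ws1 : w s1 = 0%R.
  have [] // := @w_end s1; first by rewrite IE.
  by left; rewrite /am al_ -EFinB lee_fin /s1 addrAC subrr add0r.
have far s : (s2 <= s)%R -> w s = 0%R /\ w' s = 0%R.
  move=> ss; apply: w_far; first by rewrite IE (lt_le_trans as1)// (le_trans _ ss)// ltW.
  by rewrite (le_trans (ler_norm M))// (le_trans (ltW Ms2))// (le_trans ss)// ler_norm.
have [] := @half_piece 1%R a w w' ap am (or_introl erefl) dw cw' I s1 s2 a s12.
- move=> s /andP[ss1 _]; rewrite /dist mul1r /interval0 /= RadE ltry subr_gt0.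
  by split => //; exact: lt_le_trans ss1.
- move=> s _ Is _; rewrite /ap /am /dist /side al_ be_ /= mul1r.
  by rewrite -EFinB ltry; split => //; rewrite mineC min_l ?leey.
- move=> s _ Is; rewrite negb_and -!ltNge => /orP[ss1|ss2]; last first.
    by apply: far; exact: ltW.
  apply: w_end => //; left; rewrite /am al_ -EFinB lee_fin.
  by rewrite lerBlDl ltW.
- by move=> s _ /andP[ss1 _]; rewrite IE (lt_le_trans as1).
move=> A [B [D [HA HB HC E]]]; rewrite /IA /IB /IC HA HB HC E.
rewrite /dG ws1 (far s2 (lexx _)).1 normr0 powR0// !mulr0 subrr addr0.
by rewrite EFinD.
Qed.

Let lhalf_case (b : R) : al = -oo -> be = b%:E -> IA = IB + IC.
Proof.
move=> al_ be_.
have RadE : Rad = +oo.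
  case: Rad_gt => //; rewrite al_ be_ /= mulry gtr0_sg ?invr_gt0// mul1e.
  by rewrite ltNge leey.
have IE s : I s = (s < b)%R by rewrite /I al_ be_ /= ltNyr lte_fin.
pose s2 := (b - delta)%R; pose s1 := (Num.min s2 (- `|M|) - 1)%R.
have s12 : (s1 < s2)%R by rewrite ltrBlDr (@le_lt_trans _ _ s2) ?ge_min ?lexx// ltrDl.
have Ms1 : (s1 < - `|M|)%R by rewrite ltrBlDr (@le_lt_trans _ _ (- `|M|)%R) ?ge_min ?lexx ?orbT// ltrDl.
have s2b : (s2 < b)%R by rewrite ltrBlDr ltrDl.
have ws2 : w s2 = 0%R.
  have [] // := @w_end s2; first by rewrite IE.
  by right; rewrite /ap be_ -EFinB lee_fin /s2 opprB addrC subrK.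
have far s : (s <= s1)%R -> w s = 0%R /\ w' s = 0%R.
  move=> ss; apply: w_far; first by rewrite IE (le_lt_trans _ s2b)// (le_trans ss)// ltW.
  have := ler_norm (- s)%R; have := ler_norm M; rewrite normrN; lra.
have [] := @half_piece (-1)%R b w w' ap am (or_intror erefl) dw cw' I s1 s2 b s12.
- move=> s /andP[_ ss2]; rewrite /dist mulN1r opprB /interval0 /= RadE ltry subr_gt0.
  by split => //; exact: le_lt_trans s2b.
- move=> s _ Is _; rewrite /ap /am /dist /side al_ be_ /= mulN1r opprB.
  by rewrite -EFinB; split => //; rewrite min_l ?leey.
- move=> s _ Is; rewrite negb_and -!ltNge => /orP[ss1|ss2].
    by apply: far; exact: ltW.
  apply: w_end => //; right; rewrite /ap be_ -EFinB lee_fin.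
  by rewrite lerBlDr -lerBlDl ltW.
- by move=> s _ /andP[_ ss2]; rewrite IE (le_lt_trans _ s2b).
move=> A [B [D [HA HB HC E]]]; rewrite /IA /IB /IC HA HB HC E.
rewrite /dG ws2 (far s1 (lexx _)).1 normr0 powR0// !mulr0 subrr addr0.
by rewrite EFinD.
Qed.

(** The number z is the boundary term at the midpoint. The two halves contribute it with the same
    sign, because both the sign [sg] and the limit of integration at which the midpoint sits are
    exchanged; hence 2 z. The function [sk] is constant on the component and has integral z. *)
Let bounded_case (a b : R) : al = a%:E -> be = b%:E -> (a < b)%R ->
  exists x y d z : R, [/\ IA = x%:E, IB = y%:E, IC = d%:E, (x = y + d + 2 * z)%R &
    forall s, I s -> sk s = (z / (b - a))%R].
Proof.
move=> al_ be_ ab.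
have IE : I = `]a, b[%classic.
  by apply/seteqP; split => s; rewrite /I al_ be_ /= !lte_fin in_itv.
(* A quarter of the length keeps [a + eps] < [m] < [b - eps], and [eps] at most [delta] makes [w]
   vanish at [a + eps] and [b - eps]. *)
pose m := ((a + b) / 2)%R; pose eps := (Num.min delta ((b - a) / 4))%R.
have eps0 : (0 < eps)%R by rewrite lt_min delta0 divr_gt0// subr_gt0.
have epsd : (eps <= delta)%R by rewrite ge_min lexx.
have epsb : (eps <= (b - a) / 4)%R by rewrite ge_min lexx orbT.
have am_ : (a < m)%R by rewrite /m; lra.
have mb : (m < b)%R by rewrite /m; lra.
have Rb : ((b - a) / 2)%:E < Rad.
  case: Rad_gt => [|->]; last by rewrite ltry.
  by rewrite al_ be_ -EFinB -EFinM mulrC.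
have I0 r : (0 < r)%R -> (r <= (b - a) / 2)%R -> interval0 Rad r.
  by move=> r0 rb; split => //; rewrite (le_lt_trans _ Rb)// lee_fin.
have wl s : (a < s)%R -> (s <= a + eps)%R -> w s = 0%R /\ w' s = 0%R.
  move=> as_ se; apply: w_end; first by rewrite IE /= in_itv /= as_; lra.
  by left; rewrite /am al_ -EFinB lee_fin; lra.
have wr s : (b - eps <= s)%R -> (s < b)%R -> w s = 0%R /\ w' s = 0%R.
  move=> as_ se; apply: w_end; first by rewrite IE /= in_itv /= se andbT; lra.
  by right; rewrite /ap be_ -EFinB lee_fin; lra.
have s1m : (a + eps < m)%R by rewrite /m; lra.
have ms2 : (m < b - eps)%R by rewrite /m; lra.
have Iab s : (a < s < b)%R -> I s by rewrite IE /= in_itv.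
have [] := @half_piece 1%R a w w' ap am (or_introl erefl) dw cw' `]a, m]%classic (a + eps)%R m m s1m.
- by move=> s /andP[h1 h2]; apply: I0; rewrite /dist mul1r; rewrite /m in h2 *; lra.
- move=> s sm; rewrite /= in_itv /= => /andP[h1 h2] _.
  have {}h2 : (s < m)%R by rewrite lt_neqAle sm.
  have h : (s - a < b - s)%R by rewrite /m in h2; lra.
  rewrite /ap /am /dist /side al_ be_ -!EFinB lte_fin h mul1r; split => //.
  by rewrite min_r// lee_fin ltW.
- move=> s sm; rewrite /= in_itv /= => /andP[h1 h2]; rewrite h2 andbT -ltNge => h.
  by apply: wl => //; exact: ltW.
- move=> s sm /andP[h1 h2]; rewrite /= in_itv /= h2 andbT; lra.
move=> A1 [B1 [D1 [HA1 HB1 HC1 E1]]].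
have [] := @half_piece (-1)%R b w w' ap am (or_intror erefl) dw cw' `]m, b[%classic m (b - eps)%R m ms2.
- by move=> s /andP[h1 h2]; apply: I0; rewrite /dist mulN1r opprB; rewrite /m in h1 *; lra.
- move=> s sm; rewrite /= in_itv /= => /andP[h1 h2] _.
  have h : (b - s < s - a)%R by rewrite /m in h1; lra.
  rewrite /ap /am /dist /side al_ be_ -!EFinB lte_fin ltNge ltW//= mulN1r opprB; split => //.
  by rewrite min_l// lee_fin ltW.
- move=> s sm; rewrite /= in_itv /= => /andP[h1 h2]; rewrite (ltW h1) /= -ltNge => h.
  by apply: wr => //; exact: ltW.
- move=> s sm /andP[h1 h2]; rewrite /= in_itv /= lt_neqAle eq_sym sm h1 /=; lra.
move=> A2 [B2 [D2 [HA2 HB2 HC2 E2]]].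
have IU : I = `]a, m]%classic `|` `]m, b[%classic.
  apply/seteqP; split => s; rewrite IE /= !in_itv /=.
    by move=> /andP[-> ->]; rewrite andbT; apply/orP; case: leP.
  by case=> /andP[h1 h2]; apply/andP; split => //; lra.
have dis : [disjoint (`]a, m]%classic : set R) & `]m, b[%classic].
  apply/disj_setPS => s [] /=; rewrite !in_itv /= => /andP[_ h1] /andP[h2 _].
  by move: (lt_le_trans h2 h1); rewrite ltxx.
have split_int (f : R -> R) : measurable_fun I (EFin \o f) -> (forall s, (0 <= f s)%R) ->
    \int[leb]_(s in I) (f s)%:E = \int[leb]_(s in `]a, m]) (f s)%:E + \int[leb]_(s in `]m, b[) (f s)%:E.
  move=> mf f0; rewrite IU ge0_integral_setU//; first by rewrite -IU.
  by move=> s _; rewrite lee_fin.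
exists (A1 + A2)%R, (B1 + B2)%R, (D1 + D2)%R, (flux p V phi ((b - a) / 2) * `|w m| `^ p)%R; split.
- by rewrite /IA split_int// ?HA1 ?HA2// => s; exact: iA_ge0.
- by rewrite /IB split_int// ?HB1 ?HB2// => s; exact: iB_ge0.
- by rewrite /IC split_int// ?HC1 ?HC2// => s; exact: iC_ge0.
- rewrite E1 E2 /dG.
  have [-> _] : w (a + eps)%R = 0%R /\ w' (a + eps)%R = 0%R by apply: wl => //; rewrite ltrDl.
  have [-> _] : w (b - eps)%R = 0%R /\ w' (b - eps)%R = 0%R by apply: wr => //; rewrite ltrBlDr ltrDl.
  rewrite normr0 powR0// !mulr0 /dist !mul1r !mulN1r opprB.
  have -> : (m - a = (b - a) / 2)%R by rewrite /m; lra.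
  have -> : (b - m = (b - a) / 2)%R by rewrite /m; lra.
  by ring.
move=> s _; rewrite /sk /skel /mid_shift /ap /am al_ be_ -!EFinB -EFinD /=.
have -> : (b - s + (s - a) = b - a)%R by ring.
have -> : (s + (b - s - (s - a)) / 2 = m)%R by rewrite /m; lra.
rewrite cutoffE; first by rewrite mulrAC.
by apply: I0 => //; rewrite divr_gt0// subr_gt0.
Qed.

(** The parts of the skeletal term sit on opposite sides, so all terms are nonnegative and can be
    summed and integrated without finiteness conditions. In the bounded case they are max(z, 0) and
    max(-z, 0), one of which is 0; the two bounds then follow from the equality, and they survive
    integration to settle the infinite cases in the end. *)
Lemma component_identity : I !=set0 ->
  [/\ IA + 2%:E * SM = IB + IC + 2%:E * SP, 2%:E * SP <= IA & 2%:E * SM <= IB + IC].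
Proof.
move=> [s0 /andP[al_s0 s0_be]].
have skI : al = -oo \/ be = +oo -> forall s, I s -> sk s = 0%R.
  move=> infty s _; rewrite /sk /skel /ap /am.
  by case: infty al_s0 s0_be => ->; [case: be => [?||]|case: al => [?||]]; rewrite //= mul0r.
move: s0_be al_s0; case be_ : be => [b||] // + +; last first.
  have sk0 := skI (or_intror be_).
  case al_ : al => [a||] // _ _.
    exact: zero_skel sk0 (rhalf_case al_ be_).
  exact: zero_skel sk0 (line_case al_ be_).
case al_ : al => [a||] // s0b as0; last first.
  exact: zero_skel (skI (or_introl al_)) (lhalf_case al_ be_).
have ab : (a < b)%R by move: as0 s0b; rewrite !lte_fin; exact: lt_trans.
have [x [y [d [z [Ax By Cd xE skE]]]]] := bounded_case al_ be_ ab.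
have IE : I = `]a, b[%classic.
  by apply/seteqP; split => s; rewrite /I al_ be_ /= !lte_fin in_itv.
have I_len : leb I = (b - a)%:E.
  rewrite IE; apply: etrans (lebesgue_measure_itv `]a, b[) _.
  by rewrite /= lte_fin ab EFinB.
have mI : measurable I by rewrite IE; exact: measurable_itv.
have ba0 : (0 < b - a)%R by rewrite subr_gt0.
have intc (k : R) : \int[leb]_(s in I) k%:E = (k * (b - a))%:E.
  by rewrite integral_cst// EFinM -I_len.
have SPE : SP = (Num.max z 0)%:E.
  rewrite /SP -[in RHS](divfK (lt0r_neq0 ba0) (Num.max z 0)%R) -intc.
  apply: eq_integral => s /set_mem Is; rewrite skE//; congr EFin.
  by rewrite maxr_pMl ?invr_ge0 ?(ltW ba0)// mul0r.
have SME : SM = (Num.max (- z) 0)%:E.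
  rewrite /SM -[in RHS](divfK (lt0r_neq0 ba0) (Num.max (- z) 0)%R) -intc.
  apply: eq_integral => s /set_mem Is; rewrite skE//; congr EFin.
  by rewrite maxr_pMl ?invr_ge0 ?(ltW ba0)// mul0r mulNr.
have x0 : (0 <= x)%R.
  by rewrite -lee_fin -Ax; apply: integral_ge0 => s _; rewrite lee_fin iA_ge0.
have y0 : (0 <= y)%R.
  by rewrite -lee_fin -By; apply: integral_ge0 => s _; rewrite lee_fin iB_ge0.
have d0 : (0 <= d)%R.
  by rewrite -lee_fin -Cd; apply: integral_ge0 => s _; rewrite lee_fin iC_ge0.
rewrite SPE SME Ax By Cd -!EFinM -!EFinD !lee_fin.
have [z0|z0] := leP 0%R z.
  have Nz0 : (- z <= 0)%R by rewrite oppr_le0.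
  rewrite ?(max_l z0) ?(max_r Nz0); split; [|lra|lra].
  by congr EFin; lra.
have Nz0 : (0 <= - z)%R by rewrite oppr_ge0 ltW.
rewrite ?(max_r (ltW z0)) ?(max_l Nz0); split; [|lra|lra].
by congr EFin; lra.
Qed.

End component_identity.
End component.

(** * Summation over the components of a chord *)

Section component_sum.
Context {R : realType}.
Local Notation leb := (@lebesgue_measure R).
Variable C : set R.
Hypothesis oC : open C.

Lemma open_component (s : R) : open (component C s : set R).
Proof.
rewrite component_itv; case: (lend C s) => [a||]; case: (rend C s) => [b||];
  first [exact: open0 | exact: openT | exact: interval_open].
Qed.

Lemma component_rat s : C s -> exists q : rat, component C s (ratr q).
Proof.
move=> Cs; have /andP[ls sr] := component_refl oC Cs.
have [y sy yr] : exists2 y : R, (s < y)%R & y%:E <= rend C s.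
  move: sr; case: (rend C s) => [b||] //; first by rewrite lte_fin; exists b.
  by exists (s + 1)%R; rewrite ?ltrDl ?leey.
have [q /itvP qy] := rat_in_itvoo sy; exists q; rewrite /component /=.
by rewrite (lt_trans ls) ?lte_fin ?qy// (lt_le_trans _ yr)// lte_fin qy.
Qed.

Let good (k : nat) (x : R) : Prop :=
  exists q : rat, [/\ choice.unpickle k = Some q, C (ratr q) & component C (ratr q) x].

(** Each component contains a rational and is labelled by the least index of such a rational. So
    [piece k] is either a component or empty, and the pieces partition [C]. *)
Let piece (k : nat) : set (measurableTypeR R) :=
  [set x | good k x /\ forall j, (j < k)%N -> ~ good j x].

Let piece_comp k x : piece k x -> C x /\ piece k = component C x.
Proof.
move=> [[q [kq Cq qx]] Nj]; have Cx := component_sub qx.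
split => //; have E := component_eq oC Cq qx.
apply/seteqP; split => [y [[q' [kq' Cq' q'y]] _]|y].
  by move: kq'; rewrite kq => -[qq]; move: q'y; rewrite -qq E.
rewrite E => qy; split; first by exists q.
move=> j jk [r [jr Cr ry]]; apply: (Nj j jk); exists r; split => //.
have := component_eq oC Cr ry; rewrite (component_eq oC Cq qy) => <-.
exact: qx.
Qed.

Let piece_cover : C = \bigcup_k piece k.
Proof.
apply/seteqP; split => [x Cx|x [k _ /piece_comp[]]//].
have [q qx] := component_rat Cx.
have exk : exists k, `[< good k x >].
  exists (choice.pickle q); apply/asboolP; exists q; rewrite choice.pickleK; split => //.
    exact: component_sub qx.
  by rewrite (component_eq oC Cx qx); exact: component_refl.
have kx := ex_minnP exk; case: kx => k /asboolP gk mink.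
exists k => //; split => // j jk gj.
by have := mink j (asboolT gj); rewrite leqNgt jk.
Qed.

Let piece_triv : trivIset setT piece.
Proof.
apply/trivIsetP => i j _ _ ij; apply/seteqP; split => // x [[gi Ni] [gj Nj]].
by move: ij; rewrite neq_ltn => /orP[/Nj|/Ni]; apply.
Qed.

Let measurable_piece k : measurable (piece k).
Proof.
have [[x /piece_comp[_ ->]]|/set0P/negP/negPn/eqP ->//] := pselect (piece k !=set0).
exact: measurable_component.
Qed.

Lemma le_integral_comp (F G : R -> \bar R) :
  measurable_fun setT F -> measurable_fun setT G ->
  (forall x, 0 <= F x) -> (forall x, 0 <= G x) ->
  (forall s, C s -> \int[leb]_(x in component C s) F x <= \int[leb]_(x in component C s) G x) ->
  \int[leb]_(x in C) F x <= \int[leb]_(x in C) G x.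
Proof.
move=> mF mG F0 G0 FG; rewrite piece_cover.
rewrite ge0_integral_bigcup//; last exact: measurable_funTS.
rewrite ge0_integral_bigcup//; last exact: measurable_funTS.
apply: lee_nneseries => k _; first by move=> _; exact: integral_ge0.
have [[x /piece_comp[Cx ->]]|/set0P/negP/negPn/eqP ->//] := pselect (piece k !=set0).
  exact: FG.
by rewrite !integral_set0.
Qed.

Lemma eq_integral_comp (F G : R -> \bar R) :
  measurable_fun setT F -> measurable_fun setT G ->
  (forall x, 0 <= F x) -> (forall x, 0 <= G x) ->
  (forall s, C s -> \int[leb]_(x in component C s) F x = \int[leb]_(x in component C s) G x) ->
  \int[leb]_(x in C) F x = \int[leb]_(x in C) G x.
Proof.
move=> mF mG F0 G0 FG; apply/eqP; rewrite eq_le.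
by apply/andP; split; apply: le_integral_comp => // s Cs; rewrite FG.
Qed.

Lemma integral_bigcup_comp (A : set (set R)) (F : R -> \bar R) :
  finite_set A -> A `<=` [set component C s | s in C] ->
  measurable_fun setT F -> (forall x, 0 <= F x) ->
  (forall s, C s -> ~ A (component C s) -> F s = 0) ->
  \int[leb]_(x in C) F x = \sum_(l \in A) \int[leb]_(x in l) F x.
Proof.
move=> finA AC mF F0 FA0.
(* Agrees with the identity on [A] and is measurable for every index. *)
pose G (l : set R) : set (measurableTypeR R) := if `[< measurable (l : set (measurableTypeR R)) >] then l else set0.
have GA l : A l -> G l = l.
  by move=> /AC[s _ <-]; rewrite /G asboolT//; exact: measurable_component.
have mG l : measurable (G l) by rewrite /G; case: asboolP.
rewrite fsbig_finite//=.
transitivity (\sum_(l <- fset_set A) \int[leb]_(x in G l) F x); last first.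
  rewrite big_seq [RHS]big_seq; apply: eq_bigr => l.
  by rewrite in_fset_set// => /set_mem /GA ->.
rewrite -ge0_integral_bigsetU//; last 2 first.
- move=> l1 l2; rewrite /= !in_fset_set// => /set_mem A1 /set_mem A2.
  rewrite !GA// => -[x [l1x l2x]].
  have [s1 Cs1 E1] := AC _ A1; have [s2 Cs2 E2] := AC _ A2.
  move: l1x l2x; rewrite -E1 -E2 => h1 h2.
  by rewrite -(component_eq oC Cs1 h1) -(component_eq oC Cs2 h2).
- exact: measurable_funTS.
rewrite [LHS]integral_mkcond [RHS]integral_mkcond; apply: eq_integral => x _.
rewrite !patchE; case: (boolP (x \in C)) => [/set_mem Cx|xC].
  have [Ax|Ax] := pselect (A (component C x)).
    rewrite mem_set// -bigcup_seq; exists (component C x); first by rewrite /= in_fset_set ?inE.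
    by rewrite GA//; exact: component_refl.
  by rewrite FA0//; case: ifP.
case: ifPn => // /set_mem; rewrite -bigcup_seq => -[l]; rewrite /= in_fset_set// => /set_mem Al.
rewrite GA// => lx; exfalso; move/negP: xC; apply; rewrite inE.
by have [s Cs E] := AC _ Al; move: lx; rewrite -E => /component_sub.
Qed.

End component_sum.

(** * Measures with a density, and uniqueness of finite Borel measures on R^n *)

Section density.
Context d (T : measurableType d) (R : realType).
Variables (mu : {measure set T -> \bar R}) (w : T -> R).
Hypothesis mw : measurable_fun setT w.
Hypothesis w0 : forall x, (0 <= w x)%R.

Let mwE : measurable_fun setT (EFin \o w). Proof. exact/measurable_EFinP. Qed.
Let wE0 x : 0 <= (w x)%:E. Proof. by rewrite lee_fin. Qed.

Lemma ex_density : exists m : {measure set T -> \bar R},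
  forall A, measurable A -> m A = \int[mu]_(x in A) (w x)%:E.
Proof.
pose m (A : set T) := \int[mu]_(x in A) (w x)%:E.
have m0 : m set0 = 0 by rewrite /m integral_set0.
have mge0 A : 0 <= m A by exact: integral_ge0.
have madd : semi_sigma_additive m.
  move=> F mF tF mUF; rewrite /m ge0_integral_bigcup//; last exact: measurable_funTS.
  by apply: is_cvg_ereal_nneg_natsum => k _; exact: integral_ge0.
pose M : {measure set T -> \bar R} := HB.pack_for {measure set T -> \bar R} m
  (isMeasure.Build _ _ _ m m0 mge0 madd).
by exists M.
Qed.

(** True for simple functions by the formula for the measure of a set, then for [h] by monotone
    convergence on both sides. *)
Lemma ge0_integral_density (m : {measure set T -> \bar R}) (h : T -> \bar R) :
  (forall A, measurable A -> m A = \int[mu]_(x in A) (w x)%:E) ->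
  measurable_fun setT h -> (forall x, 0 <= h x) ->
  \int[m]_x h x = \int[mu]_x (h x * (w x)%:E).
Proof.
move=> mE mh h0.
pose f := nnsfun_approx measurableT mh.
have fh x : EFin \o f^~ x @ \oo --> h x by apply: cvg_nnsfun_approx.
have ndf x : {homo (fun n => (f n x)%:E) : a b / (a <= b)%N >-> a <= b}.
  by move=> a b ab; rewrite lee_fin; exact/lefP/nd_nnsfun_approx.
have hE x : h x = limn (EFin \o f^~ x) by apply/esym/cvg_lim.
have lhs : (fun n => \int[m]_x (f n x)%:E) @ \oo --> \int[m]_x h x.
  rewrite (_ : \int[m]_x h x = \int[m]_x limn (fun n => (f n x)%:E)); last first.
    by apply: eq_integral => x _; exact: hE.
  apply: cvg_monotone_convergence => //.
  - by move=> n; exact/measurable_EFinP.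
  - by move=> n x _; rewrite lee_fin.
have rhs : (fun n => \int[mu]_x ((f n x)%:E * (w x)%:E)) @ \oo --> \int[mu]_x (h x * (w x)%:E).
  rewrite (_ : \int[mu]_x _ = \int[mu]_x limn (fun n => (f n x)%:E * (w x)%:E)); last first.
    apply: eq_integral => x _; apply/esym/cvg_lim => //.
    by apply: cvgeMr => //; exact: fh.
  apply: cvg_monotone_convergence => //.
  - by move=> n; apply: emeasurable_funM => //; exact/measurable_EFinP.
  - by move=> n x _; rewrite mule_ge0// lee_fin.
  - by move=> x _ a b ab; apply: lee_wpmul2r => //; exact: ndf.
suff E : (fun n => \int[m]_x (f n x)%:E) = (fun n => \int[mu]_x ((f n x)%:E * (w x)%:E)).
  rewrite E in lhs; rewrite -(cvg_lim (@ereal_hausdorff R) lhs).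
  exact: cvg_lim rhs.
apply/funext => n; rewrite integralT_nnsfun sintegralE.
transitivity (\int[mu]_x (\sum_(y \in range (f n)) (y%:E * (\1_(f n @^-1` [set y]) x)%:E * (w x)%:E))).
  rewrite ge0_integral_fsum//; last 2 first.
  - move=> y; apply: emeasurable_funM => //; apply: emeasurable_funM => //.
    by apply/measurable_EFinP; exact: measurable_indic.
  - by move=> y x _; rewrite mule_ge0// nnfun_muleindic_ge0.
  apply: eq_fsbigr => y _; rewrite mE//.
  have [y0|y0] := leP 0%R y; last first.
    rewrite preimage_nnfun0// integral_set0 mule0 integral0_eq// => x _.
    by rewrite indic0 mule0 mul0e.
  rewrite -ge0_integralZl//; last exact: measurable_funTS.
  rewrite integral_mkcond; apply: eq_integral => x _; rewrite patchE indicE.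
  by case: ifPn => _; rewrite ?mule1// mule0 mul0e.
apply: eq_integral => x _; rewrite -ge0_mule_fsuml; last by move=> y; exact: nnfun_muleindic_ge0.
by congr (_ * _); rewrite (fimfunE (f n) x) -fsumEFin.
Qed.

End density.

Section unique.
Context {R : realType} (n : nat).

Lemma measurable_rV_open : @measurable _ 'rV[R]_n = <<s open >>.
Proof.
apply/seteqP; split; last first.
  apply: smallest_sub; first exact: sigma_algebra_measurable.
  by move=> U oU; exact: measurable_openrV.
apply: smallest_sub; first exact: smallest_sigma_algebra.
rewrite -bigcup_seq; apply: bigcup_sub => i _ B [C mC <-].
pose f : g_sigma_algebraType (open : set (set 'rV[R]_n)) -> measurableTypeR R := coord_rV i.
suff : measurable_fun setT f by move=> /(_ measurableT _ mC).
apply: (measurability _ (RGenOpens.measurableE R)).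
move=> _ [_ [a [b ->] <-]]; rewrite setTI; apply: sub_sigma_algebra.
apply: open_comp; last exact: interval_open.
by move=> x _; exact: coord_continuous.
Qed.

(** The open sets are stable under intersection, contain the whole space and generate the
    sigma-algebra. *)
Lemma finite_measure_rV_unique (m1 m2 : {measure set 'rV[R]_n -> \bar R}) :
  (forall U, open U -> m1 U = m2 U) -> m1 setT < +oo ->
  forall A, measurable A -> m1 A = m2 A.
Proof.
move=> m12 moo A mA.
apply: (@measure_unique _ R 'rV[R]_n open (fun=> setT) _ _ _ _ m1 m2 _ _ A mA) => //.
- exact: measurable_rV_open.
- by move=> U1 U2; exact: openI.
- by move=> _; exact: openT.
- by rewrite bigcup_const.
Qed.

End unique.

(** * Length and midpoint of the segment through a point, as measurable functions *)

Section reach_measurability.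
Context {R : realType} {N : nat}.
Variable Omega : set 'rV[R]_N.
Hypothesis oO : open Omega.

Lemma measurable_at_rho d (T : measurableType d) (c : R) (f : R -> R) (g : T -> \bar R) :
  measurable_fun setT f -> measurable_fun setT g ->
  measurable_fun setT (fun x => at_rho c f (g x)).
Proof.
move=> mf mg.
apply: (eq_measurable_fun (fun x => if (-oo < g x) && (g x < +oo) then f (fine (g x)) else c)).
  by move=> x _; case: (g x) => [r||] //=; rewrite ltNyr ltry.
apply: measurable_fun_ifT => //.
  by apply: measurable_and; exact: measurable_fun_lte.
apply: measurableT_comp => //; exact: measurableT_comp.
Qed.

Lemma measurable_invr : measurable_fun [set: R] (fun r : R => r^-1%R).
Proof.
apply: (eq_measurable_fun (fun r : R => if (0 <= r)%R then r `^ (-1) else - (- r) `^ (-1))%R).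
  by move=> r _; case: leP => r0; rewrite powR_inv1// ?oppr_ge0 ?(ltW r0)// invrN opprK.
apply: measurable_fun_ifT.
- exact: measurable_fun_ler.
- exact: measurable_powR.
- apply: measurableT_comp => //.
  by apply: (measurableT_comp (measurable_powR (R := R) (-1)%R)).
Qed.

Lemma measurable_oppr_rV : measurable_fun [set: 'rV[R]_N] (fun x => - x)%R.
Proof.
have := measurable_mulmx_rV (R := R) (n := N) (- 1%:M)%R.
by apply: eq_measurable_fun => x _; rewrite mulmxN mulmx1.
Qed.

Lemma measurable_reach2 d (T : measurableType d) (nu x : T -> 'rV[R]_N) :
  measurable_fun setT nu -> measurable_fun setT x ->
  measurable_fun setT (fun t => reach Omega (nu t) (x t)).
Proof.
move=> mnu mx; apply: (measurableT_comp (measurable_reach oO) (measurable_fun_pair mnu mx)).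
Qed.

Lemma measurable_reachN2 d (T : measurableType d) (nu x : T -> 'rV[R]_N) :
  measurable_fun setT nu -> measurable_fun setT x ->
  measurable_fun setT (fun t => reach Omega (- nu t)%R (x t)).
Proof.
move=> mnu mx; apply: measurable_reach2 => //; exact: measurableT_comp measurable_oppr_rV mnu.
Qed.

(** The inverse length of the segment through [x] in the direction [nu]. It is 0 when that length is
    infinite, in which case [midp] below has no meaning but always occurs multiplied by this
    weight. *)
Definition wt nu x : R :=
  at_rho 0 (@GRing.inv R) (reach Omega nu x + reach Omega (- nu)%R x).
Definition midp nu x : 'rV[R]_N :=
  (x + mid_shift (reach Omega nu x) (reach Omega (- nu)%R x) *: nu)%R.

Lemma wt_ge0 nu x : (0 <= wt nu x)%R.
Proof.
rewrite /wt; have : 0 <= reach Omega nu x + reach Omega (- nu)%R x.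
  by rewrite adde_ge0// reach_ge0.
by case: (_ + _) => [r||] //=; rewrite lee_fin invr_ge0.
Qed.

Lemma measurable_wt d (T : measurableType d) (nu x : T -> 'rV[R]_N) :
  measurable_fun setT nu -> measurable_fun setT x ->
  measurable_fun setT (fun t => wt (nu t) (x t)).
Proof.
move=> mnu mx; apply: measurable_at_rho.
  exact: measurable_invr.
by apply: emeasurable_funD; [exact: measurable_reach2|exact: measurable_reachN2].
Qed.

Lemma measurable_mid_shift d (T : measurableType d) (nu x : T -> 'rV[R]_N) :
  measurable_fun setT nu -> measurable_fun setT x ->
  measurable_fun setT (fun t => mid_shift (reach Omega (nu t) (x t)) (reach Omega (- nu t)%R (x t))).
Proof.
move=> mnu mx; apply: measurable_funM => //; apply: measurable_funB.
  by apply: measurableT_comp => //; exact: measurable_reach2.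
by apply: measurableT_comp => //; exact: measurable_reachN2.
Qed.

Lemma measurable_midp d (T : measurableType d) (nu x : T -> 'rV[R]_N) :
  measurable_fun setT nu -> measurable_fun setT x ->
  measurable_fun setT (fun t => midp (nu t) (x t)).
Proof.
move=> mnu mx; apply: measurable_funD_rV => //.
by apply: measurable_funZ_rV => //; exact: measurable_mid_shift.
Qed.

Lemma measurable_line (z nu : 'rV[R]_N) :
  measurable_fun [set: measurableTypeR R] (fun s : measurableTypeR R => z + s *: nu)%R.
Proof. by apply: measurable_funD_rV => //; exact: measurable_funZ_rV. Qed.

End reach_measurability.

(** * The sum over midpoints as an integral along the line *)

Section skeleton_sum.
Context {R : realType} {N : nat}.
Variable Omega : set 'rV[R]_N.
Hypothesis oO : open Omega.
Variables z nu : 'rV[R]_N.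
Hypothesis nu1 : usphere nu.
Local Notation leb := (@lebesgue_measure R).
Local Notation C := (chord Omega nu z).
Let oC : open C. Proof. exact: open_chord. Qed.

Lemma usphere_neq0 : nu != 0%R.
Proof.
apply/eqP => nu0; move: nu1; rewrite /usphere /= nu0 /enorm /dotp big1 ?sqrtr0 => [/esym/eqP|i _].
  by rewrite oner_eq0.
by rewrite mxE mul0r.
Qed.

Lemma line_bounded (K : set 'rV[R]_N) : bounded_set K ->
  exists M : R, forall s, K (z + s *: nu)%R -> (`|s| < M)%R.
Proof.
move=> [B0 [_ KB0]]; pose B := (B0 + 1)%R.
have BK : forall x, K x -> (`|x| <= B)%R by apply: KB0; rewrite ltrDl.
have nu0 : (0 < `|nu|)%R by rewrite normr_gt0 usphere_neq0.
exists ((B + `|z|) / `|nu| + 1)%R => s /BK /= sB.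
rewrite (@le_lt_trans _ _ ((B + `|z|) / `|nu|)%R)// ?ltrDl// ler_pdivlMr// -normrZ.
by rewrite (le_trans _ (lerD sB (lexx _)))// -[X in (`|X| <= _)%R](addKr z) addrC ler_normB.
Qed.

Let ends s (a b : R) : C s -> lend C s = a%:E -> rend C s = b%:E ->
  [/\ component C s = `]a, b[%classic, (a < s < b)%R,
    midpoint z nu (component C s) = Some (z + ((a + b) / 2) *: nu)%R,
    midp Omega nu (z + s *: nu)%R = (z + ((a + b) / 2) *: nu)%R &
    wt Omega nu (z + s *: nu)%R = (b - a)^-1%R].
Proof.
move=> Cs la rb.
have E : component C s = `]a, b[%classic by rewrite component_itv la rb.
have asb : (a < s < b)%R.
  by have := component_refl oC Cs; rewrite E /= in_itv.
have ab : (a < b)%R by case/andP: asb; exact: lt_trans.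
split => //.
- rewrite /midpoint E asboolT; last first.
    split; [exists b|exists a] => t; rewrite /= in_itv /= => /andP[]; by move=> *; rewrite ltW.
  rewrite inf_itv ?sup_itv//.
- rewrite /midp /mid_shift reach_line reachN_line la rb -!EFinB /= -addrA -scalerDl.
  congr (_ + _ *: _)%R; lra.
- rewrite /wt reach_line reachN_line la rb -!EFinB -EFinD /=.
  by congr (_^-1)%R; ring.
Qed.

Let no_ends s : C s -> lend C s = -oo \/ rend C s = +oo ->
  midpoint z nu (component C s) = None /\ wt Omega nu (z + s *: nu)%R = 0%R.
Proof.
move=> Cs infty; split; last first.
  rewrite /wt reach_line reachN_line.
  have := lend_lt oC Cs; have := rend_gt oC Cs.
  by case: infty => ->; [case: (rend C s) => [b||]|case: (lend C s) => [b||]].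
rewrite /midpoint asboolF// => -[[B ubB] [A lbA]].
have /andP[sl sr] := component_refl oC Cs.
case: infty => infty.
  have : component C s (Num.min s A - 1)%R.
    rewrite /component /= infty ltNyr /= (le_lt_trans _ sr)// lee_fin.
    by rewrite lerBlDr ge_min lerDl ler01.
  by move=> /lbA; rewrite leNgt ltrBlDr (@le_lt_trans _ _ A) ?ge_min ?lexx ?orbT// ltrDl.
have : component C s (Num.max s B + 1)%R.
  rewrite /component /= infty ltry andbT (lt_le_trans sl)// lee_fin.
  by rewrite (@le_trans _ _ (Num.max s B))// ?le_max ?lexx// lerDl.
by move=> /ubB; rewrite leNgt (@le_lt_trans _ _ (Num.max s B)) ?le_max ?lexx ?orbT// ltrDl.
Qed.

Let ends_or s : C s -> (exists a b, lend C s = a%:E /\ rend C s = b%:E) \/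
  (midpoint z nu (component C s) = None /\ wt Omega nu (z + s *: nu)%R = 0%R).
Proof.
move=> Cs; have := @no_ends s Cs.
have := lend_lt oC Cs; have := rend_gt oC Cs.
case: (lend C s) => [a||] //; case: (rend C s) => [b||] // _ _ H.
- by left; exists a, b.
- by right; apply: H; right.
- by right; apply: H; left.
- by right; apply: H; left.
Qed.

Lemma segmentsE : segments Omega z nu = [set component C s | s in C].
Proof.
apply/seteqP; split => l [s Cs <-]; exists s => //; first by rewrite -connected_componentE.
exact: connected_componentE.
Qed.

(** Along a bounded component both [wt] and [midp] are constant, so the integral over it of the
    inverse length times the value of [f] at the midpoint is that value. *)
Lemma skeleton_sum (f : 'rV[R]_N -> R) : measurable_fun setT f ->
  (forall x, (0 <= f x)%R) -> compactly_supported Omega f ->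
  (\sum_(l \in segments Omega z nu) oapp f 0 (midpoint z nu l))%R%:E =
  \int[leb]_(s in C) (wt Omega nu (z + s *: nu) * f (midp Omega nu (z + s *: nu)))%R%:E.
Proof.
move=> mf f0 [cK KO]; set K := closure _ in cK KO.
pose F s := (wt Omega nu (z + s *: nu) * f (midp Omega nu (z + s *: nu)))%R%:E.
have fK x : f x != 0%R -> K x.
  by move=> fx; apply: (@subset_closure _ [set x | f x != 0%R]).
have mline := measurable_line z nu.
have mF : measurable_fun setT F.
  apply/measurable_EFinP; apply: measurable_funM.
    by apply: measurable_wt => //; exact: measurable_cst.
  by apply: measurableT_comp => //; apply: measurable_midp => //; exact: measurable_cst.
have F0 s : 0 <= F s by rewrite lee_fin mulr_ge0// wt_ge0.
pose K' := [set s : R | K (z + s *: nu)%R].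
have cline : continuous (fun s : R => z + s *: nu)%R.
  by move=> s; apply: cvgD; [exact: cvg_cst|apply: cvgZr_tmp; exact: cvg_id].
have closK' : closed K'.
  by apply: (@closed_comp _ _ (fun s : R => z + s *: nu)%R) => [s _|]; [exact: cline|exact: closed_closure].
have compK' : compact K'.
  have [M MK] := line_bounded (compact_bounded cK).
  apply: (subclosed_compact closK' (@segment_compact R (- M)%R M)) => s /MK /ltW.
  by rewrite /= in_itv /= ler_norml.
have K'C : K' `<=` C by move=> s /KO.
have mid_K' s a b : C s -> lend C s = a%:E -> rend C s = b%:E ->
    f (z + ((a + b) / 2) *: nu)%R != 0%R -> K' ((a + b) / 2)%R /\ component C s ((a + b) / 2)%R.
  move=> Cs la rb fm; split; first exact: fK.
  have [-> /andP[h1 h2] _ _ _] := ends Cs la rb; rewrite /= in_itv /=.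
  by apply/andP; split; lra.
pose g (l : set R) := oapp f 0%R (midpoint z nu l).
pose A := segments Omega z nu `&` g @^-1` [set~ 0%R].
(* The midpoints where [f] does not vanish lie in the compact [K'], which is covered by the open
   components. Finitely many of them suffice, and these include every component with such a
   midpoint. *)
have finA : finite_set A.
  have := compK'; rewrite compact_cover => /(_ R K' (component C)).
  move=> [i _|s Ks|D DK' K'D].
  - exact: open_component.
  - by exists s => //; apply: component_refl => //; exact: K'C.
  apply: (@sub_finite_set _ _ (component C @` [set` D])); last first.
    exact/finite_image/finite_fset.
  move=> l []; rewrite segmentsE => -[s Cs <-].
  rewrite /preimage /= /g; have [[a [b [la rb]]]|[-> _ //]] := ends_or Cs.
  have [_ _ -> _ _] := ends Cs la rb => /= /eqP fm.
  have [K'm Cm] := mid_K' _ _ _ Cs la rb fm.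
  have [t Dt tm] := K'D _ K'm; exists t => //.
  rewrite -(component_eq oC Cs Cm) -(component_eq oC _ tm)//.
  by have /DK' := Dt; rewrite inE => /K'C.
rewrite (integral_bigcup_comp oC finA)//; last 2 first.
- by move=> l [+ _]; rewrite segmentsE.
- move=> s Cs NA; rewrite /F.
  have [[a [b [la rb]]]|[_ ->]] := ends_or Cs; last by rewrite mul0r.
  have [_ _ mE mpE wE] := ends Cs la rb; rewrite mpE.
  have [->|fm] := eqVneq (f (z + ((a + b) / 2) *: nu)%R) 0%R; first by rewrite mulr0.
  exfalso; apply: NA; split; first by rewrite segmentsE; exists s.
  by rewrite /preimage /= /g mE /=; exact/eqP.
rewrite fsbig_supp -fsumEFin//; apply: eq_fsbigr => l /set_mem[+ gl].
rewrite segmentsE => -[s Cs lE]; rewrite -lE in gl *.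
move: gl; rewrite /preimage /= /g.
have [[a [b [la rb]]]|[-> _ //]] := ends_or Cs.
have [cE /andP[as_ sb] mE _ _] := ends Cs la rb; rewrite mE /= => fm.
have ab : (0 < b - a)%R by rewrite subr_gt0 (lt_trans as_).
transitivity (\int[leb]_(t in component C s) ((b - a)^-1 * f (z + ((a + b) / 2) *: nu))%R%:E).
  rewrite integral_cst; last exact: measurable_component.
  rewrite [X in _ = _ * X](_ : _ = (b - a)%:E); last first.
    rewrite cE; apply: etrans (lebesgue_measure_itv `]a, b[) _.
    by rewrite /= lte_fin -subr_gt0 ab EFinB.
  by rewrite -EFinM mulrAC mulVf ?mul1r// gt_eqF.
apply: eq_integral => t /set_mem st.
have [lt rt] := component_ends oC Cs st.
rewrite la in lt; rewrite rb in rt.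
by have [_ _ _ -> ->] := ends (component_sub st) lt rt.
Qed.

End skeleton_sum.

(** * Continuous approximation of open sets, and compact neighbourhoods *)

Section cutoff_functions.
Context {R : realType} (n : nat).
Local Open Scope ring_scope.
Implicit Types (U K : set 'rV[R]_n) (x y : 'rV[R]_n).

Definition dist_to (F : set 'rV[R]_n) x : R := inf [set `|x - y| | y in F].

Lemma dist_to_le F x y : F y -> dist_to F x <= `|x - y|.
Proof.
by move=> Fy; apply: ge_inf; [exists 0 => _ [z _ <-]|exists y].
Qed.

Lemma dist_to_ge F x (e : R) : F !=set0 -> (forall y, F y -> e <= `|x - y|) -> e <= dist_to F x.
Proof.
move=> [y0 Fy0] H; apply: lb_le_inf; first by exists `|x - y0|, y0.
by move=> _ [y Fy <-]; exact: H.
Qed.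

Lemma dist_to_continuous F : F !=set0 -> continuous (dist_to F).
Proof.
move=> F0; have lip x y : dist_to F x <= `|x - y| + dist_to F y.
  rewrite -lerBlDl; apply: dist_to_ge => // z Fz; rewrite lerBlDl.
  rewrite (le_trans (dist_to_le x Fz))// -[in leLHS](subrKA y).
  exact: ler_normD.
move=> x; have FF : ProperFilter (nbhs x) by exact: nbhs_pfilter.
apply/cvgrPdist_lt => e e0.
have : nbhs x (ball x e) by exact: nbhsx_ballx.
apply: filterS => y; rewrite -ball_normE /= => xy.
have h1 := lip x y; have h2 := lip y x; rewrite (distrC y) in h2.
by rewrite (le_lt_trans _ xy)// ler_norml; apply/andP; split; lra.
Qed.

(** Take min(1, k d) with d the distance to the complement of [U]; that [U] is not the whole space
    keeps this complement nonempty. *)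
Lemma ex_approx_open U : open U -> U != setT ->
  exists f : nat -> 'rV[R]_n -> R, [/\ forall k, continuous (f k),
    forall k x, 0 <= f k x, forall k x, ~ U x -> f k x = 0,
    forall x, {homo (fun k => f k x) : a b / (a <= b)%N >-> a <= b} &
    forall x, f k x @[k --> \oo] --> (\1_U x : R)].
Proof.
move=> oU /setTPn[y0 Uy0]; pose F := ~` U.
have F0 : F !=set0 by exists y0.
have cd := dist_to_continuous F0.
have d0 x : 0 <= dist_to F x by apply: dist_to_ge.
pose f (k : nat) x := Num.min 1 (k%:R * dist_to F x).
exists f; split.
- move=> k x.
  have c1 : {for x, continuous (cst (1 : R) : 'rV[R]_n -> R)} by exact: cst_continuous.
  have c2 : {for x, continuous (fun x => k%:R * dist_to F x)}.
    have FF : ProperFilter (nbhs x) by exact: nbhs_pfilter.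
    by apply: cvgM; [exact: cvg_cst|exact: cd].
  exact: continuous_min c1 c2.
- by move=> k x; rewrite le_min ler01 mulr_ge0.
- move=> k x Ux; have -> : f k x = Num.min 1 (k%:R * 0); last by rewrite mulr0 min_r.
  congr (Num.min 1 (_ * _)); apply/eqP; rewrite eq_le d0 andbT.
  by rewrite (le_trans (dist_to_le x (Ux : F x)))// subrr normr0.
- move=> x a b ab; rewrite le_min ge_min lexx /= ge_min; apply/orP; right.
  by rewrite ler_wpM2r// ler_nat.
- move=> x; rewrite indicE; case: (boolP (x \in U)) => [/set_mem Ux|]; last first.
    rewrite notin_setE => Ux; rewrite (_ : (fun k => _) = cst 0); first exact: cvg_cst.
    apply/funext => k; have -> : f k x = Num.min 1 (k%:R * 0); last by rewrite mulr0 min_r.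
    congr (Num.min 1 (_ * _)); apply/eqP; rewrite eq_le d0 andbT.
    by rewrite (le_trans (dist_to_le x (Ux : F x)))// subrr normr0.
  have dx : 0 < dist_to F x.
    have /nbhs_ballP[e /= e0 eU] := open_nbhs_nbhs (conj oU Ux).
    apply: (lt_le_trans e0); apply: dist_to_ge => // y Fy; rewrite leNgt.
    by apply/negP => xy; apply: Fy; apply: eU; rewrite -ball_normE.
  apply: cvg_near_cst; near=> k; rewrite /f min_l// -ler_pdivrMr//.
  by near: k; exact: nbhs_infty_ger.
Unshelve. all: by end_near. Qed.

Lemma compact_ball_sub K U : compact K -> open U -> K `<=` U ->
  exists2 d : R, 0 < d & forall x, K x -> ball x d `<=` U.
Proof.
move=> /compact_near_coveringP cK oU KU.
have := cK R (0^'+) (fun e x => ball x e `<=` U) _.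
have H x : K x -> \forall x' \near x & e \near 0^'+, ball x' e `<=` U.
  move=> /KU Ux; have /nbhs_ballP[r /= r0 rU] := open_nbhs_nbhs (conj oU Ux).
  have r20 : 0 < r / 2 by rewrite divr_gt0.
  exists (ball x (r / 2), [set e | e < r / 2]) => /=.
    by split; [exact: nbhsx_ballx|exact: nbhs_right_lt].
  move=> [x' e] /= [xx' er] y x'y; apply: rU; rewrite (splitr r).
  apply: ball_triangle xx' _; apply: le_ball x'y; exact: ltW.
move=> /(_ _ H) {}H.
have [e [e0 eK]] := filter_ex (filterI (nbhs_right_gt (0 : R)) H).
by exists e.
Qed.

Lemma compact_thicken K U : compact K -> open U -> K `<=` U ->
  exists G, [/\ open G, K `<=` G, compact (closure G) & closure G `<=` U].
Proof.
move=> cK oU KU; have [d d0 dU] := compact_ball_sub cK oU KU.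
have d20 : 0 < d / 2 by rewrite divr_gt0.
pose G := \bigcup_(y in K) ball y (d / 2).
have clG x : closure G x -> exists2 y, K y & ball y d x.
  move=> /(_ _ (nbhsx_ballx x (d / 2) d20))[z [[y Ky yz] xz]].
  exists y => //; rewrite (splitr d); apply: ball_triangle yz _; exact: ball_sym.
exists G; split.
- by apply: bigcup_open => y _; exact: ball_open.
- by move=> x Kx; exists x => //; exact: ballxx.
- apply: bounded_closed_compact; last exact: closed_closure.
  have [B [_ KB]] := compact_bounded cK.
  exists (B + 1 + d); split; first exact: num_real.
  move=> M BM x /clG[y Ky]; rewrite -ball_normE /= => yx.
  rewrite -(subrK y x) (le_trans (ler_normD _ _))// distrC.
  have yB : `|y| <= B + 1 by apply: (KB (B + 1)) => //; rewrite ltrDl.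
  lra.
- by move=> x /clG[y Ky yx]; exact: dU yx.
Qed.

End cutoff_functions.

(** * Integrals over the skeleton as integrals over the domain *)

Section skeletal_integral.
Context {R : realType} (n : nat).
Variable Omega : set 'rV[R]_n.+1.
Hypothesis oO : open Omega.
Hypothesis OT : Omega != setT.
Variable nu : 'rV[R]_n.+1.
Hypothesis nu1 : usphere nu.
Variable mu : {measure set 'rV[R]_n.+1 -> \bar R}.
Hypothesis mu_skel : skeletal_measure Omega nu mu.
Local Notation lam := (lebesgue_rV n.+1).
Local Notation leb := (@lebesgue_measure R).

Lemma ge0_integral_chord (f : 'rV[R]_n.+1 -> \bar R) :
  measurable_fun setT f -> (forall x, 0 <= f x) ->
  \int[lam]_(x in Omega) f x = \int[lebesgue_rV n]_y
    \int[leb]_(s in chord Omega nu (y *m frame nu)%R) f (y *m frame nu + s *: nu)%R.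
Proof.
move=> mf f0; rewrite integral_mkcond (ge0_integral_line nu1).
- apply: eq_integral => y _; rewrite [RHS]integral_mkcond; apply: eq_integral => s _.
  rewrite !patchE; case: (boolP (_ \in Omega)) => [/set_mem|/negP] H.
    by rewrite mem_set.
  by case: ifPn => // /set_mem H'; exfalso; apply: H; rewrite inE.
- apply/(measurable_restrictT _ (measurable_openrV oO)).
  exact: measurable_funTS.
- by move=> x; rewrite patchE; case: ifP.
Qed.

Let measurable_skeleton : measurable (skeleton Omega nu).
Proof.
apply: measurableI; last exact: measurable_openrV.
by apply: measurable_closedrV; exact: closed_closure.
Qed.

Let mwt : measurable_fun setT (wt Omega nu).
Proof. by apply: (measurable_wt oO (nu := fun=> nu)). Qed.

Let mmidp : measurable_fun setT (midp Omega nu).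
Proof. by apply: (measurable_midp oO (nu := fun=> nu)). Qed.

Lemma skeletal_integral_Cc (f : 'rV[R]_n.+1 -> R) : continuous f ->
  (forall x, (0 <= f x)%R) -> compactly_supported Omega f ->
  \int[mu]_(m in skeleton Omega nu) (f m)%:E =
  \int[lam]_(x in Omega) (wt Omega nu x * f (midp Omega nu x))%R%:E.
Proof.
move=> cf f0 csf; case: mu_skel => _ ->//.
have mf := continuous_measurable_rV cf.
rewrite ge0_integral_chord; last 2 first.
- apply/measurable_EFinP; apply: measurable_funM => //; exact: measurableT_comp.
- by move=> x; rewrite lee_fin mulr_ge0// wt_ge0.
by apply: eq_integral => y _; rewrite skeleton_sum.
Qed.

Variable G : set 'rV[R]_n.+1.
Hypothesis oG : open G.
Hypothesis cG : compact (closure G).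
Hypothesis GO : closure G `<=` Omega.

Let skelG := skeleton Omega nu `&` G.
Let mskelG : measurable skelG.
Proof. by apply: measurableI => //; exact: measurable_openrV. Qed.

(** The density on R^N whose image measure by [midp] will turn out to be the skeletal measure
    restricted to [G]. *)
Let w x := ((\1_Omega x : R) * wt Omega nu x * \1_G (midp Omega nu x))%R.
Let mO : measurable Omega. Proof. exact: measurable_openrV. Qed.
Let mG : measurable G. Proof. exact: measurable_openrV. Qed.

Let mw : measurable_fun setT w.
Proof.
apply: measurable_funM; first by apply: measurable_funM => //; exact: measurable_indic.
by apply: measurableT_comp => //; exact: measurable_indic.
Qed.

Let w0 x : (0 <= w x)%R.
Proof. by rewrite !mulr_ge0 ?wt_ge0. Qed.

Let integral_w (U : set 'rV[R]_n.+1) : measurable U -> U `<=` G ->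
  \int[lam]_(x in midp Omega nu @^-1` U) (w x)%:E =
  \int[lam]_(x in Omega) (wt Omega nu x * \1_U (midp Omega nu x))%R%:E.
Proof.
move=> mU UG; rewrite integral_mkcond [RHS]integral_mkcond; apply: eq_integral => x _.
rewrite !patchE /w !indicE.
have -> : (x \in midp Omega nu @^-1` U) = (midp Omega nu x \in U).
  by apply/idP/idP => /set_mem H; rewrite inE.
case: (boolP (midp Omega nu x \in U)) => [/set_mem /UG Gx|_].
  by rewrite [_ \in G]mem_set//; case: ifP => _; rewrite ?mul1r ?mul0r.
by case: ifP => _; rewrite ?mulr0.
Qed.

(** The indicator of [U] within [G] is an increasing limit of continuous functions supported in
    [closure G], hence compactly in [Omega]. The defining property of the skeletal measure applies
    to each of them, and monotone convergence passes to the limit on both sides. *)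
Let mu_open (U : set 'rV[R]_n.+1) : open U ->
  mu (U `&` skelG) = \int[lam]_(x in midp Omega nu @^-1` (U `&` G)) (w x)%:E.
Proof.
move=> oU; have oUG : open (U `&` G) by exact: openI.
have UGT : U `&` G != setT.
  apply/negP => /eqP UGT; move/negP: OT; apply; apply/eqP; rewrite -subTset -UGT.
  by move=> x [_ /subset_closure/GO].
rewrite integral_w//; last exact: measurable_openrV.
have [f [cf f0 fU fnd flim]] := ex_approx_open oUG UGT.
have csf k : compactly_supported Omega (f k).
  have sub : closure [set x | f k x != 0%R] `<=` closure G.
    apply: closure_subset => x /= fx; apply: contrapT => Gx; move/negP: fx; apply.
    by apply/eqP; apply: fU => -[].
  split; last exact: subset_trans GO.
  by apply: subclosed_compact cG sub; exact: closed_closure.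
have mf k : measurable_fun setT (f k) by exact: continuous_measurable_rV.
have E k := skeletal_integral_Cc (cf k) (f0 k) (csf k).
have limE x : (\1_(U `&` G) x : R)%:E = limn (fun k => (f k x)%:E).
  by apply/esym/cvg_lim => //; apply: cvg_EFin; [exact: nearW|exact: flim].
have lhs : (fun k => \int[mu]_(m in skeleton Omega nu) (f k m)%:E) @ \oo -->
    \int[mu]_(m in skeleton Omega nu) (\1_(U `&` G) m)%:E.
  rewrite (_ : \int[mu]_(m in skeleton Omega nu) (\1_(U `&` G) m)%:E =
     \int[mu]_(m in skeleton Omega nu) limn (fun k => (f k m)%:E)); last first.
    by apply: eq_integral => x _; exact: limE.
  apply: cvg_monotone_convergence => //.
  - by move=> k; apply/measurable_EFinP; exact: measurable_funTS.
  - by move=> k x _; rewrite lee_fin.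
  - by move=> x _ a b ab; rewrite lee_fin; exact: fnd.
have rhs : (fun k => \int[lam]_(x in Omega) (wt Omega nu x * f k (midp Omega nu x))%R%:E) @ \oo -->
    \int[lam]_(x in Omega) (wt Omega nu x * \1_(U `&` G) (midp Omega nu x))%R%:E.
  rewrite (_ : \int[lam]_(x in Omega) (wt Omega nu x * \1_(U `&` G) (midp Omega nu x))%R%:E =
     \int[lam]_(x in Omega) limn (fun k => (wt Omega nu x * f k (midp Omega nu x))%R%:E)); last first.
    apply: eq_integral => x _; apply/esym/cvg_lim => //.
    apply: cvg_EFin; first exact: nearW.
    by apply: cvgM; [exact: cvg_cst|exact: flim].
  apply: cvg_monotone_convergence => //.
  - move=> k; apply/measurable_EFinP/measurable_funTS; apply: measurable_funM => //.
    exact: measurableT_comp.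
  - by move=> k x _; rewrite lee_fin mulr_ge0// wt_ge0.
  - by move=> x _ a b ab; rewrite lee_fin ler_wpM2l ?wt_ge0//; exact: fnd.
have -> : mu (U `&` skelG) = \int[mu]_(m in skeleton Omega nu) (\1_(U `&` G) m)%:E.
  rewrite integral_indic//; last exact: measurable_openrV.
  by rewrite /skelG setIA setIAC.
rewrite -(cvg_lim (@ereal_hausdorff R) lhs) -(cvg_lim (@ereal_hausdorff R) rhs).
by congr (limn _); apply/funext => k; exact: E.
Qed.

(** The skeletal measure restricted to [G], and the image by [midp] of the measure of density [w],
    are finite and agree on open sets by [mu_open], so they agree on Borel sets. Integrating [h]
    against both gives the formula. *)
Lemma skeletal_integral (h : 'rV[R]_n.+1 -> R) : measurable_fun setT h ->
  (forall x, (0 <= h x)%R) -> (forall x, ~ G x -> h x = 0%R) ->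
  \int[mu]_(m in skeleton Omega nu) (h m)%:E =
  \int[lam]_(x in Omega) (wt Omega nu x * h (midp Omega nu x))%R%:E.
Proof.
move=> mh h0 hG.
have [D DE] := ex_density lam mw w0.
pose m1 := mrestr mu mskelG.
have mpush : measurable_fun [set: 'rV[R]_n.+1] (midp Omega nu) by [].
have [m2 m2E] : exists m2 : {measure set 'rV[R]_n.+1 -> \bar R},
    forall A, m2 A = D (midp Omega nu @^-1` A).
  pose F : {mfun _ >-> _} := HB.pack_for {mfun 'rV[R]_n.+1 >-> 'rV[R]_n.+1}
    (midp Omega nu) (isMeasurableFun.Build _ _ _ _ _ mpush).
  by exists (pushforward D F).
have DG (U : set 'rV[R]_n.+1) : measurable U -> m2 U = \int[lam]_(x in midp Omega nu @^-1` (U `&` G)) (w x)%:E.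
  move=> mU; rewrite m2E DE; last exact: preimage_measurable.
  rewrite integral_mkcond [RHS]integral_mkcond; apply: eq_integral => x _.
  rewrite !patchE; case: ifPn => [/set_mem Ux|Ux].
    case: ifPn => // GNx; congr EFin; rewrite /w [\1_G _]indicE memNset ?mulr0// => Gx.
    by move/negP: GNx; apply; rewrite inE.
  by case: ifPn => // /set_mem[Ux' _]; move/negP: Ux; rewrite inE.
have m12 : forall A, measurable A -> m1 A = m2 A.
  apply: finite_measure_rV_unique => [U oU|].
    rewrite -[LHS]/(mu (U `&` skelG)) mu_open// DG//; exact: measurable_openrV.
  (* Finiteness is the Radon property on the compact [closure G]. *)
  rewrite -[ltLHS]/(mu (setT `&` skelG)) setTI; apply: (le_lt_trans _ (mu_skel.1 _ cG GO)).
  apply: le_measure; rewrite ?inE//.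
    by apply: measurableI => //; apply: measurable_closedrV; exact: closed_closure.
  by move=> x [sx Gx]; split => //; exact: subset_closure.
have hE0 x : 0 <= (h x)%:E by rewrite lee_fin.
have mhE : measurable_fun setT (fun x => (h x)%:E) by exact/measurable_EFinP.
transitivity (\int[mu]_(m in skelG) (h m)%:E).
  rewrite integral_mkcond [RHS]integral_mkcond; apply: eq_integral => x _.
  rewrite !patchE; case: ifPn => [/set_mem sx|sx].
    by case: ifPn => // GNx; rewrite hG// => Gx; move/negP: GNx; apply; rewrite inE.
  by case: ifPn => // /set_mem[sx' _]; move/negP: sx; rewrite inE.
transitivity (\int[m1]_(m in skelG) (h m)%:E).
  by apply: eq_measure_integral => A mA AG; rewrite -[RHS]/(mu (A `&` skelG)) (setIidl AG).
transitivity (\int[m1]_m (h m)%:E).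
  rewrite integral_mkcond; apply: (@integral_off_null _ _ _ m1 setT (~` skelG)) => //.
  - exact: measurableC.
  - by rewrite -[LHS]/(mu (~` skelG `&` skelG)) setICl measure0.
  - by move=> x _ /contrapT sx; rewrite patchE mem_set.
transitivity (\int[m2]_m (h m)%:E).
  by apply: eq_measure_integral => A mA _; exact: m12.
rewrite (ge0_integral_image (m1 := D) (phi := midp Omega nu))//.
rewrite (ge0_integral_density mw w0 DE)//; last exact: measurableT_comp mhE mpush.
rewrite [RHS]integral_mkcond; apply: eq_integral => x _.
rewrite patchE /w [\1_Omega _]indicE -EFinM; case: ifPn => xO; last by rewrite !mul0r mulr0.
congr EFin; rewrite mul1r mulrC -mulrA; congr (_ * _)%R.
have [Gx|Gx] := pselect (G (midp Omega nu x)); last by rewrite hG// mulr0.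
by rewrite indicE mem_set// mul1r.
Unshelve. exact: mpush.
Qed.

End skeletal_integral.

(** * Derivatives along lines, and the quotient of [u] by phi(rho) *)

Lemma continuous_sumR (R : realType) (I : Type) (r : seq I) (F : I -> R -> R) :
  (forall i, continuous (F i)) -> continuous (fun s => \sum_(i <- r) F i s)%R.
Proof.
move=> cF s; elim: r => [|i r IH].
  by under eq_fun do rewrite big_nil; exact: cvg_cst.
by under eq_fun do rewrite big_cons; apply: cvgD; [exact: cF|exact: IH].
Qed.

Section directional_derivative.
Context {R : realType} {N : nat}.
Implicit Types (u : 'rV[R]_N -> R) (nu x : 'rV[R]_N).
Local Open Scope ring_scope.

Lemma derive_line u nu x (s : R) :
  'D_1 (fun t : R => u (x + t *: nu)) s = 'D_nu u (x + s *: nu).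
Proof.
rewrite /derive; congr (lim (_ @ 0^')); apply/funext => h.
have h1 : h *: (1 : R) = h by rewrite /GRing.scale /= mulr1.
by rewrite /= h1 scalerDl addrCA.
Qed.

Lemma derivable_line u nu x (s : R) :
  derivable (fun t : R => u (x + t *: nu)) s 1 <-> derivable u (x + s *: nu) nu.
Proof.
rewrite /derivable; suff -> : (fun h : R => h^-1 *: (((fun t : R => u (x + t *: nu)) \o shift s) (h *: 1) -
  u (x + s *: nu))) = (fun h => h^-1 *: ((u \o shift (x + s *: nu)) (h *: nu) - u (x + s *: nu))) by [].
apply/funext => h.
have h1 : h *: (1 : R) = h by rewrite /GRing.scale /= mulr1.
by rewrite /= h1 scalerDl addrCA.
Qed.

Lemma derive_grad u nu x : differentiable u x -> 'D_nu u x = dotp nu (grad u x).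
Proof.
move=> du; rewrite deriveE// {1}(row_sum_delta nu) linear_sum /=.
apply: eq_bigr => i _; rewrite linearZ /= mxE /partial deriveE//.
Qed.

Section test_function.
Variable u : 'rV[R]_N -> R.
Variable Omega : set 'rV[R]_N.
Hypothesis tu : test_function Omega u.

Definition tsupp : set 'rV[R]_N := closure [set x | u x != 0].

Lemma test_differentiable x : differentiable u x.
Proof. by have := tu.1 [::] x. Qed.

Lemma partial_continuous i : continuous (partial i u).
Proof. by move=> x; apply: differentiable_continuous; exact: (tu.1 [:: i] x). Qed.

Lemma test_continuous : continuous u.
Proof. by move=> x; apply: differentiable_continuous; exact: test_differentiable. Qed.

Lemma is_derive_test_line nu x (s : R) :
  is_derive s (1 : R) (fun t : R => u (x + t *: nu)) ('D_nu u (x + s *: nu)).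
Proof.
split; last exact: derive_line.
by apply/derivable_line/diff_derivable; exact: test_differentiable.
Qed.

Lemma derive_off_tsupp nu x : ~ tsupp x -> u x = 0 /\ 'D_nu u x = 0.
Proof.
move=> Kx; split.
  by apply: contrapT => ux; apply: Kx; apply: subset_closure => /=; exact/eqP.
rewrite -(derive_cst (0 : R) nu x); apply: near_eq_derive.
have : nbhs x (~` tsupp).
  apply: open_nbhs_nbhs; split => //; apply: closed_openC; exact: closed_closure.
apply: filterS => y Ky; apply: contrapT => uy; apply: Ky; apply: subset_closure => /=.
exact/eqP.
Qed.

Lemma measurable_derive d (T : measurableType d) (nu x : T -> 'rV[R]_N) :
  measurable_fun setT nu -> measurable_fun setT x ->
  measurable_fun setT (fun t => 'D_(nu t) u (x t)).
Proof.
move=> mnu mx; apply: (eq_measurable_fun (fun t => \sum_i coord_rV i (nu t) * partial i u (x t))) => [t _|].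
  rewrite derive_grad; last exact: test_differentiable.
  by apply: eq_bigr => i _; rewrite mxE.
apply: measurable_sum => i; apply: measurable_funM.
  by apply: measurableT_comp => //; exact: measurable_coord_rV.
apply: measurableT_comp => //; apply: continuous_measurable_rV.
exact: partial_continuous.
Qed.

Lemma continuous_derive_line nu x : continuous (fun s : R => 'D_nu u (x + s *: nu)).
Proof.
rewrite (_ : (fun s => _) = (fun s => \sum_i nu ord0 i * partial i u (x + s *: nu))); last first.
  apply/funext => t; rewrite derive_grad; last exact: test_differentiable.
  by apply: eq_bigr => i _; rewrite mxE.
apply: continuous_sumR => i s; apply: cvgM; first exact: cvg_cst.
have cl : {for s, continuous (fun s : R => x + s *: nu)}.
  by apply: cvgD; [exact: cvg_cst|apply: cvgZr_tmp; exact: cvg_id].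
by apply: continuous_comp; [exact: cl|exact: partial_continuous].
Qed.

End test_function.

Section bessel_derivative.
Variables (p : R) (Rad : \bar R) (V W phi : R -> R).
Hypothesis sol : positive_solution p Rad V W phi.
Variables (Omega : set 'rV[R]_N) (u : 'rV[R]_N -> R).
Hypothesis oO : open Omega.
Hypothesis du : forall x, differentiable u x.
Variables nu x : 'rV[R]_N.
Hypothesis Ox : Omega x.
Local Notation ap := (reach Omega nu x).
Local Notation am := (reach Omega (- nu) x).
Local Notation rho := (rho Omega nu).

Let C := chord Omega nu x.
Let oC : open C. Proof. exact: open_chord. Qed.
Let C0 : C 0. Proof. by rewrite /C /chord /= scale0r addr0. Qed.

Let rho_line s : component C 0 s -> (rho (x + s *: nu) = mine (ap - s%:E) (am + s%:E))%E.
Proof.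
move=> Cs; rewrite rho_reach reach_line reachN_line.
have [lE rE] := component_ends oC C0 Cs.
have := reach_line Omega nu x 0; have := reachN_line Omega nu x 0.
rewrite scale0r addr0 -/C sube0 sub0e => -> ->.
rewrite -/C lE rE; congr (Order.min _ _); exact: addeC.
Qed.

(** Where [rho] is affine along the line with slope [sg], this is the quotient rule. *)
Let isd (sg r : R) : interval0 Rad r -> (rho x = r%:E) ->
  (\forall s \near (0 : R), rho (x + s *: nu) = (r + sg * s)%:E) ->
  phi r * 'D_nu (fun z => u z / at_rho 1 phi (rho z)) x =
  'D_nu u x - sg * logder phi r * u x.
Proof.
move=> r0 rhox near_rho.
have [phi0 phi1 _ _] := sol.
have pr := phi0 r r0.
pose g z := u z / at_rho 1 phi (rho z).
have xE : x = x + (0 : R) *: nu by rewrite scale0r addr0.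
have -> : 'D_nu g x = 'D_1 (fun t : R => g (x + t *: nu)) 0 by rewrite derive_line -xE.
have d1 : is_derive (0 : R) (1 : R) (fun t : R => u (x + t *: nu)) ('D_nu u x).
  have := derive_line u nu x 0; rewrite -xE => E; split; last exact: E.
  by apply/derivable_line; rewrite -xE; apply: diff_derivable.
have d2 : is_derive (0 : R) (1 : R) (fun t : R => r + sg * t) sg.
  rewrite (_ : (fun t => _) = cst r + (sg \*: id)); last by apply/funext.
  have := is_deriveD (is_derive_cst r (0:R) (1:R)) (is_deriveZ sg (is_derive_id (0:R) (1:R))).
  by move/is_derive_eq; apply; rewrite add0r /GRing.scale /= mulr1.
have rr : r + sg * 0 = r by rewrite mulr0 addr0.
have d3 : is_derive (r + sg * 0) (1 : R) phi (derive1 phi r).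
  by rewrite rr; have [d _] := phi1 r r0; split => //; rewrite -derive1E.
have d4 := @is_derive1_comp R phi (fun t : R => r + sg * t) 0 _ _ d3 d2.
have n0 : (phi \o (fun t : R => r + sg * t)) 0 != 0 by rewrite /= rr gt_eqF.
have d5 := is_deriveM d1 (is_deriveV n0 d4).
have near_g : \forall t \near (0 : R), ((fun t : R => u (x + t *: nu)) *
    (fun y => (phi (r + sg * y))^-1)) t = g (x + t *: nu).
  by apply: filterS near_rho => t tE; rewrite /g tE.
have [_ ->] := near_eq_is_derive near_g d5.
rewrite /= rr scale0r addr0 /GRing.scale /= /logder.
by field; rewrite gt_eqF.
Qed.

Let near_component (P : R -> Prop) : (\forall s \near (0 : R), P s) ->
  \forall s \near (0 : R), component C 0 s /\ P s.
Proof.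
move=> nP; apply: filterI => //; apply: open_nbhs_nbhs; split.
  exact: open_component.
exact: component_refl.
Qed.

(** The excluded points are the midpoints of bounded segments, where [rho] has a kink. Elsewhere
    [rho] is locally affine, or it is +oo along the line and [phi] is read as 1. *)
Lemma derive_quotient : ap != am \/ ap = +oo%E ->
  (rho x = +oo)%E \/ (rho x < Rad)%E ->
  at_rho 1 phi (rho x) * 'D_nu (fun z => u z / at_rho 1 phi (rho z)) x =
  'D_nu u x - side ap am * at_rho 0 (cutoff Rad (logder phi)) (rho x) * u x.
Proof.
move=> apam rhoR.
have ap0 : (0%:E < ap)%E by exact: reach_gt0.
have am0 : (0%:E < am)%E by exact: reach_gt0.
have rho0 : (0%:E < rho x)%E by rewrite rho_reach lt_min ap0.
have [am_ap|am_ap|E] := ltgtP am ap.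
- have [r rE] : exists r, am = r%:E.
    by exists (fine am); rewrite fineK// ge0_fin_numE ?reach_ge0// (lt_le_trans am_ap) ?leey.
  have rhoE : rho x = r%:E by rewrite rho_reach min_r ?rE// -?rE ltW.
  have r0 : interval0 Rad r.
    move: rhoR rho0; rewrite rhoE => -[//|rR] r0; split => //.
  rewrite /side am_ap rhoE /= cutoffE//.
  apply: (@isd 1 r r0 rhoE).
  (* The strict inequality between the two reaches persists for small s, so the minimum keeps the
     same branch. *)
  have : \forall s \near (0 : R), (r%:E + s%:E < ap - s%:E)%E.
    move: am_ap; rewrite rE; case: ap => [b||] //; last first.
      move=> _; have : nbhs (0 : R) setT by exact: filterT.
      by apply: filterS => s _; rewrite /= -EFinD ltry.
    rewrite lte_fin => rb; have br0 : 0 < (b - r) / 2 by rewrite divr_gt0// subr_gt0.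
    have : nbhs (0 : R) (ball 0 ((b - r) / 2)) by exact: nbhsx_ballx.
    apply: filterS => s; rewrite /ball /= sub0r normrN -EFinD -EFinB lte_fin => sb.
    have := ler_norm s; lra.
  move=> /near_component; apply: filterS => s [/rho_line -> lt].
  by rewrite mul1r rE in lt *; rewrite min_r// ltW.
- have [r rE] : exists r, ap = r%:E.
    by exists (fine ap); rewrite fineK// ge0_fin_numE ?reach_ge0// (lt_le_trans am_ap) ?leey.
  have rhoE : rho x = r%:E by rewrite rho_reach min_l ?rE// -?rE ltW.
  have r0 : interval0 Rad r.
    move: rhoR rho0; rewrite rhoE => -[//|rR] r0; split => //.
  rewrite /side ltNge ltW//= rhoE /= cutoffE//.
  apply: (@isd (-1) r r0 rhoE).
  have : \forall s \near (0 : R), (r%:E - s%:E < am + s%:E)%E.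
    move: am_ap; rewrite rE; case: am => [b||] //; last first.
      move=> _; have : nbhs (0 : R) setT by exact: filterT.
      by apply: filterS => s _; rewrite /= -EFinD ltry.
    rewrite lte_fin => rb; have br0 : 0 < (b - r) / 2 by rewrite divr_gt0// subr_gt0.
    have : nbhs (0 : R) (ball 0 ((b - r) / 2)) by exact: nbhsx_ballx.
    apply: filterS => s; rewrite /ball /= sub0r normrN -EFinB -EFinD lte_fin => sb.
    have := ler_norm (- s); rewrite normrN; lra.
  move=> /near_component; apply: filterS => s [/rho_line -> lt].
  by rewrite mulN1r rE in lt *; rewrite min_l// ltW.
have apE : ap = +oo%E by case: apam => //; rewrite E eqxx.
have rhoE : rho x = +oo%E by rewrite rho_reach E apE minxx.
rewrite rhoE /= mul1r mulr0 mul0r subr0.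
have xE : x = x + (0 : R) *: nu by rewrite scale0r addr0.
rewrite [in LHS]xE [in RHS]xE -!derive_line; apply: near_eq_derive.
have : \forall s \near (0 : R), True by exact: filterT.
move=> /near_component; apply: filterS => s [/rho_line -> _].
by rewrite E apE /= divr1.
Qed.

End bessel_derivative.
End directional_derivative.

(** * Norm comparison, sums of integrals, finiteness of the sphere measure, and Tonelli on
    subsets *)

Lemma norm_le_enorm (R : realType) n (x : 'rV[R]_n) : (`|x| <= enorm x)%R.
Proof.
rewrite -[leLHS]/(mx_norm x); have [->|/mx_norm_neq0[i ->]] := eqVneq (mx_norm x) 0%R.
  exact: sqrtr_ge0.
by rewrite (ord1 i.1) coord_le_enorm.
Qed.

Section real_integrals.
Context d (T : measurableType d) (R : realType) (mu : {measure set T -> \bar R}).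
Variables (D : set T) (f g : T -> R).
Hypotheses (mD : measurable D) (mf : measurable_fun setT f) (mg : measurable_fun setT g).
Hypotheses (f0 : forall x, (0 <= f x)%R) (g0 : forall x, (0 <= g x)%R).

Lemma ge0_integral_EFinD :
  \int[mu]_(x in D) (f x + g x)%:E = \int[mu]_(x in D) (f x)%:E + \int[mu]_(x in D) (g x)%:E.
Proof.
under eq_integral do rewrite EFinD.
by apply: ge0_integralD => //; first [by move=> x _; rewrite lee_fin|
  by apply/measurable_EFinP; exact: measurable_funTS].
Qed.

Lemma ge0_integral_EFinM (k : R) : (0 <= k)%R ->
  \int[mu]_(x in D) (k * g x)%:E = k%:E * \int[mu]_(x in D) (g x)%:E.
Proof.
move=> k0; under eq_integral do rewrite EFinM.
by apply: ge0_integralZl_EFin => //; first [by move=> x _; rewrite lee_fin|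
  by apply/measurable_EFinP; exact: measurable_funTS].
Qed.

End real_integrals.

Section sphere_measure_finite.
Context {R : realType} {n : nat}.

Let sphere_fin : fin_num_fun (@sphere_measure R n).
Proof.
move=> A mA; rewrite ge0_fin_numE ?measure_ge0//.
suff cone_lt : cone_measure A < +oo.
  by rewrite /sphere_measure /mscale /= lte_mul_pinfty// lee_fin inv_ball_ge0.
have mB := @measurable_punctured_ball R n.
apply: (@le_lt_trans _ _ (lebesgue_rV n [set x : 'rV[R]_n | forall i, (-1 <= x ord0 i <= 1)%R])).
  apply: le_measure; rewrite ?inE.
  - apply: measurableI => //; rewrite -[X in measurable X]setTI.
    exact: measurable_to_sphere.
  - exact: measurable_cube.
  - move=> x [] /andP[_ x1] _ i; rewrite -ler_norml.
    exact: le_trans (coord_le_enorm x i) x1.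
by rewrite lebesgue_rV_box ?ltry// lerNl opprK (@le_trans _ _ 0%R) ?lerN10.
Qed.

HB.instance Definition _ := Measure_isFinite.Build _ _ _ (@sphere_measure R n) sphere_fin.

Lemma measurable_usphere : measurable (@usphere R n).
Proof.
rewrite (_ : usphere = @enorm R n @^-1` [set 1%R]) //.
by apply: preimage_measurable => //; exact: measurable_enorm.
Qed.

End sphere_measure_finite.

Section tonelli.
Context d1 d2 (T1 : measurableType d1) (T2 : measurableType d2) (R : realType).
Variables (m1 : {sigma_finite_measure set T1 -> \bar R})
  (m2 : {sigma_finite_measure set T2 -> \bar R}).
Variables (A : set T1) (B : set T2) (f : T1 * T2 -> \bar R).
Hypotheses (mA : measurable A) (mB : measurable B).
Hypotheses (mf : measurable_fun setT f) (f0 : forall z, 0 <= f z).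

Let g := f \_ (A `*` B).
Let mg : measurable_fun setT g.
Proof.
by apply/(measurable_restrictT _ (measurableX mA mB)); exact: measurable_funTS.
Qed.
Let g0 z : 0 <= g z. Proof. by rewrite /g patchE; case: ifP => _; rewrite ?f0. Qed.

Let gE x y : g (x, y) = if x \in A then ((f \o pair x) \_ B) y else 0.
Proof.
by rewrite /g !patchE in_setX /=; case: (x \in A).
Qed.

Let gE' x y : g (x, y) = if y \in B then ((f \o pair^~ y) \_ A) x else 0.
Proof.
by rewrite /g !patchE in_setX /= andbC; case: (y \in B).
Qed.

Let F x : \int[m2]_y g (x, y) = (fun x => \int[m2]_(y in B) f (x, y)) \_ A x.
Proof.
rewrite patchE; case: ifPn => xA; last first.
  by apply: integral0_eq => y _; rewrite gE (negbTE xA).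
by rewrite [RHS]integral_mkcond; apply: eq_integral => y _; rewrite gE xA.
Qed.

Let G y : \int[m1]_x g (x, y) = (fun y => \int[m1]_(x in A) f (x, y)) \_ B y.
Proof.
rewrite patchE; case: ifPn => yB; last first.
  by apply: integral0_eq => x _; rewrite gE' (negbTE yB).
by rewrite [RHS]integral_mkcond; apply: eq_integral => x _; rewrite gE' yB.
Qed.

Lemma tonelli_on : \int[m1]_(x in A) \int[m2]_(y in B) f (x, y) =
  \int[m2]_(y in B) \int[m1]_(x in A) f (x, y).
Proof.
have E := @fubini_tonelli _ _ _ _ _ m1 m2 g mg g0.
rewrite integral_mkcond [RHS]integral_mkcond.
transitivity (\int[m1]_x \int[m2]_y g (x, y)).
  by apply: eq_integral => x _; rewrite F.
by rewrite E; apply: eq_integral => y _; rewrite G.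
Qed.

Lemma measurable_integral_on :
  measurable_fun setT ((fun x => \int[m2]_(y in B) f (x, y)) \_ A).
Proof.
apply: eq_measurable_fun (@measurable_fun_fubini_tonelli_F _ _ _ _ _ m2 g mg g0) => x _.
exact: F.
Qed.

End tonelli.

(** * Segments longer than the essential diameter, and other null sets *)

Section chord_diameter.
Context {R : realType} {N : nat}.
Variable Omega : set 'rV[R]_N.
Hypothesis oO : open Omega.
Variables nu z : 'rV[R]_N.
Local Notation C := (chord Omega nu z).

(** The two reaches add up to the distance between the ends of the component. These ends are not in
    the component and are approached from inside it, by explicit interior points whose distance
    would exceed the supremum. *)
Lemma chord_diam_ge s : C s ->
  reach Omega nu (z + s *: nu)%R + reach Omega (- nu)%R (z + s *: nu)%R <= chord_diam Omega z nu.
Proof.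
move=> Cs; have oC : open C by exact: open_chord.
rewrite reach_line reachN_line.
have : seg_length (component C s) <= chord_diam Omega z nu.
  apply: ereal_sup_ubound; right; exists (component C s) => //; exists s => //.
  exact: connected_componentE.
case: (chord_diam Omega z nu) => [D||]; last 2 first.
- by move=> _; rewrite leey.
- move=> H; have : (s - s)%:E <= seg_length (component C s).
    apply: ereal_sup_ubound; exists s; first exact: component_refl.
    by exists s => //; exact: component_refl.
  by move=> /le_trans/(_ H); rewrite leNgt ltNyr.
move=> lenD.
have lenP a b : component C s a -> component C s b -> (b <= a + D)%R.
  move=> Ca Cb; rewrite addrC -lerBlDr -lee_fin; apply: (le_trans _ lenD).
  by apply: ereal_sup_ubound; exists a => //; exists b.
have /andP[ls sr] := component_refl oC Cs.
have rendP a : component C s a -> rend C s <= (a + D)%:E.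
  move=> Ca; rewrite leNgt; apply/negP => aD.
  have [b []] : exists b : R, (a + D < b)%R /\ component C s b.
    move: aD sr ls; rewrite /component /=; case: (rend C s) => [r||] //=.
      rewrite !lte_fin => aD sr ls.
      pose m := Num.max s (a + D)%R.
      have mr : (m < r)%R by rewrite gt_max sr aD.
      have [sm am] : (s <= m)%R /\ (a + D <= m)%R by rewrite !le_max !lexx orbT.
      exists ((m + r) / 2)%R; rewrite (lt_le_trans ls) ?lee_fin ?lte_fin; [split => //=; lra|lra].
    move=> _ _ ls; exists (Num.max s (a + D) + 1)%R; rewrite ltry andbT; split.
      by rewrite (@le_lt_trans _ _ (Num.max s (a + D))%R) ?ltrDl// le_max lexx orbT.
    by rewrite (lt_le_trans ls)// lee_fin (@le_trans _ _ (Num.max s (a + D))%R) ?lerDl// le_max lexx.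
  by move=> aDb /(lenP _ _ Ca); rewrite leNgt aDb.
have [r rE] : exists r, rend C s = r%:E.
  by move: (rendP s (component_refl oC Cs)) sr; case: (rend C s) => [r||] //; exists r.
have lP : (r - D)%:E <= lend C s.
  rewrite leNgt; apply/negP => lD.
  have [a []] : exists a : R, (a < r - D)%R /\ component C s a.
    move: lD ls; rewrite /component /=; case: (lend C s) => [l||] //=.
      rewrite !lte_fin => lD ls.
      pose m := Num.min s (r - D)%R.
      have mr : (l < m)%R by rewrite lt_min ls lD.
      have [sm am] : (m <= s)%R /\ (m <= r - D)%R by rewrite !ge_min !lexx orbT.
      exists ((m + l) / 2)%R; rewrite (le_lt_trans _ sr) ?lee_fin ?lte_fin ?andbT; [split => //=; lra|lra].
    move=> _ _; exists (Num.min s (r - D) - 1)%R; rewrite ltNyr /=; split.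
      by rewrite (@lt_le_trans _ _ (Num.min s (r - D))%R) ?ltrBlDr ?ltrDl// ge_min lexx orbT.
    rewrite (le_lt_trans _ sr)// lee_fin (@le_trans _ _ (Num.min s (r - D))%R) ?lerBlDr ?lerDl//.
    by rewrite ge_min lexx.
  move=> arD /rendP; rewrite rE lee_fin; lra.
move: lP ls; rewrite rE; case: (lend C s) => [l||] //.
by rewrite -!EFinB -EFinD !lee_fin => lP _; lra.
Qed.

End chord_diameter.

Section bad_points.
Context {R : realType} {n : nat}.
Variable Omega : set 'rV[R]_n.+1.
Hypothesis oO : open Omega.
Implicit Types nu x z : 'rV[R]_n.+1.
Local Notation lam := (lebesgue_rV n.+1).
Local Notation leb := (@lebesgue_measure R).

(** Away from such points, half the segment through [x] is below the radius of the pair, or that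
    radius is infinite. The factor 1/2 matches the assumption on the radius. *)
Definition bad nu x : Prop := 2^-1%:E * ess_diam Omega <
  2^-1%:E * (reach Omega nu x + reach Omega (- nu)%R x).

Lemma ae_not_bad : {ae sphere_measure, forall nu, usphere nu ->
  {ae lebesgue_rV n, forall y, forall s, chord Omega nu (y *m frame nu)%R s ->
     ~ bad nu (y *m frame nu + s *: nu)%R}}.
Proof.
have := @ess_sup_ge _ _ _ sphere_measure (fun nu : 'rV[R]_n.+1 =>
    ess_sup (lebesgue_rV n.+1.-1) (fun y : 'rV[R]_n.+1.-1 => chord_diam Omega (y *m frame nu)%R nu)).
apply: filterS => nu Dnu _.
have := @ess_sup_ge _ _ _ (lebesgue_rV n.+1.-1) (fun y : 'rV[R]_n.+1.-1 => chord_diam Omega (y *m frame nu)%R nu).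
apply: filterS => y Dy s Cs; rewrite /bad; apply/negP; rewrite -leNgt.
rewrite lee_wpmul2l// ?lee_fin ?invr_ge0//.
exact: le_trans (chord_diam_ge oO Cs) (le_trans Dy Dnu).
Qed.

Section measurable_bad.
Context d (T : measurableType d).
Variables nu x : T -> 'rV[R]_n.+1.
Hypothesis mnu : measurable_fun setT nu.
Hypothesis mx : measurable_fun setT x.

Lemma measurable_bad : measurable [set t | bad (nu t) (x t)].
Proof.
rewrite -[X in measurable X]setTI.
apply: measurable_lte => //.
apply: measurable_funeM; apply: emeasurable_funD; first exact: measurable_reach2.
exact: measurable_reachN2.
Qed.

End measurable_bad.

Lemma null_by_lines nu (B : set 'rV[R]_n.+1) : usphere nu -> measurable B ->
  {ae lebesgue_rV n, forall y, leb [set s | B (y *m frame nu + s *: nu)%R] = 0} -> lam B = 0.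
Proof.
move=> nu1 mB Bline; rewrite -[B]setIT -integral_indic//.
rewrite (ge0_integral_line nu1)//; last by apply/measurable_EFinP; exact: measurable_indic.
transitivity (\int[lebesgue_rV n]_(y in setT) (0 : \bar R)); last exact: integral0.
apply: eq_integral_ae => //.
apply: filterS Bline => y By _.
pose E := [set s : measurableTypeR R | B (y *m frame nu + s *: nu)%R].
have mE : measurable E.
  exact: (preimage_measurable (measurable_line (y *m frame nu)%R nu) mB).
by rewrite -[RHS]By -[X in leb X]setIT -[RHS]integral_indic.
Qed.

Lemma ae_null_bad : {ae sphere_measure, forall nu, usphere nu -> lam (Omega `&` bad nu) = 0}.
Proof.
apply: filterS ae_not_bad => nu H nu1.
apply: (null_by_lines nu1).
  apply: measurableI; first exact: measurable_openrV.
  by apply: (measurable_bad (nu := fun=> nu)).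
apply: filterS (H nu1) => y Hy.
rewrite [X in leb X](_ : _ = set0) ?measure0//.
by apply/seteqP; split => // s [Os]; exact: Hy.
Qed.

(** Tonelli turns almost every [nu], almost every x into almost every x, almost every [nu]. This
    second form is the one needed for the spherical means, which integrate over [nu] at fixed x. *)
Lemma ae_null_bad_sphere :
  {ae lam, forall x, Omega x -> sphere_measure (usphere `&` [set nu | bad nu x]) = 0}.
Proof.
pose E : set ('rV[R]_n.+1 * 'rV[R]_n.+1) :=
  (usphere `*` Omega) `&` [set z | bad z.1 z.2].
have mE : measurable E.
  apply: measurableI; last exact: measurable_bad.
  by apply: measurableX; [exact: measurable_usphere|exact: measurable_openrV].
have := section_fubini (@sphere_measure R n.+1) lam mE.
have -> : \int[sphere_measure]_nu lam [set x | E (nu, x)] = 0.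
  transitivity (\int[@sphere_measure R n.+1]_(nu in setT) (0 : \bar R)); last exact: integral0.
  apply: eq_integral_ae => //.
  apply: filterS ae_null_bad => nu H _.
  have [nu1|nu1] := pselect (usphere nu).
    rewrite -[RHS]H//; congr (lam _).
    by apply/seteqP; split => x [] => [[_ Ox] bx|Ox bx]; split => //; split.
  by rewrite [X in lam X](_ : _ = set0) ?measure0//; apply/seteqP; split => // x [[]].
move=> /esym E0.
have mS : measurable_fun setT (fun x => sphere_measure [set nu | E (nu, x)]).
  apply: eq_measurable_fun (measurable_fun_ysection (@sphere_measure R n.+1) mE) => x _.
  by congr (sphere_measure _); apply/seteqP; split => nu; rewrite /ysection /= inE.
have := (ae_eq_integral_abs lam measurableT mS).1.
under eq_integral do rewrite gee0_abs ?measure_ge0//.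
move=> /(_ E0); apply: filterS => x /(_ I) /= H Ox.
rewrite -[RHS]H; congr (sphere_measure _).
by apply/seteqP; split => nu [] => [nu1 b|[nu1 _] b]; split => //; split.
Qed.

(** These points are midpoints of bounded segments. A line carries countably many segments, hence a
    Lebesgue null set of midpoints. *)
Lemma null_midpoints nu : usphere nu ->
  lam (Omega `&` [set x | reach Omega nu x = reach Omega (- nu)%R x /\ reach Omega nu x < +oo]) = 0.
Proof.
move=> nu1; have mcst : measurable_fun [set: 'rV[R]_n.+1] (fun=> nu) by exact: measurable_cst.
have mO := measurable_openrV oO.
have mr := measurable_reach2 oO mcst (@measurable_id _ _ setT).
have mrN := measurable_reachN2 oO mcst (@measurable_id _ _ setT).
apply: (null_by_lines nu1).
  apply: measurableI => //; apply: measurableI.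
    rewrite -[X in measurable X]setTI.
    exact: measurable_eqe.
  rewrite -[X in measurable X]setTI.
  exact: measurable_lte.
apply: aeW => y; set z := (y *m frame nu)%R; pose C := chord Omega nu z.
have oC : open C by exact: open_chord.
pose mid s := ((fine (lend C s) + fine (rend C s)) / 2)%R.
apply: countable_lebesgue_measure0.
apply: (@sub_countable _ _ _ ((fun q : rat => mid (ratr q)) @` setT)); last first.
  by apply: (card_le_trans (card_image_le _ _)); exact: countableP.
apply: subset_card_le => s [/= Cs [/esym]]; rewrite reach_line reachN_line -/C => E fin.
have [q qs] := component_rat oC Cs; exists q => //.
have [lE rE] := component_ends oC Cs qs; rewrite /mid lE rE.
move: E fin (lend_lt oC Cs) (rend_gt oC Cs).
case: (lend C s) => [l||] //; case: (rend C s) => [r||] //=.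
by rewrite -!EFinB => -[E] _ _ _; lra.
Qed.

End bad_points.

(** * Comparison of integrals line by line, and Euclidean geometry of directions *)

Section integral_chord_le.
Context {R : realType} {n : nat}.
Variable Omega : set 'rV[R]_n.+1.
Hypothesis oO : open Omega.
Variable nu : 'rV[R]_n.+1.
Hypothesis nu1 : usphere nu.
Local Notation lam := (lebesgue_rV n.+1).
Local Notation leb := (@lebesgue_measure R).

Let measurable_integral_chord (f : 'rV[R]_n.+1 -> \bar R) :
  measurable_fun setT f -> (forall x, 0 <= f x) ->
  measurable_fun setT (fun y : 'rV[R]_n =>
    \int[leb]_(s in chord Omega nu (y *m frame nu)%R) f (y *m frame nu + s *: nu)%R).
Proof.
move=> mf f0; have mfO : measurable_fun setT (f \_ Omega).
  by apply/(measurable_restrictT _ (measurable_openrV oO)); exact: measurable_funTS.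
have fO0 x : 0 <= (f \_ Omega) x by rewrite patchE; case: ifP => _; rewrite ?f0.
apply: eq_measurable_fun (measurable_line_integral nu mfO fO0) => y _.
rewrite [RHS]integral_mkcond; apply: eq_integral => s _; rewrite !patchE.
case: (boolP (_ \in Omega)) => [/set_mem|/negP] H.
  by rewrite mem_set.
by case: ifPn => // /set_mem H'; exfalso; apply: H; rewrite inE.
Qed.

Lemma le_integral_chord (f g : 'rV[R]_n.+1 -> \bar R) :
  measurable_fun setT f -> (forall x, 0 <= f x) ->
  measurable_fun setT g -> (forall x, 0 <= g x) ->
  {ae lebesgue_rV n, forall y,
    \int[leb]_(s in chord Omega nu (y *m frame nu)%R) f (y *m frame nu + s *: nu)%R <=
    \int[leb]_(s in chord Omega nu (y *m frame nu)%R) g (y *m frame nu + s *: nu)%R} ->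
  \int[lam]_(x in Omega) f x <= \int[lam]_(x in Omega) g x.
Proof.
move=> mf f0 mg g0 fg; rewrite !(ge0_integral_chord oO nu1)//.
apply: ae_ge0_le_integral => //.
- by move=> y _; exact: integral_ge0.
- exact: measurable_integral_chord.
- by move=> y _; exact: integral_ge0.
- exact: measurable_integral_chord.
by apply: filterS fg => y.
Qed.

End integral_chord_le.

Section dot_product.
Context {R : realType} {n : nat}.
Implicit Types x y nu : 'rV[R]_n.

Lemma dotp_sub x y : dotp (x - y)%R (x - y)%R = (dotp x x - 2 * dotp y x + dotp y y)%R.
Proof.
rewrite /dotp mulr_sumr -sumrB -big_split /=; apply: eq_bigr => i _.
by rewrite !mxE; ring.
Qed.

Lemma dotpZl (c : R) x y : dotp (c *: x)%R y = (c * dotp x y)%R.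
Proof. by rewrite /dotp mulr_sumr; apply: eq_bigr => i _; rewrite !mxE mulrA. Qed.

Lemma dotpC x y : dotp x y = dotp y x.
Proof. by apply: eq_bigr => i _; rewrite mulrC. Qed.

Lemma dotpxx_ge0 x : (0 <= dotp x x)%R.
Proof. by apply: sumr_ge0 => i _; rewrite -expr2 sqr_ge0. Qed.

(** Cauchy-Schwarz, from the nonnegativity of the squared norm of x - (nu . x) nu. *)
Lemma usphere_dotp_le nu x : usphere nu -> (`|dotp nu x| <= enorm x)%R.
Proof.
move=> nu1; rewrite -sqrtr_sqr ler_wsqrtr//.
have := dotpxx_ge0 (x - dotp nu x *: nu)%R.
rewrite dotp_sub !dotpZl (dotpC nu (_ *: _)) dotpZl (usphere_dotp nu1) mulr1.
set t := dotp nu x => H; rewrite -subr_ge0; apply: le_trans H _.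
by rewrite [leLHS](_ : _ = dotp x x - t ^+ 2)%R//; ring.
Qed.

Lemma enorm_eq0 x : enorm x = 0%R -> x = 0%R.
Proof.
by move=> x0; apply/eqP; rewrite -normr_le0 -x0 norm_le_enorm.
Qed.

Lemma enormZ (c : R) x : enorm (c *: x)%R = (`|c| * enorm x)%R.
Proof.
by rewrite /enorm dotpZl dotpC dotpZl mulrA -expr2 sqrtrM ?sqr_ge0// sqrtr_sqr.
Qed.

Lemma cosangZr nu (c : R) x : (0 < c)%R -> cosang nu (c *: x)%R = cosang nu x.
Proof.
move=> c0; rewrite /cosang dotpC dotpZl (dotpC x) enormZ gtr0_norm// mulrCA.
by rewrite -mulf_div divff ?mul1r// gt_eqF.
Qed.

Lemma measurable_dotp d (T : measurableType d) (x y : T -> 'rV[R]_n) :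
  measurable_fun setT x -> measurable_fun setT y ->
  measurable_fun setT (fun t => dotp (x t) (y t)).
Proof.
move=> mx my; apply: measurable_sum => i; apply: measurable_funM.
  exact: (measurableT_comp (measurable_coord_rV i) mx).
exact: (measurableT_comp (measurable_coord_rV i) my).
Qed.

Lemma measurable_cosang x : measurable_fun setT (cosang ^~ x).
Proof.
apply: measurable_funM; first by apply: measurable_dotp => //; exact: measurable_cst.
apply: (measurableT_comp (@measurable_invr R)); apply: measurable_funM => //.
exact: measurable_enorm.
Qed.

End dot_product.

Lemma coord_le_norm (R : realType) n (x : 'rV[R]_n) i : (`|x ord0 i| <= `|x|)%R.
Proof.
rewrite -[leRHS]/(mx_norm x) mx_normrE.
exact: (le_bigmax _ (fun ij : 'I_1 * 'I_n => `|x ij.1 ij.2|)%R (ord0, i)).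
Qed.

Lemma rho_midp (R : realType) N (Omega : set 'rV[R]_N) nu x (l : R) : open Omega -> Omega x ->
  reach Omega nu x + reach Omega (- nu)%R x = l%:E ->
  rho Omega nu (midp Omega nu x) = (l / 2)%:E.
Proof.
move=> oO Ox; pose C := chord Omega nu x; have oC : open C by exact: open_chord.
have C0 : C 0%R by rewrite /C /chord /= scale0r addr0.
have := reach_gt0 nu oO Ox; have := reach_gt0 (- nu)%R oO Ox.
have := reach_line Omega nu x 0; have := reachN_line Omega nu x 0.
rewrite scale0r addr0 -/C sube0 sub0e /midp => Eam Eap.
case Ea : (reach Omega nu x) => [a||] //; case Eb : (reach Omega (- nu)%R x) => [b||] //.
rewrite !lte_fin -EFinD => b0 a0 [<-].
rewrite rho_reach reach_line reachN_line -/C /mid_shift /=.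
have [lE rE] : lend C ((a - b) / 2)%R = lend C 0 /\ rend C ((a - b) / 2)%R = rend C 0.
  apply: component_ends => //; rewrite /component /= -Eap Ea -[lend C 0]oppeK -Eam Eb.
  by rewrite -EFinN !lte_fin; apply/andP; split; lra.
rewrite lE rE -Eap Ea -[lend C 0]oppeK -Eam Eb -!EFinN -!EFinD.
have -> : (a - (a - b) / 2 = (a + b) / 2)%R by lra.
have -> : ((a - b) / 2 - - b = (a + b) / 2)%R by lra.
by rewrite minxx.
Qed.

Lemma measurable_cutoff (R : realType) (Rad : \bar R) (f : R -> R) : (forall r, interval0 Rad r -> {for r, continuous f}) ->
  measurable_fun setT (cutoff Rad f).
Proof.
move=> cf; have mI : measurable (interval0 Rad : set (measurableTypeR R)).
  by apply: open_measurable; exact: open_interval0.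
apply: (eq_measurable_fun (f \_ (interval0 Rad : set (measurableTypeR R)))) => [r _|].
  rewrite patchE /cutoff; case: asboolP => H; first by rewrite mem_set.
  by rewrite memNset.
apply/(measurable_restrictT _ mI).
apply: open_continuous_measurable_fun; first exact: open_interval0.
by move=> r /set_mem; exact: cf.
Qed.

(** * From one component to a full line: the integrands and their identity *)

Section bessel_identity.
Context {R : realType} {n : nat}.
Variables (p : R) (Rad : \bar R) (V W phi : R -> R) (Vinf : R).
Hypothesis p1 : (1 < p)%R.
Hypothesis VW0 : forall r, interval0 Rad r -> (0 < V r)%R /\ (0 < W r)%R.
Hypothesis V1 : C1_on Rad V.
Hypothesis W1 : C1_on Rad W.
Hypothesis sol : positive_solution p Rad V W phi.
Hypothesis Vinf0 : (0 <= Vinf)%R.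
Variables (Omega : set 'rV[R]_n.+1) (u : 'rV[R]_n.+1 -> R).
Hypothesis oO : open Omega.
Hypothesis tu : test_function Omega u.
Local Notation lam := (lebesgue_rV n.+1).
Local Notation leb := (@lebesgue_measure R).
Local Notation sg := (@sphere_measure R n.+1).
Local Notation ap nu x := (reach Omega nu x).
Local Notation am nu x := (reach Omega (- nu)%R x).

Let mO : measurable Omega. Proof. exact: measurable_openrV. Qed.
Let mS : measurable (@usphere R n.+1). Proof. exact: measurable_usphere. Qed.
Let mid_ : measurable_fun [set: 'rV[R]_n.+1] id. Proof. exact: measurable_id. Qed.
Let mcst nu : measurable_fun [set: 'rV[R]_n.+1] (fun=> nu : 'rV[R]_n.+1).
Proof. exact: measurable_cst. Qed.
Let mfst : measurable_fun setT (@fst 'rV[R]_n.+1 'rV[R]_n.+1).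
Proof. exact: measurable_fst. Qed.
Let msnd : measurable_fun setT (@snd 'rV[R]_n.+1 'rV[R]_n.+1).
Proof. exact: measurable_snd. Qed.

(** The integrands as functions of direction and point, written with cut-off functions so that they
    are jointly measurable; almost everywhere they agree with those of the theorem. *)
Definition FA nu x : R := iA p Rad V Vinf (ap nu x) (am nu x) ('D_nu u x).
Definition FB nu x : R := iB p Rad W (ap nu x) (am nu x) (u x).
Definition FC nu x : R := iC p Rad V phi Vinf (ap nu x) (am nu x) (u x) ('D_nu u x).
Definition FS nu x : R := skel p Rad V phi (ap nu x) (am nu x) (u (midp Omega nu x)).
Definition FP nu x : R := Num.max (FS nu x) 0%R.
Definition FM nu x : R := Num.max (- FS nu x)%R 0%R.

Lemma FA_ge0 nu x : (0 <= FA nu x)%R. Proof. exact: (iA_ge0 _ VW0 Vinf0). Qed.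
Lemma FB_ge0 nu x : (0 <= FB nu x)%R. Proof. exact: (iB_ge0 _ VW0). Qed.
Lemma FC_ge0 nu x : (0 <= FC nu x)%R. Proof. exact: (iC_ge0 _ p1 VW0 Vinf0). Qed.
Lemma FP_ge0 nu x : (0 <= FP nu x)%R. Proof. by rewrite le_max lexx orbT. Qed.
Lemma FM_ge0 nu x : (0 <= FM nu x)%R. Proof. by rewrite le_max lexx orbT. Qed.

Section joint_measurability.
Context d (T : measurableType d).
Variables nu x : T -> 'rV[R]_n.+1.
Hypothesis mnu : measurable_fun setT nu.
Hypothesis mx : measurable_fun setT x.

Let map_ : measurable_fun setT (fun t => ap (nu t) (x t)).
Proof. exact: measurable_reach2. Qed.
Let mam : measurable_fun setT (fun t => am (nu t) (x t)).
Proof. exact: measurable_reachN2. Qed.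
Let mrho : measurable_fun setT (fun t => mine (ap (nu t) (x t)) (am (nu t) (x t))).
Proof. exact: measurable_mine. Qed.
Let mV : measurable_fun setT (fun t => at_rho Vinf (cutoff Rad V) (mine (ap (nu t) (x t)) (am (nu t) (x t)))).
Proof.
by apply: measurable_at_rho => //; apply: measurable_cutoff => r; exact: C1_on_continuous.
Qed.
Let mD : measurable_fun setT (fun t => 'D_(nu t) u (x t)).
Proof. exact (measurable_derive tu mnu mx). Qed.
Let mu_ : measurable_fun setT u.
Proof. by apply: continuous_measurable_rV; exact: (test_continuous tu). Qed.
Let mux : measurable_fun setT (fun t => u (x t)).
Proof. exact: (measurableT_comp mu_ mx). Qed.
Let mpow (f : T -> R) : measurable_fun setT f -> measurable_fun setT (fun t => `|f t| `^ p)%R.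
Proof.
move=> mf; have h : measurable_fun setT (fun r : R => `|r| `^ p)%R.
  by apply: continuous_measurable_fun; exact: continuous_norm_powR.
exact: (measurableT_comp h mf).
Qed.

Lemma measurable_FA : measurable_fun setT (fun t => FA (nu t) (x t)).
Proof. by apply: measurable_funM => //; exact: mpow. Qed.

Lemma measurable_FB : measurable_fun setT (fun t => FB (nu t) (x t)).
Proof.
apply: measurable_funM; last exact: mpow.
by apply: measurable_at_rho => //; apply: measurable_cutoff => r; exact: C1_on_continuous.
Qed.

Lemma measurable_FC : measurable_fun setT (fun t => FC (nu t) (x t)).
Proof.
apply: measurable_funM => //.
pose z t := (side (ap (nu t) (x t)) (am (nu t) (x t)) *
  at_rho 0 (cutoff Rad (logder phi)) (mine (ap (nu t) (x t)) (am (nu t) (x t))) * u (x t))%R.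
have mz : measurable_fun setT z.
  apply: measurable_funM => //; apply: measurable_funM.
    by apply: measurable_fun_ifT => //; exact: measurable_fun_lte.
  apply: measurable_at_rho => //; apply: measurable_cutoff => r.
  exact: (continuous_logder sol).
apply: (eq_measurable_fun (fun t => `|'D_(nu t) u (x t)| `^ p - `|z t| `^ p -
    p * (signed_pow p (z t) * ('D_(nu t) u (x t) - z t)))%R) => [t _|].
  by rewrite Cp_cancel.
apply: measurable_funB; first by apply: measurable_funB; exact: mpow.
apply: measurable_funM => //; apply: measurable_funM; last exact: measurable_funB.
apply: measurableT_comp => //.
by apply: continuous_measurable_fun; exact: continuous_signed_pow.
Qed.

Lemma measurable_FS : measurable_fun setT (fun t => FS (nu t) (x t)).
Proof.
apply: measurable_funM.
  apply: measurable_at_rho; last by apply: emeasurable_funD.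
  apply: measurable_funM; last exact: measurable_invr.
  apply: (measurableT_comp (f := cutoff Rad (flux p V phi))); last exact: measurable_funM.
  by apply: measurable_cutoff => r; exact: (continuous_flux p1 sol).
by apply: mpow; apply: measurableT_comp => //; exact: measurable_midp.
Qed.

Lemma measurable_FP : measurable_fun setT (fun t => FP (nu t) (x t)).
Proof. by apply: measurable_maxr => //; exact: measurable_FS. Qed.

Lemma measurable_FM : measurable_fun setT (fun t => FM (nu t) (x t)).
Proof.
by apply: measurable_maxr => //; apply: measurableT_comp => //; exact: measurable_FS.
Qed.

End joint_measurability.

Definition good_line nu z := forall s, chord Omega nu z s ->
  2^-1%:E * (reach Omega nu (z + s *: nu)%R + reach Omega (- nu)%R (z + s *: nu)%R) < Rad \/ Rad = +oo.

(** The compact support of [u] has a positive distance to the complement of [Omega]. Unit vectors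
    have sup norm at most 1, so one [delta] serves all directions. *)
Lemma reach_tsupp : exists2 delta : R, (0 < delta)%R & forall nu x, (`|nu| <= 1)%R ->
  reach Omega nu x <= delta%:E -> ~ tsupp u x.
Proof.
have [d d0 dO] := compact_ball_sub tu.2.1 oO tu.2.2.
exists (d / 2)%R => [|nu x nu1 rd Kx]; first by rewrite divr_gt0.
suff : (d / 2)%:E < reach Omega nu x by rewrite ltNge rd.
apply/(reach_gtP _ _ oO); first by rewrite divr_ge0// ltW.
move=> s; rewrite /= in_itv /= => /andP[s0 sd]; apply: (dO x Kx).
rewrite -ball_normE /= opprD addrA subrr sub0r normrN normrZ ger0_norm//.
by rewrite (@le_lt_trans _ _ s)// ?ler_piMr// (le_lt_trans sd)// ltr_pdivrMr// ltr_pMr// ltr1n.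
Qed.

Section line_identity.
Variables nu z : 'rV[R]_n.+1.
Hypothesis nu1 : usphere nu.
Hypothesis good : good_line nu z.
Let C := chord Omega nu z.
Let pt (s : R) := (z + s *: nu)%R.
Let mpt : measurable_fun [set: measurableTypeR R] pt.
Proof. exact: measurable_line. Qed.
Let mnu : measurable_fun [set: measurableTypeR R] (fun=> nu).
Proof. exact: measurable_cst. Qed.
Let mA := measurable_FA mnu mpt.
Let mB := measurable_FB mnu mpt.
Let mC := measurable_FC mnu mpt.
Let mP := measurable_FP mnu mpt.
Let mM := measurable_FM mnu mpt.
Let oC : open C. Proof. exact: open_chord. Qed.
Let mcomp s : measurable (component C s : set (measurableTypeR R)).
Proof. exact: measurable_component. Qed.

(** [component_identity] applied to the restriction of [u]: on a component, the two reaches are the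
    distances to its two ends, and [reach_tsupp] makes [u] and its derivative vanish near them. *)
Let component_line s : C s -> let J : set (measurableTypeR R) := component C s in
  [/\ \int[leb]_(t in J) (FA nu (pt t))%:E + 2%:E * \int[leb]_(t in J) (FM nu (pt t))%:E =
      \int[leb]_(t in J) (FB nu (pt t))%:E + \int[leb]_(t in J) (FC nu (pt t))%:E +
        2%:E * \int[leb]_(t in J) (FP nu (pt t))%:E,
    2%:E * \int[leb]_(t in J) (FP nu (pt t))%:E <= \int[leb]_(t in J) (FA nu (pt t))%:E &
    2%:E * \int[leb]_(t in J) (FM nu (pt t))%:E <=
      \int[leb]_(t in J) (FB nu (pt t))%:E + \int[leb]_(t in J) (FC nu (pt t))%:E].
Proof.
move=> Cs J; pose al := lend C s; pose be := rend C s.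
have [delta delta0 reach_d] := reach_tsupp.
have [M ptM] : exists M : R, forall t, tsupp u (pt t) -> (`|t| < M)%R.
  by apply: line_bounded => //; exact: compact_bounded tu.2.1.
have nuN : (`|nu| <= 1)%R by rewrite (le_trans (norm_le_enorm _))// nu1.
have apE (t : R) : J t -> reach Omega nu (pt t) = be - t%:E.
  by move=> Jt; rewrite reach_line -/C; have [_ ->] := component_ends oC Cs Jt.
have amE (t : R) : J t -> reach Omega (- nu)%R (pt t) = t%:E - al.
  by move=> Jt; rewrite reachN_line -/C; have [-> _] := component_ends oC Cs Jt.
pose w t := u (pt t); pose w' t := 'D_nu u (pt t).
have eA (t : R) : J t -> FA nu (pt t) = iA p Rad V Vinf (be - t%:E) (t%:E - al) (w' t).
  by move=> Jt; rewrite /FA apE// amE.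
have eB (t : R) : J t -> FB nu (pt t) = iB p Rad W (be - t%:E) (t%:E - al) (w t).
  by move=> Jt; rewrite /FB apE// amE.
have eC (t : R) : J t -> FC nu (pt t) = iC p Rad V phi Vinf (be - t%:E) (t%:E - al) (w t) (w' t).
  by move=> Jt; rewrite /FC apE// amE.
have eS (t : R) : J t -> FS nu (pt t) =
    skel p Rad V phi (be - t%:E)%E (t%:E - al)%E (w (t + mid_shift (be - t%:E)%E (t%:E - al)%E)%R).
  by move=> Jt; rewrite /FS /midp apE// amE// /w /pt -addrA -scalerDl.
have Rad_gt : 2^-1%:E * (be - al) < Rad \/ Rad = +oo.
  have Js : J s by exact: component_refl.
  case: (good Cs) => [|->]; [|by right]; rewrite apE// amE// => H; left.
  suff <- : be - s%:E + (s%:E - al) = be - al by [].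
  by case: (be) => [b||] //; case: (al) => [a||] //; rewrite -!EFinB -EFinD; congr EFin; ring.
have w_end (t : R) : J t -> t%:E - al <= delta%:E \/ be - t%:E <= delta%:E ->
    w t = 0%R /\ w' t = 0%R.
  move=> Jt [] H; apply: derive_off_tsupp.
    by apply: (reach_d (- nu)%R); rewrite ?normrN// amE.
  by apply: (reach_d nu) => //; rewrite apE.
have w_far (t : R) : J t -> (M <= `|t|)%R -> w t = 0%R /\ w' t = 0%R.
  move=> Jt Mt; apply: derive_off_tsupp => /ptM; by rewrite ltNge Mt.
have [] := @component_identity R p Rad V W phi Vinf p1 VW0 V1 W1 sol Vinf0 w w' delta M
  (is_derive_test_line tu nu z) (continuous_derive_line tu (nu := nu) (x := z)) delta0 al be Rad_gt w_end w_far.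
- apply: (eq_measurable_fun (fun t => (FA nu (pt t))%:E)) => [t /set_mem Jt|]; first by rewrite eA.
  by apply/measurable_EFinP; exact: measurable_funTS.
- apply: (eq_measurable_fun (fun t => (FB nu (pt t))%:E)) => [t /set_mem Jt|]; first by rewrite eB.
  by apply/measurable_EFinP; exact: measurable_funTS.
- apply: (eq_measurable_fun (fun t => (FC nu (pt t))%:E)) => [t /set_mem Jt|]; first by rewrite eC.
  by apply/measurable_EFinP; exact: measurable_funTS.
- by exists s; exact: component_refl.
have intE (f g : R -> R) : (forall t, J t -> f t = g t) ->
    \int[leb]_(t in J) (f t)%:E = \int[leb]_(t in [set t | al < t%:E < be]) (g t)%:E.
  by move=> fg; apply: eq_integral => t /set_mem Jt; rewrite fg.
rewrite (intE _ _ eA) (intE _ _ eB) (intE _ _ eC).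
rewrite (intE (fun t => FP nu (pt t)) _ (fun t Jt => congr1 (fun r => Num.max r 0%R) (eS t Jt))).
by rewrite (intE (fun t => FM nu (pt t)) _ (fun t Jt => congr1 (fun r => Num.max (- r)%R 0%R) (eS t Jt))).
Qed.

Lemma line_identity :
  [/\ \int[leb]_(s in C) (FA nu (pt s) + 2 * FM nu (pt s))%:E =
      \int[leb]_(s in C) (FB nu (pt s) + FC nu (pt s) + 2 * FP nu (pt s))%:E,
    \int[leb]_(s in C) (2 * FP nu (pt s))%:E <= \int[leb]_(s in C) (FA nu (pt s))%:E &
    \int[leb]_(s in C) (2 * FM nu (pt s))%:E <=
      \int[leb]_(s in C) (FB nu (pt s) + FC nu (pt s))%:E].
Proof.
have A0 t : (0 <= FA nu (pt t))%R by exact: FA_ge0.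
have B0 t : (0 <= FB nu (pt t))%R by exact: FB_ge0.
have C0 t : (0 <= FC nu (pt t))%R by exact: FC_ge0.
have P0 t : (0 <= FP nu (pt t))%R by exact: FP_ge0.
have M0 t : (0 <= FM nu (pt t))%R by exact: FM_ge0.
have mBC := measurable_funD mB mC.
have m2P := measurable_funM (measurable_cst (2%R : R)) mP.
have m2M := measurable_funM (measurable_cst (2%R : R)) mM.
have P20 t : (0 <= 2 * FP nu (pt t))%R by rewrite mulr_ge0.
have M20 t : (0 <= 2 * FM nu (pt t))%R by rewrite mulr_ge0.
have BC0 t : (0 <= FB nu (pt t) + FC nu (pt t))%R by rewrite addr_ge0.
split.
- apply: (eq_integral_comp oC).
  + by apply/measurable_EFinP; exact: measurable_funD.
  + by apply/measurable_EFinP; exact: measurable_funD.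
  + by move=> t; rewrite lee_fin addr_ge0.
  + by move=> t; rewrite lee_fin addr_ge0.
  move=> s Cs; have [E _ _] := component_line Cs.
  by rewrite !ge0_integral_EFinD// !ge0_integral_EFinM.
- apply: (le_integral_comp oC).
  + exact/measurable_EFinP.
  + exact/measurable_EFinP.
  + by move=> t; rewrite lee_fin.
  + by move=> t; rewrite lee_fin.
  by move=> s Cs; have [_ E _] := component_line Cs; rewrite !ge0_integral_EFinM.
- apply: (le_integral_comp oC).
  + exact/measurable_EFinP.
  + exact/measurable_EFinP.
  + by move=> t; rewrite lee_fin.
  + by move=> t; rewrite lee_fin.
  by move=> s Cs; have [_ _ E] := component_line Cs; rewrite !ge0_integral_EFinM// ge0_integral_EFinD.
Qed.

End line_identity.

(** * From lines to the domain, and the spherical means *)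

Section gap.
Hypothesis gap : 2^-1%:E * ess_diam Omega < Rad \/ (ess_diam Omega = +oo /\ Rad = +oo).

Local Notation I_ F nu := (\int[lam]_(x in Omega) (F nu x)%:E).

Lemma not_bad_gap nu x : ~ bad Omega nu x ->
  2^-1%:E * (reach Omega nu x + reach Omega (- nu)%R x) < Rad \/ Rad = +oo.
Proof.
move=> /negP; rewrite -leNgt => le; case: gap => [lt|[]]; [left|by right].
exact: le_lt_trans lt.
Qed.

(** The minimum of the two reaches is at most their mean, which is half the length of the
    segment. *)
Lemma not_bad_rho nu x : ~ bad Omega nu x -> rho Omega nu x = +oo \/ rho Omega nu x < Rad.
Proof.
move=> /not_bad_gap [lt|->]; last first.
  by case: (ltP (rho Omega nu x) +oo) => [|]; [right|rewrite leye_eq => /eqP; left].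
right; apply: le_lt_trans lt; rewrite rho_reach.
have [] := (reach_ge0 Omega nu x, reach_ge0 Omega (- nu)%R x).
case: (reach Omega nu x) => [a||] //; case: (reach Omega (- nu)%R x) => [b||] //=.
- rewrite !lee_fin -EFin_min -EFinD -EFinM lee_fin => a0 b0.
  rewrite [leRHS](_ : _ = ((a + b) / 2)%R); last by rewrite mulrC.
  by rewrite ge_min; apply/orP; case: (leP a b) => h; [left|right]; lra.
- by move=> _ _; rewrite addey// mulry gtr0_sg ?invr_gt0// mul1e leey.
- by move=> _ _; rewrite addye// mulry gtr0_sg ?invr_gt0// mul1e leey.
- by move=> _ _; rewrite addye// mulry gtr0_sg ?invr_gt0// mul1e leey.
Qed.

(** For almost every [nu], almost all lines of that direction contain no bad point, and
    [line_identity] holds on them. The equality is obtained as two inequalities between integrals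
    over lines. *)
Lemma domain_identity : {ae sphere_measure, forall nu, usphere nu ->
  [/\ I_ FA nu + 2%:E * I_ FM nu = I_ FB nu + I_ FC nu + 2%:E * I_ FP nu,
      2%:E * I_ FP nu <= I_ FA nu & 2%:E * I_ FM nu <= I_ FB nu + I_ FC nu]}.
Proof.
apply: filterS (ae_not_bad oO) => nu good nu1.
have mA := measurable_FA (mcst nu) mid_.
have mB := measurable_FB (mcst nu) mid_.
have mC := measurable_FC (mcst nu) mid_.
have mP := measurable_FP (mcst nu) mid_.
have mM := measurable_FM (mcst nu) mid_.
have A0 x : (0 <= FA nu x)%R by exact: FA_ge0.
have B0 x : (0 <= FB nu x)%R by exact: FB_ge0.
have C0 x : (0 <= FC nu x)%R by exact: FC_ge0.
have P0 x : (0 <= FP nu x)%R by exact: FP_ge0.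
have M0 x : (0 <= FM nu x)%R by exact: FM_ge0.
have mBC := measurable_funD mB mC.
have m2P := measurable_funM (measurable_cst (2%R : R)) mP.
have m2M := measurable_funM (measurable_cst (2%R : R)) mM.
have P20 x : (0 <= 2 * FP nu x)%R by rewrite mulr_ge0.
have M20 x : (0 <= 2 * FM nu x)%R by rewrite mulr_ge0.
have BC0 x : (0 <= FB nu x + FC nu x)%R by rewrite addr_ge0.
have line := line_identity nu1.
have goodl : {ae lebesgue_rV n, forall y, good_line nu (y *m frame nu)%R}.
  by apply: filterS (good nu1) => y H s Cs; apply: not_bad_gap; exact: H.
have E : \int[lam]_(x in Omega) (FA nu x + 2 * FM nu x)%:E =
    \int[lam]_(x in Omega) (FB nu x + FC nu x + 2 * FP nu x)%:E.
  apply/eqP; rewrite eq_le; apply/andP; split; apply: (le_integral_chord oO nu1).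
  - by apply/measurable_EFinP; exact: measurable_funD.
  - by move=> x; rewrite lee_fin addr_ge0.
  - by apply/measurable_EFinP; exact: measurable_funD.
  - by move=> x; rewrite lee_fin addr_ge0.
  - by apply: filterS goodl => y /line[-> _ _].
  - by apply/measurable_EFinP; exact: measurable_funD.
  - by move=> x; rewrite lee_fin addr_ge0.
  - by apply/measurable_EFinP; exact: measurable_funD.
  - by move=> x; rewrite lee_fin addr_ge0.
  - by apply: filterS goodl => y /line[-> _ _].
have EP : \int[lam]_(x in Omega) (2 * FP nu x)%:E <= \int[lam]_(x in Omega) (FA nu x)%:E.
  apply: (le_integral_chord oO nu1).
  - exact/measurable_EFinP.
  - by move=> x; rewrite lee_fin.
  - exact/measurable_EFinP.
  - by move=> x; rewrite lee_fin.
  - by apply: filterS goodl => y /line[].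
have EM : \int[lam]_(x in Omega) (2 * FM nu x)%:E <=
    \int[lam]_(x in Omega) (FB nu x + FC nu x)%:E.
  apply: (le_integral_chord oO nu1).
  - exact/measurable_EFinP.
  - by move=> x; rewrite lee_fin.
  - exact/measurable_EFinP.
  - by move=> x; rewrite lee_fin.
  - by apply: filterS goodl => y /line[].
by move: E EP EM; rewrite !ge0_integral_EFinD// !ge0_integral_EFinM.
Qed.

Section swap.
Variable F : 'rV[R]_n.+1 -> 'rV[R]_n.+1 -> R.
Hypothesis mF : measurable_fun setT (fun z : 'rV[R]_n.+1 * 'rV[R]_n.+1 => F z.1 z.2).
Hypothesis F0 : forall nu x, (0 <= F nu x)%R.

Let mFE : measurable_fun setT (fun z : 'rV[R]_n.+1 * 'rV[R]_n.+1 => (F z.1 z.2)%:E).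
Proof. exact/measurable_EFinP. Qed.
Let FE0 z : 0 <= (F z.1 z.2)%:E. Proof. by rewrite lee_fin. Qed.

Lemma sphere_domain_swap : \int[sg]_(nu in usphere) \int[lam]_(x in Omega) (F nu x)%:E =
  \int[lam]_(x in Omega) \int[sg]_(nu in usphere) (F nu x)%:E.
Proof. exact: (tonelli_on sg lam mS mO mFE FE0). Qed.

Lemma measurable_integral_domain :
  measurable_fun usphere (fun nu => \int[lam]_(x in Omega) (F nu x)%:E).
Proof.
apply/(measurable_restrictT _ mS).
exact: (measurable_integral_on lam mS mO mFE FE0).
Qed.

End swap.

Lemma at_rho_cutoff (c : R) (f : R -> R) nu x : Omega x -> ~ bad Omega nu x ->
  at_rho c f (rho Omega nu x) =
  at_rho c (cutoff Rad f) (mine (reach Omega nu x) (reach Omega (- nu)%R x)).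
Proof.
move=> Ox /not_bad_rho; rewrite -rho_reach => rR.
have : 0 < rho Omega nu x by rewrite rho_reach lt_min !reach_gt0.
move: rR; case: (rho Omega nu x) => [r||] //= [//|rR] r0.
by rewrite cutoffE.
Qed.

Let good_at x := Omega x -> sg (usphere `&` [set nu | bad Omega nu x]) = 0.

Let mbad x : measurable (usphere `&` [set nu | bad Omega nu x]).
Proof.
apply: measurableI => //; apply: measurable_bad => //; exact: measurable_cst.
Qed.

Let eq_integral_good x (F G : 'rV[R]_n.+1 -> \bar R) : Omega x -> good_at x ->
  (forall nu, usphere nu -> ~ bad Omega nu x -> F nu = G nu) ->
  \int[sg]_(nu in usphere) F nu = \int[sg]_(nu in usphere) G nu.
Proof.
move=> Ox gx FG; apply: (integral_off_null mS (mbad x) (gx Ox)) => nu nu1 nb.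
by apply: FG => // b; apply: nb.
Qed.

Let mcut (f : R -> R) (c : R) x : (forall r, interval0 Rad r -> {for r, continuous f}) ->
  measurable_fun setT (fun nu =>
    at_rho c (cutoff Rad f) (mine (reach Omega nu x) (reach Omega (- nu)%R x))).
Proof.
move=> cf; apply: measurable_at_rho; first exact: measurable_cutoff.
apply: measurable_mine.
  by apply: measurable_reach2 => //; exact: measurable_cst.
by apply: measurable_reachN2 => //; exact: measurable_cst.
Qed.

Let VVc r : interval0 Rad r -> {for r, continuous V}.
Proof. exact: C1_on_continuous. Qed.
Let WWc r : interval0 Rad r -> {for r, continuous W}.
Proof. exact: C1_on_continuous. Qed.

(** Rests on |cos(nu, grad u)| |grad u| = |d_nu u|. Where the gradient is 0 the angle has no
    meaning, but both sides vanish. *)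
Lemma mean_cos_grad x : Omega x -> good_at x ->
  mean_cos p Vinf V Omega (grad u x) x * (enorm (grad u x) `^ p)%:E =
  \int[sg]_(nu in usphere) (FA nu x)%:E.
Proof.
move=> Ox gx; have dE nu : 'D_nu u x = dotp nu (grad u x).
  by apply: derive_grad; exact: (test_differentiable tu).
have [g0|g0] := eqVneq (enorm (grad u x)) 0%R.
  rewrite g0 powR0 ?gt_eqF ?(lt_trans _ p1)// mule0.
  apply/esym/integral0_eq => nu _; rewrite /FA dE (enorm_eq0 g0).
  rewrite /dotp big1 ?iA0// => i _; by rewrite mxE mulr0.
rewrite /mean_cos muleC (eq_integral_good (G := fun nu => (at_rho Vinf (cutoff Rad V) (mine (reach Omega nu x) (reach Omega (- nu)%R x)) * `|cosang nu (grad u x)| `^ p)%:E) Ox gx); last first.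
  by move=> nu nu1 nb; rewrite at_rho_cutoff.
rewrite -ge0_integral_EFinM//; last 3 first.
- apply: measurable_funM; first exact: (mcut _ _ VVc).
  have h : measurable_fun setT (fun r : R => `|r| `^ p)%R.
    by apply: continuous_measurable_fun; exact: continuous_norm_powR.
  exact: (measurableT_comp h (measurable_cosang _)).
- by move=> nu; rewrite mulr_ge0 ?powR_ge0// (at_rhoV_ge0 VW0).
- exact: powR_ge0.
apply: eq_integral => nu /set_mem nu1; congr EFin; rewrite mulrCA /FA /iA; congr (_ * _)%R.
rewrite -powRM ?sqrtr_ge0// dE; congr (_ `^ _)%R.
rewrite /cosang nu1 mul1r normrM normfV (ger0_norm (sqrtr_ge0 _)) mulrC.
by rewrite divfK.
Qed.

Lemma mean_W x : Omega x -> good_at x ->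
  mean 0 W Omega x * (`|u x| `^ p)%:E = \int[sg]_(nu in usphere) (FB nu x)%:E.
Proof.
move=> Ox gx; rewrite /mean muleC (eq_integral_good (G := fun nu => (at_rho 0 (cutoff Rad W) (mine (reach Omega nu x) (reach Omega (- nu)%R x)))%:E) Ox gx); last first.
  by move=> nu nu1 nb; rewrite at_rho_cutoff.
rewrite -ge0_integral_EFinM//; last 2 first.
- exact: (mcut _ _ WWc).
- by move=> nu; rewrite (at_rhoW_ge0 VW0).
by apply: eq_integral => nu _; rewrite mulrC.
Qed.

(** The counterpart of [FA] with the full gradient in place of the derivative along [nu]; it
    dominates [FA] by Cauchy-Schwarz. *)
Definition FV nu x : R := (at_rho Vinf (cutoff Rad V) (mine (reach Omega nu x) (reach Omega (- nu)%R x)) *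
  enorm (grad u x) `^ p)%R.

Lemma mean_V x : Omega x -> good_at x ->
  mean Vinf V Omega x * (enorm (grad u x) `^ p)%:E = \int[sg]_(nu in usphere) (FV nu x)%:E.
Proof.
move=> Ox gx; rewrite /mean muleC (eq_integral_good (G := fun nu => (at_rho Vinf (cutoff Rad V) (mine (reach Omega nu x) (reach Omega (- nu)%R x)))%:E) Ox gx); last first.
  by move=> nu nu1 nb; rewrite at_rho_cutoff.
rewrite -ge0_integral_EFinM//; last 3 first.
- exact: (mcut _ _ VVc).
- by move=> nu; rewrite (at_rhoV_ge0 VW0).
- exact: powR_ge0.
by apply: eq_integral => nu _; rewrite mulrC.
Qed.

Lemma FA_le_FV nu x : usphere nu -> (FA nu x <= FV nu x)%R.
Proof.
move=> nu1; rewrite /FA /iA /FV ler_wpM2l ?(at_rhoV_ge0 VW0)//.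
rewrite ge0_ler_powR ?nnegrE ?sqrtr_ge0//; first by rewrite ltW// (lt_trans _ p1).
by rewrite derive_grad; [exact: usphere_dotp_le|exact: (test_differentiable tu)].
Qed.

Let A0 nu x : (0 <= FA nu x)%R. Proof. exact: FA_ge0. Qed.
Let B0 nu x : (0 <= FB nu x)%R. Proof. exact: FB_ge0. Qed.
Let V0 nu x : (0 <= FV nu x)%R.
Proof. by rewrite mulr_ge0 ?powR_ge0// (at_rhoV_ge0 VW0). Qed.

Let mgrad : measurable_fun setT (fun x => enorm (grad u x) `^ p)%R.
Proof.
have h : measurable_fun setT (fun r : R => `|r| `^ p)%R.
  by apply: continuous_measurable_fun; exact: continuous_norm_powR.
have mg : measurable_fun setT (grad u).
  apply: measurable_fun_rV => i.
  apply: (eq_measurable_fun (partial i u)) => [x _|]; first by rewrite /coord_rV /= mxE.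
  by apply: continuous_measurable_rV; exact: (partial_continuous tu).
apply: eq_measurable_fun (measurableT_comp h (measurableT_comp (@measurable_enorm R n.+1) mg)) => x _.
by rewrite /= ger0_norm// sqrtr_ge0.
Qed.

Let mFV : measurable_fun setT (fun z : 'rV[R]_n.+1 * 'rV[R]_n.+1 => FV z.1 z.2).
Proof.
apply: measurable_funM; last exact: (measurableT_comp mgrad msnd).
apply: measurable_at_rho; first by apply: measurable_cutoff => r; exact: C1_on_continuous.
by apply: measurable_mine; [exact: measurable_reach2|exact: measurable_reachN2].
Qed.

Let mFA := measurable_FA mfst msnd.
Let mFB := measurable_FB mfst msnd.

Lemma integral_mean_cos_grad :
  \int[lam]_(x in Omega) (mean_cos p Vinf V Omega (grad u x) x * (enorm (grad u x) `^ p)%:E) =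
  \int[sg]_(nu in usphere) \int[lam]_(x in Omega) (FA nu x)%:E.
Proof.
rewrite (sphere_domain_swap mFA A0); apply: (eq_integral_ae mO).
apply: filterS (ae_null_bad_sphere oO) => x gx Ox.
exact: (mean_cos_grad Ox gx).
Qed.

Lemma integral_mean_W :
  \int[lam]_(x in Omega) (mean 0 W Omega x * (`|u x| `^ p)%:E) =
  \int[sg]_(nu in usphere) \int[lam]_(x in Omega) (FB nu x)%:E.
Proof.
rewrite (sphere_domain_swap mFB B0); apply: (eq_integral_ae mO).
apply: filterS (ae_null_bad_sphere oO) => x gx Ox.
exact: (mean_W Ox gx).
Qed.

Lemma integral_mean_V_ge :
  \int[sg]_(nu in usphere) \int[lam]_(x in Omega) (FA nu x)%:E <=
  \int[lam]_(x in Omega) (mean Vinf V Omega x * (enorm (grad u x) `^ p)%:E).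
Proof.
have -> : \int[lam]_(x in Omega) (mean Vinf V Omega x * (enorm (grad u x) `^ p)%:E) =
    \int[sg]_(nu in usphere) \int[lam]_(x in Omega) (FV nu x)%:E.
  rewrite (sphere_domain_swap mFV V0); apply: (eq_integral_ae mO).
  apply: filterS (ae_null_bad_sphere oO) => x gx Ox.
  exact: (mean_V Ox gx).
apply: ge0_le_integral => //.
- by move=> nu _; apply: integral_ge0 => x _; rewrite lee_fin.
- exact: (measurable_integral_domain mFA A0).
- exact: (measurable_integral_domain mFV V0).
move=> nu nu1; apply: ge0_le_integral => //.
- by move=> x _; rewrite lee_fin.
- apply/measurable_EFinP; apply: measurable_funTS.
  by apply: (measurable_FA (nu := fun=> nu)).
- apply/measurable_EFinP; apply: measurable_funTS.
  exact: (measurableT_comp mFV (measurable_fun_pair (mcst nu) mid_)).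
by move=> x _; rewrite lee_fin; apply: (FA_le_FV) => //.
Qed.

(** If the mean is the same for all unit vectors, then at each x the vector [e] may be replaced by
    the normalized gradient, and the angle does not see the normalization. Where the gradient is 0
    the integrands are 0. *)
Lemma mean_cos_direction e : (forall e' x, usphere e' -> Omega x ->
    mean_cos p Vinf V Omega e' x = mean_cos p Vinf V Omega e x) ->
  \int[lam]_(x in Omega) (mean_cos p Vinf V Omega e x * (enorm (grad u x) `^ p)%:E) =
  \int[lam]_(x in Omega) (mean_cos p Vinf V Omega (grad u x) x * (enorm (grad u x) `^ p)%:E).
Proof.
move=> He; apply: eq_integral => x /set_mem Ox.
have [g0|g0] := eqVneq (enorm (grad u x)) 0%R.
  have -> : (enorm (grad u x) `^ p)%:E = 0 by rewrite g0 powR0 ?gt_eqF ?(lt_trans _ p1).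
  by transitivity (0 : \bar R); [exact: mule0|exact/esym/mule0].
have gp : (0 < (enorm (grad u x))^-1)%R by rewrite invr_gt0 lt_neqAle eq_sym g0 sqrtr_ge0.
suff E : mean_cos p Vinf V Omega e x = mean_cos p Vinf V Omega (grad u x) x.
  exact: (congr1 (fun z => z * (enorm (grad u x) `^ p)%:E) E).
transitivity (mean_cos p Vinf V Omega ((enorm (grad u x))^-1 *: grad u x)%R x).
  by apply/esym/He => //; rewrite /usphere /= enormZ gtr0_norm// mulVf.
by apply: eq_integral => nu _; rewrite cosangZr.
Qed.

(** The integrands agree off two null sets: the bad points, where the cut-off may differ, and the
    midpoints, where [derive_quotient] fails. *)
Lemma integral_Cp :
  \int[sg]_(nu in usphere) \int[lam]_(x in Omega)
      (at_rho Vinf V (rho Omega nu x) *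
       Cp p ('D_nu u x)
         (at_rho 1 phi (rho Omega nu x) *
          'D_nu (fun z => u z / at_rho 1 phi (rho Omega nu z)) x))%R%:E =
  \int[sg]_(nu in usphere) \int[lam]_(x in Omega) (FC nu x)%:E.
Proof.
apply: (eq_integral_ae mS); apply: filterS (ae_null_bad oO) => nu bad0 nu1.
pose M := Omega `&` [set x | reach Omega nu x = reach Omega (- nu)%R x /\ reach Omega nu x < +oo].
have mr := measurable_reach2 oO (mcst nu) mid_.
have mrN := measurable_reachN2 oO (mcst nu) mid_.
have mM : measurable M.
  apply: measurableI => //; apply: measurableI; rewrite -[X in measurable X]setTI.
    exact: measurable_eqe.
  exact: measurable_lte.
have mB : measurable (Omega `&` bad Omega nu).
  by apply: measurableI => //; exact: (measurable_bad oO (mcst nu) mid_).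
apply: (integral_off_null mO (measurableU _ _ mB mM)).
  by rewrite measureU0//; [exact: bad0|exact: (null_midpoints oO nu1)].
move=> x Ox /not_orP[nb nM].
have {}nb : ~ bad Omega nu x by move=> b; exact: nb.
rewrite /FC /iC (at_rho_cutoff _ _ Ox nb); congr (EFin (_ * Cp _ _ _)%R).
rewrite (derive_quotient sol oO (test_differentiable tu) Ox) ?rho_reach//.
- have [E|] := eqVneq (reach Omega nu x) (reach Omega (- nu)%R x); [right|by left].
  apply: contrapT => fin; apply: nM; split => //; split => //.
  by rewrite ltey; apply/eqP.
- by rewrite -rho_reach; exact: (not_bad_rho nb).
Qed.

(** * The skeletal mean of the flux *)

Section skeletal_mean.
Hypothesis OT : Omega != setT.
Variable mu : 'rV[R]_n.+1 -> {measure set 'rV[R]_n.+1 -> \bar R}.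
Hypothesis mu_skel : forall nu, usphere nu -> skeletal_measure Omega nu (mu nu).

Section fixed_direction.
Variable nu : 'rV[R]_n.+1.
Hypothesis nu1 : usphere nu.
Hypothesis bad0 : lam (Omega `&` bad Omega nu) = 0.

Let mrho : measurable_fun [set: 'rV[R]_n.+1] (rho Omega nu).
Proof.
apply: (eq_measurable_fun (fun x => mine (reach Omega nu x) (reach Omega (- nu)%R x))) => [x _|].
  by rewrite rho_reach.
by apply: measurable_mine; [exact: measurable_reach2|exact: measurable_reachN2].
Qed.

Let mpow : measurable_fun setT (fun x => `|u x| `^ p)%R.
Proof.
have h : measurable_fun setT (fun r : R => `|r| `^ p)%R.
  by apply: continuous_measurable_fun; exact: continuous_norm_powR.
apply: (measurableT_comp h); apply: continuous_measurable_rV.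
exact: (test_continuous tu).
Qed.

Let h m := (at_rho 0 (cutoff Rad (flux p V phi)) (rho Omega nu m) * `|u m| `^ p)%R.
Let mh : measurable_fun setT h.
Proof.
apply: measurable_funM => //; apply: measurable_at_rho => //.
by apply: measurable_cutoff => r; exact: (continuous_flux p1 sol).
Qed.

Let hmid x : Omega x -> FS nu x = (wt Omega nu x * h (midp Omega nu x))%R.
Proof.
move=> Ox; rewrite /FS /skel /wt /h; have := rho_midp (nu := nu) oO Ox.
case: (reach Omega nu x + reach Omega (- nu)%R x) => [l /(_ l erefl) -> /=|_|_] /=.
- by rewrite mulrA (mulrC _ l^-1%R).
- by rewrite !mul0r.
- by rewrite !mul0r.
Qed.

Let mskel : measurable (skeleton Omega nu).
Proof.
apply: measurableI => //.
by apply: measurable_closedrV; exact: closed_closure.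
Qed.

Let p0 : p != 0%R. Proof. by rewrite gt_eqF// (lt_trans _ p1). Qed.

(** The integrand equals its cut-off [h] almost everywhere for the skeletal measure. By [hmid], [FS]
    is [wt] times [h] at the midpoint, so [skeletal_integral] applies to the positive and negative
    parts of [h]. *)
Lemma skeletal_integral_flux :
  \int[mu nu]_(m in skeleton Omega nu) (at_rho 0 (fun r =>
      V r * signed_pow p (derive1 phi r / phi r)) (rho Omega nu m) * `|u m| `^ p)%R%:E =
  \int[lam]_(x in Omega) (FP nu x)%:E - \int[lam]_(x in Omega) (FM nu x)%:E.
Proof.
have [G [oG KG cG GO]] := compact_thicken tu.2.1 oO tu.2.2.
have uG m : ~ G m -> u m = 0%R.
  by move=> Gm; apply: contrapT => um; apply: Gm; apply: KG; apply: subset_closure => /=; exact/eqP.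
have skI := skeletal_integral oO OT nu1 (mu_skel nu1) oG cG GO.
(* Within [G], the only points of the skeleton where the cut-off can matter. A segment whose
   midpoint lies in [Z] has half-length at least [Rad], so its points are bad; carried over to
   [Omega] by [skI], this shows that [Z] is null for the skeletal measure. *)
pose Z := G `&` [set m | Rad <= rho Omega nu m /\ rho Omega nu m < +oo].
have mZ : measurable Z.
  apply: measurableI; first exact: measurable_openrV.
  apply: measurableI; rewrite -[X in measurable X]setTI.
    exact: measurable_lee.
  exact: measurable_lte.
have Z0 : mu nu (skeleton Omega nu `&` Z) = 0.
  rewrite setIC -integral_indic// skI; last 3 first.
  - exact: measurable_indic.
  - by move=> x; rewrite indicE.
  - by move=> x Gx; rewrite indicE memNset// => -[].
  transitivity (\int[lam]_(x in Omega) (0 : \bar R)); last exact: integral0.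
  apply: (integral_off_null mO (N := Omega `&` bad Omega nu)) => //.
    by apply: measurableI => //; exact: (measurable_bad oO (mcst nu) mid_).
  move=> x Ox nb; have {}nb : ~ bad Omega nu x by move=> b; exact: nb.
  rewrite indicE; case: (boolP (_ \in _)) => [/set_mem[_ [/= Rr _]]|_]; last by rewrite mulr0.
  rewrite /wt; have := rho_midp (nu := nu) oO Ox; have := not_bad_gap nb.
  case: (reach Omega nu x + reach Omega (- nu)%R x) => [l H /(_ l erefl) E|_ _|_ _] /=; rewrite ?mul0r//.
  case: H => [|RE]; last by move: Rr; rewrite E RE leNgt ltry.
  by move: Rr; rewrite E => Rr lt; move: (lt_le_trans lt Rr); rewrite -EFinM mulrC ltxx.
transitivity (\int[mu nu]_(m in skeleton Omega nu) (h m)%:E).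
  apply: (integral_off_null mskel (measurableI _ _ mskel mZ) Z0) => m sm nZ.
  have [Gm|/uG um] := pselect (G m); last by rewrite /h um normr0 powR0// !mulr0.
  have Om : Omega m by case: sm.
  have r0 : 0 < rho Omega nu m by rewrite rho_reach lt_min !reach_gt0.
  rewrite /h; congr (EFin (_ * _)%R); move: nZ r0; rewrite /Z /=; case: (rho Omega nu m) => [r||] //= nZ r0.
  rewrite cutoffE//; split => //; rewrite ltNge; apply/negP => Rr.
  by apply: nZ; split => //; split => //; rewrite ltry.
rewrite integralE; congr (_ - _).
- transitivity (\int[mu nu]_(m in skeleton Omega nu) (Num.max (h m) 0)%:E).
    by apply: eq_integral => m _; rewrite funeposE EFin_max.
  rewrite skI; last 3 first.
  + exact: measurable_maxr.
  + by move=> x; rewrite le_max lexx orbT.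
  + by move=> x /uG ux; rewrite /h ux normr0 powR0// mulr0 maxxx.
  apply: eq_integral => x /set_mem Ox; rewrite /FP hmid//.
  by rewrite maxr_pMr ?wt_ge0// mulr0.
- transitivity (\int[mu nu]_(m in skeleton Omega nu) (Num.max (- h m) 0)%:E).
    by apply: eq_integral => m _; rewrite funenegE EFin_max.
  rewrite skI; last 3 first.
  + by apply: measurable_maxr => //; exact: measurableT_comp.
  + by move=> x; rewrite le_max lexx orbT.
  + by move=> x /uG ux; rewrite /h ux normr0 powR0// mulr0 oppr0 maxxx.
  apply: eq_integral => x /set_mem Ox; rewrite /FM hmid//.
  by rewrite maxr_pMr ?wt_ge0// mulr0 mulrN.
Qed.

End fixed_direction.

Lemma skeletal_mean_flux :
  skeletal_mean Omega mu (fun nu m =>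
    at_rho 0 (fun r => V r * signed_pow p (derive1 phi r / phi r)) (rho Omega nu m)
      * `|u m| `^ p)%R =
  \int[sg]_(nu in usphere)
    (\int[lam]_(x in Omega) (FP nu x)%:E - \int[lam]_(x in Omega) (FM nu x)%:E).
Proof.
apply: (eq_integral_ae mS); apply: filterS (ae_null_bad oO) => nu bad0 nu1.
by rewrite skeletal_integral_flux// bad0.
Qed.

End skeletal_mean.

End gap.

(** * Integrability of the negative part when the essential diameter is finite *)

Section finite_skeletal_term.
Hypothesis gap : 2^-1%:E * ess_diam Omega < Rad.

Lemma test_bounded : exists2 U : R, (0 <= U)%R & forall x, (`|u x| `^ p <= U)%R.
Proof.
have cu : continuous u by exact: (test_continuous tu).
have : compact (u @` tsupp u).
  by apply: continuous_compact; [exact: continuous_subspaceT|exact: tu.2.1].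
move=> /compact_bounded[B0 [_ UB]]; have uB : forall y, (u @` tsupp u) y -> (`|y| <= B0 + 1)%R.
  by apply: UB; rewrite ltrDl.
exists (Num.max 0 (B0 + 1) `^ p)%R => [|x]; first exact: powR_ge0.
apply: ge0_ler_powR; rewrite ?nnegrE ?le_max ?lexx ?normr_ge0//.
  by rewrite ltW// (lt_trans _ p1).
have [xK|/(derive_off_tsupp 0%R)[-> _]] := pselect (tsupp u x); last by rewrite normr0 lexx.
by rewrite (uB (u x)) ?orbT//; exists x.
Qed.

(** If [u] does not vanish at the midpoint, the half-length of the segment exceeds [delta], and off
    bad points it is at most [r1] < [Rad]. On [delta, r1] the continuous flux is bounded by [Q]; the
    inverse length is at most 1/(2 delta), and |u|^p is at most [U]. *)
Lemma FM_bounded : exists (K B : R), [/\ (0 <= K)%R, (0 <= B)%R &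
  forall nu x, usphere nu -> Omega x -> ~ bad Omega nu x ->
    (FM nu x <= K * \1_[set x : 'rV[R]_n.+1 | forall i, (- B <= x ord0 i <= B)] x)%R].
Proof.
have [delta d0 reach_d] := reach_tsupp.
have [U U0 uU] := test_bounded.
pose r1 := fine (2^-1%:E * ess_diam Omega).
have [Q Q0 QP] : exists2 Q : R, (0 <= Q)%R & forall r, (delta <= r <= r1)%R ->
    (r%:E < Rad)%E -> (r1%:E < Rad)%E -> (`|flux p V phi r| <= Q)%R.
  have [r1R|r1R] := pselect (r1%:E < Rad); last by exists 0%R.
  have : compact (flux p V phi @` `[delta, r1]%classic).
    apply: continuous_compact; last exact: segment_compact.
    apply: continuous_in_subspaceT => r; rewrite inE /= in_itv /= => /andP[dr rr].
    apply: (continuous_flux p1 sol); split; first exact: lt_le_trans dr.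
    by rewrite (le_lt_trans _ r1R)// lee_fin.
  move=> /compact_bounded[B0 [_ UB]].
  have qB : forall y, (flux p V phi @` `[delta, r1]%classic) y -> (`|y| <= B0 + 1)%R.
    by apply: UB; rewrite ltrDl.
  exists (Num.max 0 (B0 + 1))%R => [|r dr _ _]; first by rewrite le_max lexx.
  by rewrite le_max qB ?orbT//; exists r => //; rewrite /= in_itv.
have [B0 [_ KB]] := compact_bounded tu.2.1.
have KB1 : forall y, tsupp u y -> (`|y| <= B0 + 1)%R by apply: KB; rewrite ltrDl.
(* The midpoint is in the bounded support of [u], and x is at distance at most [r1] from it in sup
   norm. *)
pose B := (Num.max 0 (B0 + 1) + Num.max 0 r1)%R.
have r10 : (0 <= Num.max 0 r1)%R by rewrite le_max lexx.
have B10 : (0 <= Num.max 0 (B0 + 1))%R by rewrite le_max lexx.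
exists (Q / (2 * delta) * U)%R, B; split.
- by rewrite mulr_ge0// divr_ge0// mulr_ge0// ltW.
- by rewrite addr_ge0.
move=> nu x nu1 Ox nb; set box := mkset _.
have KK0 : (0 <= Q / (2 * delta) * U * \1_box x)%R.
  by rewrite !mulr_ge0// invr_ge0 mulr_ge0// ltW.
rewrite /FM ge_max KK0 andbT; apply: le_trans (ler_norm _) _; rewrite normrN.
rewrite /FS; have [umK|/(derive_off_tsupp 0%R)[-> _]] := pselect (tsupp u (midp Omega nu x)); last first.
  by rewrite skel0// normr0.
rewrite /skel; move/negP: nb; rewrite -leNgt.
have := rho_midp (nu := nu) oO Ox.
have [a0 b0] := (reach_ge0 Omega nu x, reach_ge0 Omega (- nu)%R x).
case Ea : (reach Omega nu x) a0 => [a||] // a0; case Eb : (reach Omega (- nu)%R x) b0 => [b||] // b0;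
  rewrite /= ?mul0r ?normr0// => /(_ (a + b)%R erefl) rm.
rewrite lee_fin in a0; rewrite lee_fin in b0.
rewrite -EFinD -EFinM mulrC => le.
have DE : 2^-1%:E * ess_diam Omega = r1%:E.
  move: le gap; rewrite /r1; case: (2^-1%:E * ess_diam Omega) => [r||] //= _.
  by rewrite ltNge leey.
have r1R : r1%:E < Rad by rewrite -DE.
rewrite DE lee_fin in le.
have nuN : (`|nu| <= 1)%R by rewrite (le_trans (norm_le_enorm _))// nu1.
have dl : (delta < (a + b) / 2)%R.
  rewrite -lte_fin -rm rho_reach lt_min; apply/andP; split; rewrite ltNge; apply/negP => H.
    exact: (reach_d nu _ nuN H).
  by apply: (reach_d (- nu)%R _ _ H umK); rewrite normrN.
have ab0 : (0 < (a + b) / 2)%R by exact: lt_trans dl.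
have lR : ((a + b) / 2)%:E < Rad by rewrite (le_lt_trans _ r1R)// lee_fin.
have -> : \1_box x = 1%R :> R.
  rewrite indicE mem_set// => i; rewrite -ler_norml (le_trans (coord_le_norm x i))//.
  have -> : x = (midp Omega nu x - mid_shift a%:E b%:E *: nu)%R by rewrite /midp Ea Eb addrK.
  apply: le_trans (ler_normB _ _) _; apply: lerD; first by rewrite le_max KB1 ?orbT.
  rewrite normrZ (@le_trans _ _ `|(a - b) / 2|%R) ?ler_piMr//.
  by rewrite le_max; apply/orP; right; apply: le_trans le; rewrite ler_norml; apply/andP; split; lra.
rewrite cutoffE// mulr1.
have := QP ((a + b) / 2)%R; move: (flux p V phi _) => q Qq.
rewrite 2!normrM (ger0_norm (powR_ge0 _ _)) normfV.
rewrite ler_pM ?mulr_ge0 ?invr_ge0 ?powR_ge0//.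
rewrite ler_pM ?invr_ge0//; first by apply: Qq => //; rewrite (ltW dl).
rewrite ger0_norm ?addr_ge0// lef_pV2 ?posrE ?mulr_gt0//; lra.
Qed.

Lemma integral_FM_finite :
  \int[sg]_(nu in usphere) \int[lam]_(x in Omega) (FM nu x)%:E < +oo.
Proof.
have [K [B [K0 B0 KB]]] := FM_bounded.
pose box := [set x : 'rV[R]_n.+1 | forall i, (- B <= x ord0 i <= B)%R].
have mbox : measurable box by exact: measurable_cube.
have mFM := measurable_FM mfst msnd.
have M0 nu x : (0 <= FM nu x)%R by exact: FM_ge0.
pose c := (K * (B - - B) ^+ n.+1)%R.
have c0 : (0 <= c)%R by rewrite mulr_ge0// exprn_ge0// opprK addr_ge0.
apply: (@le_lt_trans _ _ (\int[sg]_(nu in usphere) c%:E)); last first.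
  by rewrite integral_cst// lte_mul_pinfty ?lee_fin// ltey_eq fin_num_measure.
apply: ae_ge0_le_integral => //.
- by move=> nu _; apply: integral_ge0 => x _; rewrite lee_fin.
- exact: (measurable_integral_domain mFM M0).
apply: filterS (ae_null_bad oO) => nu bad0 nu1.
have -> : c%:E = \int[lam]_x (K * \1_box x)%:E.
  rewrite ge0_integral_EFinM//.
  have BB : (- B <= B)%R by rewrite (@le_trans _ _ 0%R)// oppr_le0.
  transitivity (K%:E * lam box); last by rewrite integral_indic// setIT.
  by rewrite (lebesgue_rV_box n.+1 BB) EFinM.
rewrite integral_mkcond; apply: ae_ge0_le_integral => //.
- by move=> x _; rewrite patchE; case: ifP => // _; rewrite lee_fin.
- apply/(measurable_restrictT _ mO); apply/measurable_EFinP/measurable_funTS.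
  exact: (measurable_FM (mcst nu) mid_).
- by move=> x _; rewrite lee_fin mulr_ge0.
- by apply/measurable_EFinP; apply: measurable_funM.
exists (Omega `&` bad Omega nu); split.
- by apply: measurableI => //; exact: (measurable_bad oO (mcst nu) mid_).
- exact: bad0.
move=> x /= /not_implyP[_ H]; apply: contrapT => nOb; apply: H.
rewrite patchE; case: ifPn => [/set_mem Ox|_]; last by rewrite lee_fin mulr_ge0.
by rewrite lee_fin KB// => b; apply: nOb.
Qed.

End finite_skeletal_term.

End bessel_identity.

(** * Recombining the two parts of the skeletal term in the extended reals *)

Section balance.
Context d (T : measurableType d) (R : realType) (mu : {measure set T -> \bar R}).
Variable D : set T.
Hypothesis mD : measurable D.

Lemma pos_neg_parts (x y : \bar R) : 0 <= x -> 0 <= y -> (x < +oo \/ y < +oo) ->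
  maxe (x - y) 0 + y = maxe (- (x - y)) 0 + x.
Proof.
have fin (a b : R) : maxe (a%:E - b%:E) 0 + b%:E = maxe (- (a%:E - b%:E)) 0 + a%:E.
  rewrite -EFinB -EFinN -[0]/(0%:E) -!EFin_max -!EFinD; congr EFin.
  by case: (leP (a - b)%R 0%R) => h1; case: (leP (- (a - b))%R 0%R) => h2; lra.
case: x => [x||] //; case: y => [y||] // x0 y0 [] // _.
- by rewrite /= maxNye maxye add0e addye.
- by rewrite /= maxNye maxye add0e addye.
Qed.

Let fin_ae (f : T -> \bar R) : measurable_fun D f -> (forall x, 0 <= f x) ->
  \int[mu]_(x in D) f x < +oo -> {ae mu, forall x, D x -> f x < +oo}.
Proof.
move=> mf f0 fi; have : mu.-integrable D f.
  apply/integrableP; split => //.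
  by under eq_integral do rewrite gee0_abs//.
move=> /(integrable_ae mD); apply: filterS => x H Dx.
by have := H Dx; rewrite ge0_fin_numE.
Qed.

Section integral_difference.
Variables P M : T -> \bar R.
Hypotheses (mP : measurable_fun D P) (mM : measurable_fun D M).
Hypotheses (P0 : forall x, 0 <= P x) (M0 : forall x, 0 <= M x).

(** The integral of P - M is by definition that of its positive part minus that of its negative
    part. These satisfy f^+ + M = f^- + P almost everywhere, with f^+ <= P and f^- <= M, so one
    finite integral suffices to rearrange. *)
Lemma ge0_integral_difference : \int[mu]_(x in D) P x < +oo \/ \int[mu]_(x in D) M x < +oo ->
  \int[mu]_(x in D) (P x - M x) = \int[mu]_(x in D) P x - \int[mu]_(x in D) M x.
Proof.
move=> fin; rewrite integralE; set f := (fun x => P x - M x).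
have mf : measurable_fun D f by exact: emeasurable_funB.
have mfp := measurable_funepos mf; have mfn := measurable_funeneg mf.
have fin' : {ae mu, forall x, D x -> P x < +oo \/ M x < +oo}.
  by case: fin => /fin_ae H; [apply: filterS (H mP P0)|apply: filterS (H mM M0)] => x h Dx;
    [left|right]; exact: h.
have E : \int[mu]_(x in D) f^\+ x + \int[mu]_(x in D) M x =
    \int[mu]_(x in D) f^\- x + \int[mu]_(x in D) P x.
  rewrite -!ge0_integralD//; apply: eq_integral_ae => //.
  apply: filterS fin' => x h Dx; rewrite funeposE funenegE.
  by apply: pos_neg_parts => //; exact: h.
have lep : \int[mu]_(x in D) f^\+ x <= \int[mu]_(x in D) P x.
  apply: ge0_le_integral => // x _.
  by rewrite funeposE ge_max P0 andbT /f -[leRHS]sube0 leeB.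
have len : \int[mu]_(x in D) f^\- x <= \int[mu]_(x in D) M x.
  apply: ge0_le_integral => // x _.
  rewrite funenegE ge_max M0 andbT /f.
  case: (P x) (P0 x) => [r||] //; case: (M x) (M0 x) => [q||] //= q0 r0; rewrite ?leNye ?leey//.
  by rewrite lee_fin opprB gerBl -lee_fin.
have X0 : 0 <= \int[mu]_(x in D) f^\+ x by exact: integral_ge0.
have Y0 : 0 <= \int[mu]_(x in D) f^\- x by exact: integral_ge0.
have PP0 : 0 <= \int[mu]_(x in D) P x by exact: integral_ge0.
have MM0 : 0 <= \int[mu]_(x in D) M x by exact: integral_ge0.
move: fin E lep len X0 Y0 PP0 MM0.
move: (\int[mu]_(x in D) f^\+ x) (\int[mu]_(x in D) f^\- x) (\int[mu]_(x in D) P x) (\int[mu]_(x in D) M x).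
case=> [X||] [Y||] [a||] [b||] //.
- by rewrite -!EFinD => _ [E] _ _ _ _ _ _; congr EFin; lra.
all: by case.
Qed.

End integral_difference.

Variables a b c P M : T -> \bar R.
Hypotheses (ma : measurable_fun D a) (mb : measurable_fun D b) (mc : measurable_fun D c).
Hypotheses (mP : measurable_fun D P) (mM : measurable_fun D M).
Hypotheses (a0 : forall x, 0 <= a x) (b0 : forall x, 0 <= b x) (c0 : forall x, 0 <= c x).
Hypotheses (P0 : forall x, 0 <= P x) (M0 : forall x, 0 <= M x).
Hypothesis abc : {ae mu, forall x, D x -> [/\ a x + 2%:E * M x = b x + c x + 2%:E * P x,
  2%:E * P x <= a x & 2%:E * M x <= b x + c x]}.
Local Notation I_ f := (\int[mu]_(x in D) f x).
Local Notation J := (\int[mu]_(x in D) (P x - M x)).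

Let two_oo : 2%:E * +oo = +oo :> \bar R.
Proof. by rewrite mulry gtr0_sg// mul1e. Qed.
Let two_Noo : 2%:E * -oo = -oo :> \bar R.
Proof. by rewrite mulrNy gtr0_sg// mul1e. Qed.

(** When M has a finite integral, J splits as a difference and the integrated identity is
    rearranged. Otherwise both sides of the claim are +oo: 2 M <= b + c makes the integral of b + c
    infinite, and the definedness of the sum excludes J = -oo. *)
Lemma balance : I_ M < +oo \/ ((I_ b + I_ c) +? (2%:E * J)) -> I_ a = I_ b + 2%:E * J + I_ c.
Proof.
have two0 : (0 <= 2 :> R)%R by [].
have I2 f : measurable_fun D f -> (forall x, 0 <= f x) -> I_ (fun x => 2%:E * f x) = 2%:E * I_ f.
  by move=> mf f0; rewrite ge0_integralZl_EFin.
have m2 f : measurable_fun D f -> measurable_fun D (fun x => 2%:E * f x).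
  by move=> mf; exact: measurable_funeM.
have p2 f : (forall x, 0 <= f x) -> forall x, 0 <= 2%:E * f x.
  by move=> f0 x; rewrite mule_ge0.
have bc0 x : 0 <= b x + c x by rewrite adde_ge0.
have mbc := emeasurable_funD mb mc.
have E : I_ a + 2%:E * I_ M = I_ b + I_ c + 2%:E * I_ P.
  rewrite -!I2// -!ge0_integralD//; [|by move=> x _; exact: p2|exact: m2|by move=> x _; exact: p2|exact: m2].
  by apply: eq_integral_ae => //; apply: filterS abc => x H /H[].
have leP_ : 2%:E * I_ P <= I_ a.
  rewrite -I2//; apply: ae_ge0_le_integral => //; [by move=> x _; exact: p2|exact: m2|].
  by apply: filterS abc => x H /H[].
have leM : 2%:E * I_ M <= I_ b + I_ c.
  rewrite -I2// -ge0_integralD//; apply: ae_ge0_le_integral => //; [by move=> x _; exact: p2|exact: m2|].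
  by apply: filterS abc => x H /H[].
have JE := ge0_integral_difference mP mM P0 M0.
have B0 : 0 <= I_ b by exact: integral_ge0.
have C0 : 0 <= I_ c by exact: integral_ge0.
have PP0 : 0 <= I_ P by exact: integral_ge0.
have MM0 : 0 <= I_ M by exact: integral_ge0.
have A0 : 0 <= I_ a by exact: integral_ge0.
move: E leP_ leM JE A0 B0 C0 PP0 MM0.
move: (I_ a) (I_ b) (I_ c) (I_ P) (I_ M) J => A B C X Y Z.
case: Y => [y||] //; rewrite ?two_oo => E leP_ leM JE A0 B0 C0 PP0 MM0; [move=> _|case=> // dZ].
  rewrite {}JE; last by right; rewrite ltry.
  move: A B C X E {leP_ leM} A0 B0 C0 PP0; case=> [A||] [B||] [C||] [X||] //; rewrite ?two_oo //.
  by rewrite -!EFinM -!EFinD => -[E] _ _ _ _; congr EFin; lra.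
(* A finite integral of [a] would bound that of P through 2 P <= a, and then J = -oo, contrary to
   definedness. *)
have AE : A = +oo.
  case: A A0 E leP_ => [A||] // A0 E leP_; move: dZ; rewrite JE; last first.
    by left; move: X leP_ {E JE} PP0 => [X||] //; rewrite ?ltry// two_oo.
  have -> : X - +oo = -oo by case: (X).
  by rewrite two_Noo; move: leM; case: B B0 {E} => [B||] //; case: C C0 => [C||] //.
have Z_neq : Z != -oo.
  apply/negP => /eqP ZE; move: dZ; rewrite ZE two_Noo.
  by move: leM; case: B B0 {E} => [B||] //; case: C C0 => [C||] //.
rewrite AE; move: leM Z_neq {dZ E}; case: B B0 => [B||] //; case: C C0 => [C||] //; case: Z {JE} => [Z||] //;
  by rewrite ?two_oo.
Qed.

(** If J = -oo the left-hand side is -oo. Otherwise its sum is defined, the remaining terms being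
    nonnegative, and [balance] gives equality. *)
Lemma balance_le : I_ b + 2%:E * J + I_ c <= I_ a.
Proof.
have B0 : 0 <= I_ b by exact: integral_ge0.
have C0 : 0 <= I_ c by exact: integral_ge0.
have [J_|J_] := eqVneq J -oo.
  by rewrite J_ two_Noo addeNy addNye leNye.
rewrite -balance//; right.
move: B0 C0 J_; move: (I_ b) (I_ c) J => B C Z.
by case: B => [B||] //; case: C => [C||] //; case: Z => [Z||] //; rewrite ?two_oo.
Qed.

End balance.

Theorem theorem3p16 (R : realType) (N : nat) (p : R)
    (Omega : set 'rV[R]_N) (Rad : \bar R) (V W phi : R -> R) (Vinf : R)
    (mu : 'rV[R]_N -> {measure set 'rV[R]_N -> \bar R}) :
  (2 <= N)%N -> (1 < p)%R ->
  domain Omega -> Omega != [set: 'rV[R]_N] ->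
  0 < Rad -> bessel_pair p Rad V W -> positive_solution p Rad V W phi ->
  (2^-1%:E * ess_diam Omega < Rad) \/ (ess_diam Omega = +oo /\ Rad = +oo) ->
  (0 <= Vinf)%R ->
  (forall nu, usphere nu -> skeletal_measure Omega nu (mu nu)) ->
  forall u : 'rV[R]_N -> R, test_function Omega u ->
  let V_tilde e x := mean_cos p Vinf V Omega e x in
  let V_mean x := mean Vinf V Omega x in
  let W_mean x := mean 0 W Omega x in
  let I_W := \int[lebesgue_rV N]_(x in Omega) (W_mean x * (`|u x| `^ p)%:E) in
  let I_S := skeletal_mean Omega mu (fun nu m =>
    at_rho 0 (fun r => V r * signed_pow p (derive1 phi r / phi r)) (rho Omega nu m)
      * `|u m| `^ p)%R in
  let I_C := \int[sphere_measure]_(nu in usphere)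
    \int[lebesgue_rV N]_(x in Omega)
      (at_rho Vinf V (rho Omega nu x) *
       Cp p ('D_nu u x)
         (at_rho 1 phi (rho Omega nu x) *
          'D_nu (fun z => u z / at_rho 1 phi (rho Omega nu z)) x))%R%:E in
  let rhs := I_W + 2%:E * I_S + I_C in
  (* the right-hand side is not of the form +oo - oo; automatic when the
     essential diameter is finite *)
  let rhs_defined := ess_diam Omega = +oo -> (I_W + I_C) +? (2%:E * I_S) in
  [/\ (* for a fixed direction e, when V_tilde does not depend on e *)
      rhs_defined ->
      forall e, usphere e ->
      (forall e' x, usphere e' -> Omega x -> V_tilde e' x = V_tilde e x) ->
      \int[lebesgue_rV N]_(x in Omega)
        (V_tilde e x * (enorm (grad u x) `^ p)%:E) = rhs,
      (* in general, with e the direction of the gradient of u at x *)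
      rhs_defined ->
      \int[lebesgue_rV N]_(x in Omega)
        (V_tilde (grad u x) x * (enorm (grad u x) `^ p)%:E) = rhs &
      rhs <= \int[lebesgue_rV N]_(x in Omega)
        (V_mean x * (enorm (grad u x) `^ p)%:E)].
Proof.
case: N Omega mu => [|n] Omega mu // _ p1 [oO _ _] OT Rad0 [VW0 V1 W1 _] sol gap Vinf0 mu_skel u tu.
move=> V_tilde V_mean W_mean I_W I_S I_C rhs rhs_defined.
pose lam := lebesgue_rV (R := R) n.+1.
pose A nu := \int[lam]_(x in Omega) (FA p Rad V Vinf Omega u nu x)%:E.
pose B nu := \int[lam]_(x in Omega) (FB p Rad W Omega u nu x)%:E.
pose C nu := \int[lam]_(x in Omega) (FC p Rad V phi Vinf Omega u nu x)%:E.
pose P nu := \int[lam]_(x in Omega) (FP p Rad V phi Omega u nu x)%:E.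
pose M nu := \int[lam]_(x in Omega) (FM p Rad V phi Omega u nu x)%:E.
have A0 nu : 0 <= A nu.
  by apply: integral_ge0 => x _; rewrite lee_fin (FA_ge0 _ VW0 Vinf0).
have B0 nu : 0 <= B nu.
  by apply: integral_ge0 => x _; rewrite lee_fin (FB_ge0 _ VW0).
have C0 nu : 0 <= C nu.
  by apply: integral_ge0 => x _; rewrite lee_fin (FC_ge0 _ p1 VW0 Vinf0).
have P0 nu : 0 <= P nu by apply: integral_ge0 => x _; rewrite lee_fin FP_ge0.
have M0 nu : 0 <= M nu by apply: integral_ge0 => x _; rewrite lee_fin FM_ge0.
have mfst : measurable_fun setT (@fst 'rV[R]_n.+1 'rV[R]_n.+1) by exact: measurable_fst.
have msnd : measurable_fun setT (@snd 'rV[R]_n.+1 'rV[R]_n.+1) by exact: measurable_snd.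
have mA : measurable_fun usphere A.
  apply: (measurable_integral_domain oO (measurable_FA Vinf p1 V1 oO tu mfst msnd)).
  by move=> nu x; exact: (FA_ge0 _ VW0 Vinf0).
have mB : measurable_fun usphere B.
  apply: (measurable_integral_domain oO (measurable_FB p1 W1 oO tu mfst msnd)).
  by move=> nu x; exact: (FB_ge0 _ VW0).
have mC : measurable_fun usphere C.
  apply: (measurable_integral_domain oO (measurable_FC Vinf p1 V1 sol oO tu mfst msnd)).
  by move=> nu x; exact: (FC_ge0 _ p1 VW0 Vinf0).
have mP : measurable_fun usphere P.
  apply: (measurable_integral_domain oO (measurable_FP p1 sol oO tu mfst msnd)).
  by move=> nu x; exact: FP_ge0.
have mM : measurable_fun usphere M.
  apply: (measurable_integral_domain oO (measurable_FM p1 sol oO tu mfst msnd)).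
  by move=> nu x; exact: FM_ge0.
have ident := domain_identity p1 VW0 V1 W1 sol Vinf0 oO tu gap.
have mS := @measurable_usphere R n.+1.
have WE : I_W = \int[sphere_measure]_(nu in usphere) B nu.
  exact: (integral_mean_W p1 VW0 W1 oO tu gap).
have CE : I_C = \int[sphere_measure]_(nu in usphere) C nu.
  exact: (integral_Cp Vinf sol oO tu gap).
have SE : I_S = \int[sphere_measure]_(nu in usphere) (P nu - M nu).
  exact: (skeletal_mean_flux p1 sol oO tu gap OT mu_skel).
have gradE : rhs_defined -> \int[lam]_(x in Omega)
    (V_tilde (grad u x) x * (enorm (grad u x) `^ p)%:E) = rhs.
  move=> def; rewrite /rhs WE CE SE.
  rewrite (integral_mean_cos_grad p1 VW0 V1 Vinf0 oO tu gap).
  apply: (balance mS mA mB mC mP mM A0 B0 C0 P0 M0 ident).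
  (* Either the essential diameter is finite and the negative part of the skeletal term is
     integrable, or definedness of the right-hand side is the assumption [def]. *)
  case: gap => [gap'|[Doo _]].
    by left; exact: (integral_FM_finite p1 sol oO tu gap').
  by right; move: (def Doo); rewrite WE CE SE.
split; [|exact: gradE|].
  move=> def e _ He; exact: (etrans (mean_cos_direction p1 u He) (gradE def)).
(* The mean without cosine dominates the integral of [FA], and [balance_le] compares the latter with
   the right-hand side without any definedness assumption. *)
apply: le_trans (integral_mean_V_ge p1 VW0 V1 Vinf0 oO tu gap).
rewrite /rhs WE CE SE.
exact: (balance_le mS mA mB mC mP mM A0 B0 C0 P0 M0 ident).
Qed.
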